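(* Let $M^4\subset\mathbb{C}^3$ be a local real analytic $4$-dimensional CR-generic submanifold passing through the origin, $0\in M^4$, which belongs to the General Class $\mathsf{II}$, i.e. such that for any local vector field generator $\mathcal{L}$ of $T^{1,0}M$, the four fields $$\Big\{\mathcal{L},\ \overline{\mathcal{L}},\ [\mathcal{L},\overline{\mathcal{L}}],\ \big[\mathcal{L},[\mathcal{L},\overline{\mathcal{L}}]\big]\Big\}$$ constitute a frame for $\mathbb{C}\otimes_{\mathbb{R}}TM$. Then $M$ may always be represented near the origin, in suitable local holomorphic coordinates $(z,w_1,w_2)\in\mathbb{C}^3$ (centered at the origin) with $w_j=u_j+\sqrt{-1}\,v_j$, by two real analytic equations of the form $$\begin{aligned} v_1&=z\overline{z}+z\overline{z}\,\mathrm{O}_2(z,\overline{z})+z\overline{z}\,\mathrm{O}_1(u_1)+z\overline{z}\,\mathrm{O}_1(u_2),\\ v_2&=z^2\overline{z}+z\overline{z}^2+z\overline{z}\,\mathrm{O}_2(z,\overline{z})+z\overline{z}\,\mathrm{O}_1(u_1)+z\overline{z}\,\mathrm{O}_1(u_2). \end{aligned}$$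
   Context: A real submanifold $M\subset\mathbb{C}^{N}$ is CR-generic if $T_pM+J\,T_pM=T_p\mathbb{C}^{N}$ for every $p\in M$, where $J$ is the standard complex structure. $T^{1,0}M$ denotes the bundle $T^{1,0}\mathbb{C}^3|_M\cap(\mathbb{C}\otimes_{\mathbb{R}}TM)$, here of complex rank $1$; $\overline{\mathcal{L}}$ is the conjugate field and $[\cdot,\cdot]$ the Lie bracket. ''Frame'' means a basis of the fiber at every point of the (local) manifold $M$. Remainder notation: $\mathrm{O}_k(t_1,\dots,t_N)$ denotes an unspecified convergent power series (with complex coefficients) in $t_1,\dots,t_N$ all of whose monomials have total degree $\geqslant k$. By convention $z\overline{z}\,\mathrm{O}_1(u_j)$ is shorthand for $z\overline{z}\,u_j\,\mathrm{O}_0(z,\overline{z},u_1,u_2)$. Different occurrences of a remainder symbol may denote different series. The right-hand sides of the graphing equations are real-valued convergent power series in $(z,\overline{z},u_1,u_2)$. *)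

(* Defs.v *)
From HB Require Import structures.
From mathcomp Require Import all_boot all_order all_algebra.
From mathcomp Require Import complex.
From mathcomp Require Import all_classical all_reals all_analysis.

Set Implicit Arguments.
Unset Strict Implicit.
Unset Printing Implicit Defensive.

Import Order.TTheory GRing.Theory Num.Theory.
Import numFieldNormedType.Exports.

Local Open Scope classical_set_scope.
Local Open Scope ring_scope.
Local Open Scope complex_scope.

(** * Convergent power series in several variables *)

(* The power series in [n] variables whose coefficient at the multi-index
   [al] is [a al]. *)
Definition mpseries (n : nat) (K : Type) := {ffun 'I_n -> nat} -> K.

Definition psum (n : nat) (K : numFieldType) (a : mpseries n K) (x : 'rV[K]_n)
    (m : nat) : K :=
  \sum_(al : {ffun 'I_n -> 'I_m})
    a [ffun i => al i : nat] * \prod_(i < n) x ord0 i ^+ al i.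

(* The sum of [a] at [x], as the limit of the partial sums over the boxes
   [0, m)^n; it is used only where the series converges absolutely. *)
Definition mpeval (n : nat) (K : numFieldType) (a : mpseries n K)
    (x : 'rV[K]_n) : K :=
  lim (psum a x @ \oo).

(* [a] converges absolutely on the closed polydisc of radius [r]. *)
Definition mpconverges (n : nat) (K : numFieldType) (r : K)
    (a : mpseries n K) : Prop :=
  exists B : K, forall m : nat, psum (fun al => `|a al|) (const_mx r) m <= B.

(* All the monomials of [a] have total degree at least [k]. *)
Definition mporder_ge (n : nat) (K : numFieldType) (k : nat)
    (a : mpseries n K) : Prop :=
  forall al : {ffun 'I_n -> nat}, (\sum_(i < n) al i < k)%N -> a al = 0.

Definition row_of_seq (n : nat) (K : nmodType) (s : seq K) : 'rV[K]_n :=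
  \row_(i < n) s`_i.

(** * Real analytic submanifolds of R^n *)

Definition analytic_at (R : realType) (n : nat) (f : 'rV[R]_n -> R)
    (p : 'rV[R]_n) : Prop :=
  exists (r : R) (a : mpseries n R),
    [/\ 0 < r, mpconverges r a &
        forall x : 'rV[R]_n, `|x - p| < r -> f x = mpeval a (x - p)].

Definition analytic_on (R : realType) (n m : nat) (W : set 'rV[R]_n)
    (f : 'rV[R]_n -> 'rV[R]_m) : Prop :=
  forall p, W p -> forall j : 'I_m, analytic_at (fun x => f x ord0 j) p.

Definition analytic_submanifold (R : realType) (n d : nat)
    (M : set 'rV[R]_n) : Prop :=
  (d <= n)%N /\
  forall p, M p ->
    exists (W : set 'rV[R]_n) (rho : 'rV[R]_n -> 'rV[R]_(n - d)),
      [/\ open W, W p, analytic_on W rho,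
          M `&` W = [set x | W x /\ rho x = 0] &
          forall x, (M `&` W) x -> \rank ('J rho x) = (n - d)%N].

(* T_pM, as the velocities at [p] of the curves drawn on [M]. *)
Definition tangent (R : realType) (n : nat) (M : set 'rV[R]_n)
    (p : 'rV[R]_n) : set 'rV[R]_n :=
  [set v | exists g : R -> 'rV[R]_n,
    [/\ g 0 = p, \forall t \near 0, M (g t) & is_derive (0 : R) (1 : R) g v]].

(** * Complexified vector fields *)

(* An element of C (x) R^n is given by its coordinates in C^n. *)
Definition ctangent (R : realType) (n : nat) (M : set 'rV[R]_n)
    (p : 'rV[R]_n) : set 'rV[R[i]]_n :=
  [set X | tangent M p (map_mx (@complex.Re R) X) /\
           tangent M p (map_mx (@complex.Im R) X)].

Definition field_re (R : realType) (n : nat) (X : 'rV[R]_n -> 'rV[R[i]]_n)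
    (p : 'rV[R]_n) : 'rV[R]_n := map_mx (@complex.Re R) (X p).

Definition field_im (R : realType) (n : nat) (X : 'rV[R]_n -> 'rV[R[i]]_n)
    (p : 'rV[R]_n) : 'rV[R]_n := map_mx (@complex.Im R) (X p).

Definition field_conj (R : realType) (n : nat) (X : 'rV[R]_n -> 'rV[R[i]]_n)
    (p : 'rV[R]_n) : 'rV[R[i]]_n := map_mx conjc (X p).

Definition lie (R : realType) (n : nat) (X Y : 'rV[R]_n -> 'rV[R]_n)
    (p : 'rV[R]_n) : 'rV[R]_n :=
  'D_(X p) Y p - 'D_(Y p) X p.

(* The C-bilinear extension of [lie]. When both fields are tangent to a
   submanifold M at its points, the values of their bracket on M only depend
   on those of the fields on M: it is the bracket of vector fields of M. *)
Definition clie (R : realType) (n : nat) (X Y : 'rV[R]_n -> 'rV[R[i]]_n)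
    (p : 'rV[R]_n) : 'rV[R[i]]_n :=
  map2_mx (@Complex R)
    (lie (field_re X) (field_re Y) p - lie (field_im X) (field_im Y) p)
    (lie (field_re X) (field_im Y) p + lie (field_im X) (field_re Y) p).

(* The rows of [F] form a basis of the fiber of C (x) TM at [p]. *)
Definition ctangent_basis (R : realType) (n m : nat) (M : set 'rV[R]_n)
    (p : 'rV[R]_n) (F : 'M[R[i]]_(m, n)) : Prop :=
  row_free F /\
  forall X : 'rV[R[i]]_n, ctangent M p X <-> (X <= F)%MS.

(** * CR geometry in C^N *)

(* C^N is identified with R^(N + N) through (x, y) |-> x + i y. *)
Definition to_complex (R : realType) (N : nat) (x : 'rV[R]_(N + N)) :
    'rV[R[i]]_N :=
  map2_mx (@Complex R) (lsubmx x) (rsubmx x).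

Definition realification (R : realType) (N : nat) (M : set 'rV[R[i]]_N) :
    set 'rV[R]_(N + N) :=
  @to_complex R N @^-1` M.

(* The standard complex structure, (x, y) |-> (- y, x); it is used over R, and
   over R[i] for its C-linear extension. *)
Definition Jst (K : zmodType) (N : nat) (v : 'rV[K]_(N + N)) : 'rV[K]_(N + N) :=
  row_mx (- rsubmx v) (lsubmx v).

Definition CR_generic (R : realType) (N : nat) (M : set 'rV[R]_(N + N)) : Prop :=
  forall p, M p -> forall v : 'rV[R]_(N + N),
    exists a b, [/\ tangent M p a, tangent M p b & v = a + Jst b].

(* T^{1,0}C^N is the eigenbundle of J for the eigenvalue i. *)
Definition T10 (R : realType) (N : nat) (M : set 'rV[R]_(N + N))
    (p : 'rV[R]_(N + N)) : set 'rV[R[i]]_(N + N) :=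
  [set X | ctangent M p X /\ Jst X = 'i *: X].

(* [L] is a real analytic field on the open set [W] of the ambient space whose
   restriction to M `&` W is a section of T^{1,0}M generating each fiber. *)
Definition T10_generator (R : realType) (N : nat) (M W : set 'rV[R]_(N + N))
    (L : 'rV[R]_(N + N) -> 'rV[R[i]]_(N + N)) : Prop :=
  [/\ open W, analytic_on W (field_re L), analytic_on W (field_im L) &
      forall p, (M `&` W) p ->
        T10 M p (L p) /\
        forall X, T10 M p X -> exists c : R[i], X = c *: L p].

Definition general_class_II (R : realType) (N : nat)
    (M : set 'rV[R]_(N + N)) : Prop :=
  forall (W : set 'rV[R]_(N + N)) (L : 'rV[R]_(N + N) -> 'rV[R[i]]_(N + N)),
    T10_generator M W L ->
    forall p, (M `&` W) p ->
      let L' := field_conj L in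
      ctangent_basis M p
        (\matrix_(k < 4) tnth [tuple L p; L' p; clie L L' p;
                               clie L (clie L L') p] k).

(* [Phi] is a biholomorphism, with inverse [Psi], from the neighbourhood [U] of
   the origin onto the neighbourhood [V] of the origin, and [Phi 0 = 0]: its
   components are holomorphic coordinates on [U] centered at the origin. Over
   K = R[i], [differentiable] is complex differentiability. The definition is
   stated for any [K] since the library puts a topology on an abstract
   numFieldType, but declares none on [complex R] itself. *)
Definition centered_holomorphic_coordinates (K : numFieldType) (N : nat)
    (U V : set 'rV[K]_N) (Phi Psi : 'rV[K]_N -> 'rV[K]_N) : Prop :=
  [/\ [/\ open U, open V, U 0 & Phi 0 = 0],
      forall p, U p -> V (Phi p) /\ Psi (Phi p) = p,
      forall q, V q -> U (Psi q) /\ Phi (Psi q) = q,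
      forall p, U p -> differentiable Phi p &
      forall q, V q -> differentiable Psi q].

(* z zb A(z, zb) + z zb u1 B(z, zb, u1, u2) + z zb u2 C(z, zb, u1, u2),
   where zb is the conjugate of z. *)
Definition graph_remainder (R : realType) (A : mpseries 2 R[i])
    (B C : mpseries 4 R[i]) (z : R[i]) (u1 u2 : R) : R[i] :=
  let zb := z^* in
  let zz := row_of_seq 2 [:: z; zb] in
  let zzu := row_of_seq 4 [:: z; zb; u1%:C; u2%:C] in
  z * zb * mpeval A zz
  + z * zb * (u1%:C * mpeval B zzu)
  + z * zb * (u2%:C * mpeval C zzu).

(* Main.v *)
Require Import Defs.
From mathcomp Require Import all_boot all_order all_algebra finmap.
From mathcomp Require Import complex.
From mathcomp Require Import all_classical all_reals all_analysis.
From mathcomp Require Import ring lra.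

(** Near the origin the submanifold is defined by a real analytic map. In its Taylor series the
    point [q = (z, w)] and its conjugate [(ze, om)] may be considered as independent variables,
    and everything takes place among germs at the origin of holomorphic maps.

    CR-genericity at the origin says that the C-linear part of the differential of the defining
    map has rank two, so that in linear coordinates the equations are [v = O(2)]
    ([linear_normalization]). The submanifold then contains a totally real surface transverse to
    the [z]-axis; straightening the Segre varieties of the points of this surface gives
    coordinates in which the equations are [v = F (z, zb, u)] with [F (z, 0, u) = 0] and
    [F (0, zb, u) = 0] ([normal_coordinates]), that is [v = z zb G (z, zb, u)]
    ([divide_graph]).

    The submanifold is of general class II at the origin only if [G (0)] and [dG/dz (0)] are
    linearly independent over C ([class_II_independent]). Indeed the complexified graph is also
    given by [w = om + Y (z, ze, om)]; the field [L = d/dz + (dY/dz) d/dw] generates the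
    (1,0) tangent spaces, and its conjugate is [d/dze] plus an explicit derivation in [om]. The
    components along [d/dom] of [[L, L']] and [[L, [L, L']]] at the origin are [- 2 i G (0)] and
    [- 4 i dG/dz (0)], and a vector tangent to the submanifold at the origin has equal
    components along [d/dw] and [d/dom]. Brackets of fields on the ambient real space are
    computed in the complexification because brackets are natural ([br_push]).

    As [G (0)] is real and independent of [dG/dz (0)], a change [z = la z' + be z' ^ 2],
    [w = w' A^-1], with [A] real, makes [G (0) = (1, 0)] and [dG/dz (0) = (0, 1)]
    ([normalizing_data], [normal_form_germ]); by reality [dG/dzb (0) = (0, 1)]. Hence
    [G (z, zb, 0) = (1, z + zb)] up to terms of order two, while [G (z, zb, u) - G (z, zb, 0)]
    is a combination of [u_1] and [u_2] ([expansion]): this is the normal form.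

    Germs are represented by functions that are sums of power series on a polydisc, with a bound
    for the sum of the norms of the monomials ([rep]); this norm is submultiplicative, and
    Hadamard's lemma, substitution, and Picard iteration for the implicit function theorem
    follow from elementary estimates. *)

Set Implicit Arguments.
Unset Strict Implicit.
Unset Printing Implicit Defensive.
Import Order.TTheory GRing.Theory Num.Theory.
Import numFieldNormedType.Exports.
Local Open Scope classical_set_scope.
Local Open Scope ring_scope.
Local Open Scope complex_scope.

(** * Moduli and unconditional sums *)

Notation nrm := ComplexField.Normc.normc.
Arguments ComplexField.Normc.normc : simpl never.

Section Modulus.
Variable R : realType.
Local Notation C := R[i].
Implicit Types x y : C.

Lemma nrmE x : `|x| = (nrm x)%:C. Proof. by []. Qed.

Lemma nrm_ge0 x : 0 <= nrm x.
Proof. by rewrite -ler0c -nrmE normr_ge0. Qed.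

Lemma nrm0 : nrm (0 : C) = 0.
Proof. by apply/eqP; rewrite -(inj_eq (@complexI R)) -nrmE normr0. Qed.

Lemma nrm1 : nrm (1 : C) = 1.
Proof. by apply/eqP; rewrite -(inj_eq (@complexI R)) -nrmE normr1. Qed.

Lemma nrm_eq0 x : (nrm x == 0) = (x == 0).
Proof. by rewrite -(inj_eq (@complexI R)) -nrmE normr_eq0. Qed.

Lemma nrmM x y : nrm (x * y) = nrm x * nrm y.
Proof. by apply: complexI; rewrite rmorphM -!nrmE normrM. Qed.

Lemma nrmN x : nrm (- x) = nrm x.
Proof. by apply: complexI; rewrite -!nrmE normrN. Qed.

Lemma nrmV x : nrm x^-1 = (nrm x)^-1.
Proof. by apply: complexI; rewrite fmorphV /= -!nrmE normfV. Qed.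

Lemma nrmX x n : nrm (x ^+ n) = nrm x ^+ n.
Proof. by apply: complexI; rewrite rmorphXn -!nrmE normrX. Qed.

Lemma nrm_prod (I : Type) (s : seq I) (P : pred I) (f : I -> C) :
  nrm (\prod_(i <- s | P i) f i) = \prod_(i <- s | P i) nrm (f i).
Proof. exact: (big_morph _ nrmM nrm1). Qed.

Lemma ler_nrmD x y : nrm (x + y) <= nrm x + nrm y.
Proof. by rewrite -lecR rmorphD /= -!nrmE ler_normD. Qed.

Lemma ler_nrmB x y : nrm (x - y) <= nrm x + nrm y.
Proof. by rewrite (le_trans (ler_nrmD _ _))// nrmN. Qed.

Lemma ler_nrm_sum (I : Type) (s : seq I) (P : pred I) (f : I -> C) :
  nrm (\sum_(i <- s | P i) f i) <= \sum_(i <- s | P i) nrm (f i).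
Proof.
elim/big_rec2 : _ => [|i y1 y2 _ h]; first by rewrite nrm0.
by rewrite (le_trans (ler_nrmD _ _))// lerD2l.
Qed.

Lemma nrm_real (r : R) : nrm r%:C = `|r|.
Proof. by rewrite /ComplexField.Normc.normc /= expr0n addr0 sqrtr_sqr. Qed.

Lemma nrm_conj x : nrm x^*%C = nrm x.
Proof. by case: x => a b; rewrite /ComplexField.Normc.normc /= sqrrN. Qed.

Lemma nrm_i : nrm ('i%C : C) = 1.
Proof. by rewrite /ComplexField.Normc.normc /= expr0n expr1n add0r sqrtr1. Qed.

Lemma nrm_Re x : `|complex.Re x| <= nrm x.
Proof. by rewrite -lecR -nrmE normc_ge_Re. Qed.

Lemma nrm_Im x : `|complex.Im x| <= nrm x.
Proof.
rewrite -[complex.Im x]opprK normrN -ReiNIm (le_trans (nrm_Re _))//.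
by rewrite nrmM nrm_i mulr1.
Qed.

Lemma nrm_small x : (forall e : R, 0 < e -> nrm x <= e) -> x = 0.
Proof.
move=> h; apply/eqP; rewrite -nrm_eq0 eq_le nrm_ge0 andbT.
by apply/ler_addgt0Pr => e e0; rewrite add0r h.
Qed.
End Modulus.

Section UnconditionalSum.
Variable R : realType.
Local Notation C := R[i].

(** Unconditional summability over an arbitrary index type: the sums that occur are indexed
    by multi-indices, and no enumeration of these is ever chosen. *)
Definition hsum (I : choiceType) (f : I -> C) (l : C) :=
  forall e : R, 0 < e -> exists J0 : {fset I}, forall J : {fset I},
    (J0 `<=` J)%fset -> nrm (l - \sum_(i <- J) f i) <= e.

Definition bnd (I : choiceType) (b : I -> R) (B : R) :=
  forall J : {fset I}, \sum_(i <- J) b i <= B.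

Lemma hsum_uniq (I : choiceType) (f : I -> C) l l' :
  hsum f l -> hsum f l' -> l = l'.
Proof.
move=> h h'; apply/eqP; rewrite -subr_eq0; apply/eqP/nrm_small => e e0.
have e2 : 0 < e / 2 by rewrite divr_gt0.
have [J1 h1] := h _ e2; have [J2 h2] := h' _ e2.
have k1 := h1 _ (fsubsetUl J1 J2); have k2 := h2 _ (fsubsetUr J1 J2).
set s := \sum_(i <- _) _ in k1 k2.
have -> : l - l' = (l - s) - (l' - s) by ring.
by rewrite (le_trans (ler_nrmB _ _))//; lra.
Qed.

Lemma eq_hsum (I : choiceType) (f g : I -> C) l : f =1 g -> hsum f l -> hsum g l.
Proof. by move=> /funext ->. Qed.

Lemma hsumD (I : choiceType) (f g : I -> C) l m :
  hsum f l -> hsum g m -> hsum (fun i => f i + g i) (l + m).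
Proof.
move=> h h' e e0.
have e2 : 0 < e / 2 by rewrite divr_gt0.
have [J1 h1] := h _ e2; have [J2 h2] := h' _ e2.
exists (J1 `|` J2)%fset => J; rewrite fsubUset => /andP[s1 s2].
rewrite big_split /= opprD addrACA (le_trans (ler_nrmD _ _))//.
by have := h1 _ s1; have := h2 _ s2; lra.
Qed.

Lemma hsumZ (I : choiceType) (f : I -> C) l c :
  hsum f l -> hsum (fun i => c * f i) (c * l).
Proof.
move=> h e e0.
have c0 : 0 < nrm c + 1 by have := nrm_ge0 c; lra.
have [|J0 hJ] := h (e / (nrm c + 1)); first by rewrite divr_gt0.
exists J0 => J /hJ; rewrite -mulr_sumr -mulrBr nrmM ler_pdivlMr// => le1.
rewrite (le_trans _ le1)// mulrC ler_wpM2l ?nrm_ge0//; lra.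
Qed.

Lemma hsum_fin (I : choiceType) (f : I -> C) (J0 : {fset I}) :
  (forall i, i \notin J0 -> f i = 0) -> hsum f (\sum_(i <- J0) f i).
Proof.
move=> h e e0; exists J0 => J sJ.
rewrite (big_fset_incl _ sJ) ?subrr ?nrm0 ?ltW// => i _; exact: h.
Qed.

Lemma hsum0 (I : choiceType) : hsum (fun _ : I => 0 : C) 0.
Proof.
by have /= := @hsum_fin I (fun=> 0) fset0 (fun _ _ => erefl); rewrite big_seq_fset0.
Qed.

Lemma hsum_sum (I K : choiceType) (J : {fset K}) (f : K -> I -> C) (l : K -> C) :
  (forall k, hsum (f k) (l k)) ->
  hsum (fun i => \sum_(k <- J) f k i) (\sum_(k <- J) l k).
Proof.
move=> h; elim: (enum_fset J) => [|k s IH].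
  by rewrite big_nil; apply: eq_hsum (@hsum0 I) => i; rewrite big_nil.
rewrite big_cons; apply: eq_hsum (hsumD (h k) IH) => i.
by rewrite big_cons.
Qed.

Lemma hsum_tail (I : choiceType) (f : I -> C) (b : I -> R) l (I0 : {fset I}) (e : R) :
  hsum f l -> (forall i, nrm (f i) <= b i) ->
  (forall J : {fset I}, [disjoint I0 & J]%fset -> \sum_(i <- J) b i <= e) ->
  nrm (l - \sum_(i <- I0) f i) <= e.
Proof.
move=> h fb tl; apply/ler_addgt0Pr => d d0 .
have [J0 hJ] := h _ d0.
have := hJ _ (fsubsetUl J0 I0).
rewrite (big_fsetID _ (mem I0)) /=.
have -> : [fset x in (J0 `|` I0)%fset | x \in I0]%fset = I0.
  by apply/fsetP => x; rewrite !inE; case: (x \in I0); rewrite ?orbT ?andbF.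
set K := [fset x in _ | _]%fset.
have le1 : nrm (\sum_(i <- K) f i) <= e.
  rewrite (le_trans (ler_nrm_sum _ _ _))// (le_trans (ler_sum _ (fun i _ => fb i)))//.
  apply: tl; apply/fdisjointP => x xI; rewrite !inE xI.
  by rewrite orbT.
move=> le2.
set s := \sum_(i <- I0) _ in le2 *; set t := \sum_(i <- K) _ in le1 le2 *.
have -> : l - s = (l - (s + t)) + t by ring.
by rewrite (le_trans (ler_nrmD _ _))//; lra.
Qed.

Lemma hsum_bound (I : choiceType) (f : I -> C) l (B : R) :
  hsum f l -> bnd (fun i => nrm (f i)) B -> nrm l <= B.
Proof.
move=> h hB; have := @hsum_tail I f (fun i => nrm (f i)) l fset0 B h (fun=> lexx _).
by rewrite big_seq_fset0 subr0; apply => J _; apply: hB.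
Qed.

Lemma bnd_ge0 (I : choiceType) (b : I -> R) B : bnd b B -> 0 <= B.
Proof. by move=> /(_ fset0); rewrite big_seq_fset0. Qed.

Lemma bnd_le (I : choiceType) (b c : I -> R) B :
  (forall i, b i <= c i) -> bnd c B -> bnd b B.
Proof. by move=> h hc J; rewrite (le_trans _ (hc J))// ler_sum. Qed.

Lemma bndZ (I : choiceType) (b : I -> R) B c :
  0 <= c -> bnd b B -> bnd (fun i => c * b i) (c * B).
Proof. by move=> c0 h J; rewrite -mulr_sumr ler_wpM2l. Qed.

Lemma bnd_sup (I : choiceType) (b : I -> R) B : bnd b B ->
  exists S : R, bnd b S /\
    forall e, 0 < e -> exists J : {fset I}, S - e < \sum_(i <- J) b i.
Proof.
move=> hB; pose E := [set x : R | exists J : {fset I}, x = \sum_(i <- J) b i].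
have hE : has_sup E.
  split; first by exists 0, fset0; rewrite big_seq_fset0.
  by exists B => x [J ->].
exists (sup E); split=> [J|e e0]; first by apply: ub_le_sup; [case: hE|exists J].
by have [_ [J ->] ?] := sup_adherent e0 hE; exists J.
Qed.

Lemma bnd_tail (I : choiceType) (b : I -> R) B (e : R) : bnd b B -> 0 < e ->
  exists I0 : {fset I}, forall J : {fset I},
    [disjoint I0 & J]%fset -> \sum_(i <- J) b i <= e.
Proof.
move=> /bnd_sup[S [hS hs]] e0; have [I0 hI] := hs _ e0.
exists I0 => J dj; have := hS (I0 `|` J)%fset.
rewrite (big_fsetID _ (mem I0)) /=.
have -> : [fset x in (I0 `|` J)%fset | x \in I0]%fset = I0.
  by apply/fsetP => x; rewrite !inE; case: (x \in I0); rewrite /= ?andbF ?orbT.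
have -> : [fset x in (I0 `|` J)%fset | x \notin I0]%fset = J.
  apply/fsetP => x; rewrite !inE; case: (boolP (x \in I0)) => //= xI.
    by apply/esym/negbTE; move/fdisjointP: dj; apply.
  by rewrite andbT.
by move=> h; lra.
Qed.

Lemma hsum_real_ex (I : choiceType) (b : I -> R) B :
  (forall i, 0 <= b i) -> bnd b B -> exists S : R, hsum (fun i => (b i)%:C) S%:C.
Proof.
move=> b0 /bnd_sup[S [hS hs]]; exists S => e e0.
have [I0 hI] := hs _ e0; exists I0 => J sJ.
rewrite -rmorph_sum -rmorphB nrm_real ger0_norm ?subr_ge0//.
rewrite lerBlDl -lerBlDr (le_trans (ltW hI))//.
rewrite [leRHS](big_fsetID _ (mem I0)) /=.
have -> : [fset x in J | x \in I0]%fset = I0.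
  apply/fsetP => x; rewrite !inE; case: (boolP (x \in I0)) => xI; rewrite ?andbF//.
  by rewrite (fsubsetP sJ).
by rewrite lerDl sumr_ge0.
Qed.

(** Absolute convergence: the positive and negative parts of the real and imaginary parts are summed separately. *)
Lemma hsum_ex (I : choiceType) (f : I -> C) B :
  bnd (fun i => nrm (f i)) B -> exists l, hsum f l.
Proof.
move=> hB.
have ex (g : I -> R) : (forall i, `|g i| <= nrm (f i)) ->
    exists S : R, hsum (fun i => (g i)%:C) S%:C.
  move=> hg.
  have [||S1 h1] := @hsum_real_ex I (fun i => `|g i| + g i) (2 * B).
  - by move=> i; have := ler_norm (- g i); rewrite normrN; lra.
  - apply: bnd_le (bndZ (ler0n R 2) hB) => i.
    by have := ler_norm (g i); have := hg i; lra.
  have [||S2 h2] := @hsum_real_ex I (fun i => `|g i|) B.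
  - by move=> i.
  - exact: bnd_le hB.
  exists (S1 - S2); rewrite rmorphB /= -mulN1r.
  apply: eq_hsum (hsumD h1 (hsumZ (-1) h2)) => i.
  by rewrite mulN1r -rmorphN -rmorphD /=; congr _%:C; ring.
have [S1 h1] := ex (fun i => complex.Re (f i)) (fun i => nrm_Re _).
have [S2 h2] := ex (fun i => complex.Im (f i)) (fun i => nrm_Im _).
exists (S1%:C + 'i%C * S2%:C); apply: eq_hsum (hsumD h1 (hsumZ 'i%C h2)) => i.
by rewrite -complexE.
Qed.

Lemma fsum_reindex (I K : choiceType) (V : nmodType) (h : I -> K) (k : K -> I)
    (g : K -> V) (J : {fset K}) :
  cancel h k -> (forall j, h (k j) != j -> g j = 0) ->
  \sum_(i <- J) g i =
  \sum_(i <- [fset k j | j in [fset j in J | h (k j) == j]]%fset) g (h i).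
Proof.
move=> hk g0; rewrite big_imfset /=; last first.
  move=> x y; rewrite !inE => /andP[_ /eqP hx] /andP[_ /eqP hy] e1.
  by rewrite -hx -hy e1.
rewrite (big_fsetID _ (fun j => h (k j) == j) J) /= [X in _ + X = _]big1_fset ?addr0.
  by apply: eq_fbigr => i; rewrite !inE => /andP[_ /eqP ->].
by move=> i; rewrite !inE => /andP[_ /g0].
Qed.

Lemma hsum_reindex (I K : choiceType) (h : I -> K) (k : K -> I) (g : K -> C) l :
  cancel h k -> (forall j, h (k j) != j -> g j = 0) ->
  hsum (fun i => g (h i)) l -> hsum g l.
Proof.
move=> hk g0 hs e e0; have [J0 hJ] := hs _ e0.
exists [fset h i | i in J0]%fset => J sJ.
rewrite (fsum_reindex _ hk g0); apply: hJ.
apply/fsubsetP => i iJ; apply/imfsetP; exists (h i); last by rewrite hk.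
by rewrite !inE hk eqxx andbT (fsubsetP sJ)//; apply/imfsetP; exists i.
Qed.

Lemma bnd_reindex (I K : choiceType) (h : I -> K) (k : K -> I) (g : K -> R) B :
  cancel h k -> (forall j, h (k j) != j -> g j = 0) ->
  bnd (fun i => g (h i)) B -> bnd g B.
Proof. by move=> hk g0 hB J; rewrite (fsum_reindex _ hk g0). Qed.

Lemma bnd_inj (I K : choiceType) (h : I -> K) (g : K -> R) B :
  injective h -> bnd g B -> bnd (fun i => g (h i)) B.
Proof.
by move=> hi hB J; have := hB [fset h i | i in J]%fset; rewrite big_imfset //= => x y _ _ /hi.
Qed.

Lemma hsum_conj (I : choiceType) (f : I -> C) l :
  hsum f l -> hsum (fun i => (f i)^*%C) l^*%C.
Proof.
move=> h e e0; have [J0 hJ] := h _ e0; exists J0 => J /hJ.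
by rewrite -rmorph_sum -rmorphB /= nrm_conj.
Qed.
End UnconditionalSum.

(** * Power series on a polydisc *)

Section PowerSeries.
Variable R : realType.
Local Notation C := R[i].

Definition inD n (r : R) (x : 'rV[C]_n) := forall i, nrm (x ord0 i) <= r.

Definition mon n (x : 'rV[C]_n) (al : {ffun 'I_n -> nat}) : C :=
  \prod_(i < n) x ord0 i ^+ al i.

Definition wt n (r : R) (al : {ffun 'I_n -> nat}) : R := \prod_(i < n) r ^+ al i.

(** The number [B] bounds the sum of the norms of the monomials on the polydisc. For this
    norm the germs form a Banach algebra, which is what makes products, substitutions and
    Picard iteration elementary. *)
Definition rep n (r : R) (f : 'rV[C]_n -> C) (B : R) :=
  exists a : {ffun 'I_n -> nat} -> C,
    bnd (fun al => nrm (a al) * wt r al) B /\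
    forall x, inD r x -> hsum (fun al => a al * mon x al) (f x).

Lemma wt_ge0 n r (al : {ffun 'I_n -> nat}) : 0 <= r -> 0 <= wt r al.
Proof. by move=> r0; apply: prodr_ge0 => i _; rewrite exprn_ge0. Qed.

Lemma wt_gt0 n r (al : {ffun 'I_n -> nat}) : 0 < r -> 0 < wt r al.
Proof. by move=> r0; apply: prodr_gt0 => i _; rewrite exprn_gt0. Qed.

Lemma nrm_mon n r (x : 'rV[C]_n) al : inD r x -> nrm (mon x al) <= wt r al.
Proof.
move=> xr; rewrite nrm_prod; apply: ler_prod => i _.
by rewrite nrm_ge0 /= nrmX lerXn2r ?nnegrE ?nrm_ge0// (le_trans (nrm_ge0 _) (xr i)).
Qed.

Lemma inD_le n r r' (x : 'rV[C]_n) : r <= r' -> inD r x -> inD r' x.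
Proof. by move=> rr h i; rewrite (le_trans (h i)). Qed.

Lemma inD0 n r : 0 <= r -> inD r (0 : 'rV[C]_n).
Proof. by move=> r0 i; rewrite mxE nrm0. Qed.

Lemma rep_ext n r (f g : 'rV[C]_n -> C) B :
  (forall x, inD r x -> f x = g x) -> rep r f B -> rep r g B.
Proof. by move=> fg [a [ha hf]]; exists a; split => // x xr; rewrite -fg//; exact: hf. Qed.

Lemma rep_leB n r (f : 'rV[C]_n -> C) B B' : B <= B' -> rep r f B -> rep r f B'.
Proof. by move=> BB [a [ha hf]]; exists a; split=> // J; rewrite (le_trans (ha J)). Qed.

Lemma rep_ler n r r' (f : 'rV[C]_n -> C) B : 0 <= r' -> r' <= r -> rep r f B -> rep r' f B.
Proof.
move=> r0 rr [a [ha hf]]; exists a; split=> [|x xr]; last exact: hf (inD_le rr xr).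
apply: bnd_le ha => al; rewrite ler_wpM2l ?nrm_ge0//.
by apply: ler_prod => i _; rewrite exprn_ge0//= lerXn2r// nnegrE (le_trans r0).
Qed.

Lemma rep_ge0 n r (f : 'rV[C]_n -> C) B : rep r f B -> 0 <= B.
Proof. by case=> a [/bnd_ge0]. Qed.

Lemma rep_bound n r (f : 'rV[C]_n -> C) B x : rep r f B -> inD r x -> nrm (f x) <= B.
Proof.
move=> [a [ha hf]] xr; apply: (hsum_bound (hf _ xr)).
apply: bnd_le ha => al; rewrite nrmM ler_wpM2l ?nrm_ge0//; exact: nrm_mon.
Qed.

Lemma mon0 n (x : 'rV[C]_n) : mon x [ffun=> 0%N] = 1.
Proof. by rewrite /mon big1// => i _; rewrite ffunE expr0. Qed.

Lemma wt0 n (r : R) : wt r ([ffun=> 0%N] : {ffun 'I_n -> nat}) = 1.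
Proof. by rewrite /wt big1// => i _; rewrite ffunE expr0. Qed.

Lemma rep_const n r c : rep r (fun _ : 'rV[C]_n => c) (nrm c).
Proof.
pose a (al : {ffun 'I_n -> nat}) := if al == [ffun=> 0%N] then c else 0.
exists a; split=> [J|x xr].
  case: (boolP ([ffun=> 0%N] \in J)) => h.
    rewrite (big_fsetD1 _ h) /= big1_fset ?addr0 => [|al].
      by rewrite /a eqxx wt0 mulr1.
    by rewrite !inE => /andP[/negbTE ne _] _; rewrite /a ne nrm0 mul0r.
  rewrite big1_fset ?nrm_ge0// => al alJ _; rewrite /a; case: eqP => e.
    by rewrite e (negbTE h) in alJ.
  by rewrite nrm0 mul0r.
have -> : c = \sum_(al <- [fset [ffun=> 0%N]]%fset) a al * mon x al.
  by rewrite big_seq_fset1 /a eqxx mon0 mulr1.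
apply: hsum_fin => al; rewrite inE => /negbTE ne.
by rewrite /a ne mul0r.
Qed.

Lemma rep_add n r (f g : 'rV[C]_n -> C) A B :
  rep r f A -> rep r g B -> 0 <= r -> rep r (fun x => f x + g x) (A + B).
Proof.
move=> [a [ha hf]] [b [hb hg]] r0; exists (fun al => a al + b al); split=> [J|x xr].
  apply: le_trans (lerD (ha J) (hb J)); rewrite -big_split /=.
  by apply: ler_sum => al _; rewrite -mulrDl ler_wpM2r ?wt_ge0// ler_nrmD.
by apply: eq_hsum (hsumD (hf _ xr) (hg _ xr)) => al; rewrite mulrDl.
Qed.

Lemma rep_scale n r (f : 'rV[C]_n -> C) B c :
  rep r f B -> rep r (fun x => c * f x) (nrm c * B).
Proof.
move=> [a [ha hf]]; exists (fun al => c * a al); split=> [|x xr].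
  by apply: bnd_le (bndZ (nrm_ge0 c) ha) => al; rewrite nrmM mulrA.
by apply: eq_hsum (hsumZ c (hf _ xr)) => al; rewrite mulrA.
Qed.

Definition incf n (j : 'I_n) (al : {ffun 'I_n -> nat}) : {ffun 'I_n -> nat} :=
  [ffun i => (al i + (i == j))%N].

Definition decf n (j : 'I_n) (al : {ffun 'I_n -> nat}) : {ffun 'I_n -> nat} :=
  [ffun i => (al i - (i == j))%N].

Lemma incfK n (j : 'I_n) : cancel (incf j) (decf j).
Proof. by move=> al; apply/ffunP => i; rewrite !ffunE addnK. Qed.

Lemma decfK n (j : 'I_n) (al : {ffun 'I_n -> nat}) : al j != 0%N -> incf j (decf j al) = al.
Proof.
move=> h; apply/ffunP => i; rewrite !ffunE; case: eqP => [->|_].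
  by rewrite subnK// lt0n.
by rewrite subn0 addn0.
Qed.

Lemma incf_neq0 n (j : 'I_n) (al : {ffun 'I_n -> nat}) : incf j al j != 0%N.
Proof. by rewrite ffunE eqxx addn1. Qed.

Lemma decfN n (j : 'I_n) (al : {ffun 'I_n -> nat}) : incf j (decf j al) != al -> al j == 0%N.
Proof. by apply: contraR => /decfK ->. Qed.

Lemma mon_inc n (x : 'rV[C]_n) j (al : {ffun 'I_n -> nat}) : mon x (incf j al) = x ord0 j * mon x al.
Proof.
rewrite /mon (bigD1 j)//= (bigD1 j (F := fun i => x ord0 i ^+ al i))//=.
rewrite ffunE eqxx addn1 exprS mulrA; congr (_ * _).
by apply: eq_bigr => i /negbTE ij; rewrite ffunE ij addn0.
Qed.

Lemma wt_inc n (r : R) (j : 'I_n) (al : {ffun 'I_n -> nat}) : wt r (incf j al) = r * wt r al.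
Proof.
rewrite /wt (bigD1 j)//= (bigD1 j (F := fun i => r ^+ al i))//=.
rewrite ffunE eqxx addn1 exprS mulrA; congr (_ * _).
by apply: eq_bigr => i /negbTE ij; rewrite ffunE ij addn0.
Qed.

Lemma rep_shift n r (f : 'rV[C]_n -> C) B j :
  0 <= r -> rep r f B -> rep r (fun x => x ord0 j * f x) (r * B).
Proof.
move=> r0 [a [ha hf]].
pose b (al : {ffun 'I_n -> nat}) := if al j == 0%N then 0 else a (decf j al).
have bE al : b (incf j al) = a al by rewrite /b (negbTE (incf_neq0 _ _)) incfK.
exists b; split=> [|x xr].
  apply: (bnd_reindex (incfK j)) => [al /decfN h|]; first by rewrite /b h nrm0 mul0r.
  by apply: bnd_le (bndZ r0 ha) => al; rewrite bE wt_inc mulrCA.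
apply: (hsum_reindex (incfK j)) => [al /decfN h|]; first by rewrite /b h mul0r.
by apply: eq_hsum (hsumZ (x ord0 j) (hf _ xr)) => al; rewrite bE mon_inc mulrCA.
Qed.

Lemma rep_coord n r j : 0 <= r -> rep r (fun x : 'rV[C]_n => x ord0 j) r.
Proof.
move=> r0; have := rep_shift j r0 (rep_const n r 1).
by rewrite nrm1 mulr1; apply: rep_ext => x _; rewrite mulr1.
Qed.

Definition zero_at n (j : 'I_n) (x : 'rV[C]_n) : 'rV[C]_n :=
  \row_i (if i == j then 0 else x ord0 i).

Lemma inD_zero_at n r (j : 'I_n) x : 0 <= r -> inD r x -> inD r (zero_at j x).
Proof. by move=> r0 h i; rewrite mxE; case: eqP => // _; rewrite nrm0. Qed.

Lemma mon_zero_at n (j : 'I_n) (x : 'rV[C]_n) al :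
  mon (zero_at j x) al = if al j == 0%N then mon x al else 0.
Proof.
case: ifPn => h.
  apply: eq_bigr => i _; rewrite mxE; case: eqP => // ->.
  by rewrite (eqP h) !expr0.
by rewrite /mon (bigD1 j)//= mxE eqxx expr0n (negbTE h) mul0r.
Qed.

(** Splitting off the monomials that contain one variable. *)
Lemma rep_had1 n r (f : 'rV[C]_n -> C) B j : 0 < r -> rep r f B ->
  exists h, rep r h (B / r) /\
    forall x, inD r x -> f x = f (zero_at j x) + x ord0 j * h x.
Proof.
move=> r0 [a [ha hf]].
have hb : bnd (fun al => nrm (a (incf j al)) * wt r al) (B / r).
  have ri : 0 <= r^-1 by rewrite invr_ge0 ltW.
  rewrite mulrC; apply: bnd_le (bndZ ri (bnd_inj (can_inj (incfK j)) ha)) => al.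
  by rewrite wt_inc mulrCA mulKf// gt_eqF.
have ex x : exists l, inD r x -> hsum (fun al => a (incf j al) * mon x al) l.
  have [xr|nxr] := pselect (inD r x); last by exists 0.
  have [|l hl] := @hsum_ex _ _ (fun al => a (incf j al) * mon x al) (B / r); last by exists l.
  apply: bnd_le hb => al; rewrite nrmM ler_wpM2l ?nrm_ge0//; exact: nrm_mon.
have [h hh] := choice ex; exists h; split=> [|x xr].
  by exists (fun al : {ffun 'I_n -> nat} => a (incf j al)); split.
have h0 := hf _ (inD_zero_at j (ltW r0) xr).
have h1 : hsum (fun al : {ffun 'I_n -> nat} => if al j == 0%N then 0 else a al * mon x al)
      (x ord0 j * h x).
  apply: (hsum_reindex (incfK j)) => [al /decfN ->//|].
  apply: eq_hsum (hsumZ (x ord0 j) (hh _ xr)) => al.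
  by rewrite (negbTE (incf_neq0 _ _)) mon_inc mulrCA.
apply: (hsum_uniq (hf _ xr)); apply: eq_hsum (hsumD h0 h1) => al.
by rewrite mon_zero_at; case: ifP => _; rewrite ?mulr0 ?add0r ?addr0.
Qed.

(** The coefficients are summed for each multi-index; exchanging the two summations is
    licit since [b] dominates all finite partial sums. *)
Lemma rep_hsum n r (I : choiceType) (f : I -> 'rV[C]_n -> C) (b : I -> R) B g :
  0 < r -> (forall i, rep r (f i) (b i)) -> bnd b B ->
  (forall x, inD r x -> hsum (fun i => f i x) (g x)) -> rep r g B.
Proof.
move=> r0 hf hb hg.
have [a ha] := choice hf.
have bsum (J : {fset {ffun 'I_n -> nat}}) (w : {ffun 'I_n -> nat} -> C) i :
    (forall al, nrm (w al) <= wt r al) -> nrm (\sum_(al <- J) w al * a i al) <= b i.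
  move=> hw; have [hi _] := ha i; rewrite (le_trans _ (hi J))//.
  rewrite (le_trans (ler_nrm_sum _ _ _))// ler_sum// => al _.
  by rewrite nrmM mulrC ler_wpM2l ?nrm_ge0.
have ex al : exists l, hsum (fun i => a i al) l.
  apply: (@hsum_ex _ _ _ ((wt r al)^-1 * B)).
  have w0 := wt_gt0 al r0.
  apply: bnd_le (bndZ _ hb) => [i|]; last by rewrite invr_ge0 ltW.
  rewrite mulrC ler_pdivlMr//; have [hi _] := ha i; have := hi [fset al]%fset.
  by rewrite big_seq_fset1.
have [c hc] := choice ex.
exists c; split=> [J|x xr].
  pose w al : C := (wt r al)%:C * ((nrm (c al))%:C / c al).
  have hw al : nrm (w al) <= wt r al.
    have w0 := wt_ge0 al (ltW r0).
    rewrite /w nrmM nrm_real ger0_norm// ler_piMr//.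
    rewrite nrmM nrm_real ger0_norm ?nrm_ge0// nrmV.
    by have [->|ne] := eqVneq (c al) 0; rewrite ?nrm0 ?mul0r// divff// nrm_eq0.
  have hs : hsum (fun i => \sum_(al <- J) w al * a i al) (\sum_(al <- J) w al * c al).
    by apply: (hsum_sum J) => al; exact: hsumZ (hc al).
  have := hsum_bound hs (bnd_le (fun i => bsum J w i hw) hb).
  have -> : \sum_(al <- J) w al * c al = (\sum_(al <- J) nrm (c al) * wt r al)%:C.
    rewrite rmorph_sum; apply: eq_bigr => al _; rewrite /w rmorphM.
    have [->|ne] := eqVneq (c al) 0; first by rewrite nrm0 mulr0 mul0r.
    by rewrite -mulrA divfK// mulrC.
  rewrite nrm_real ger0_norm// sumr_ge0// => al _.
  by rewrite mulr_ge0 ?nrm_ge0// wt_ge0// ltW.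
move=> e e0; have e3 : 0 < e / 3 by rewrite divr_gt0.
have [I0 tl] := bnd_tail hb e3.
have gb i : nrm (f i x) <= b i by exact: rep_bound (hf i) xr.
have t1 := hsum_tail (hg x xr) gb tl.
have hs : hsum (fun al => \sum_(i <- I0) a i al * mon x al) (\sum_(i <- I0) f i x).
  by apply: hsum_sum => i; have [_] := ha i; exact.
have [J0 hJ] := hs _ e3.
exists J0 => J /hJ t2.
have hs2 : hsum (fun i => \sum_(al <- J) mon x al * a i al) (\sum_(al <- J) mon x al * c al).
  by apply: (hsum_sum J) => al; exact: hsumZ (hc al).
have t3 := hsum_tail hs2 (fun i => bsum J _ i (fun al => nrm_mon al xr)) tl.
rewrite exchange_big /= in t2.
have eq1 : \sum_(al <- J) c al * mon x al = \sum_(al <- J) mon x al * c al.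
  by apply: eq_bigr => al _; rewrite mulrC.
have eq2 : \sum_(i <- I0) \sum_(al <- J) mon x al * a i al
   = \sum_(j <- I0) \sum_(i <- J) a j i * mon x i.
  by apply: eq_bigr => i _; apply: eq_bigr => al _; rewrite mulrC.
rewrite eq1; rewrite eq2 in t3.
set s1 := \sum_(i <- I0) f i x in t1 t2.
set s2 := \sum_(j <- I0) _ in t2 t3.
set s3 := \sum_(al <- J) _ in t3 *.
have -> : g x - s3 = (g x - s1) + (s1 - s2) - (s3 - s2) by ring.
rewrite (le_trans (ler_nrmB _ _))//; have := ler_nrmD (g x - s1) (s1 - s2); lra.
Qed.
End PowerSeries.

(** * Products, substitution and division of power series *)

Section PowerSeriesOps.
Variable R : realType.
Local Notation C := R[i].

Lemma rep_monM n r (f : 'rV[C]_n -> C) A al :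
  0 <= r -> rep r f A -> rep r (fun x => mon x al * f x) (wt r al * A).
Proof.
move=> r0 hf; rewrite /mon /wt.
elim: (index_enum _) => [|i s IH].
  by rewrite big_nil mul1r; apply: rep_ext hf => x _; rewrite big_nil mul1r.
rewrite big_cons -mulrA.
suff h k : rep r (fun x : 'rV[C]_n => x ord0 i ^+ k * (\prod_(i0 <- s) x ord0 i0 ^+ al i0 * f x))
    (r ^+ k * (\prod_(j <- s) r ^+ al j * A)).
  by apply: rep_ext (h (al i)) => x _; rewrite big_cons mulrA.
elim: k => [|k IHk].
  by rewrite expr0 mul1r; apply: rep_ext IH => x _; rewrite expr0 mul1r.
by rewrite exprS -mulrA; apply: rep_ext (rep_shift i r0 IHk) => x _; rewrite exprS mulrA.
Qed.

(** The second factor is expanded: each [a al * mon al * g] has norm at most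
    [nrm (a al) * wt al * B]. *)
Lemma rep_mul n r (f g : 'rV[C]_n -> C) A B : 0 < r ->
  rep r f A -> rep r g B -> rep r (fun x => f x * g x) (A * B).
Proof.
move=> r0 hf [b [hb hg]].
have A0 := rep_ge0 hf.
apply: (@rep_hsum _ _ _ _ (fun al x => b al * (mon x al * f x))
  (fun al => nrm (b al) * (wt r al * A))) => // [al||x xr].
- by apply: rep_scale; apply: rep_monM => //; rewrite ltW.
- by apply: bnd_le (bndZ A0 hb) => al; rewrite mulrA [in leRHS]mulrC.
- by apply: eq_hsum (hsumZ (f x) (hg _ xr)) => al; ring.
Qed.

Lemma rep_expr n r (f : 'rV[C]_n -> C) A k : 0 < r ->
  rep r f A -> rep r (fun x => f x ^+ k) (A ^+ k).
Proof.
move=> r0 hf; elim: k => [|k IH].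
  by apply: (rep_ext (f := fun=> 1)) => [x _|]; rewrite ?expr0// -nrm1; exact: rep_const.
by rewrite exprS; apply: rep_ext (rep_mul r0 hf IH) => x _; rewrite exprS.
Qed.

Lemma rep_mon n k r s (F : 'rV[C]_n -> 'rV[C]_k) al : 0 < r ->
  (forall j, rep r (fun x => F x ord0 j) s) ->
  rep r (fun x => mon (F x) al) (wt s al).
Proof.
move=> r0 hF; rewrite /mon /wt.
elim: (index_enum _) => [|i l IH].
  apply: (rep_ext (f := fun=> 1)) => [x _|]; first by rewrite big_nil.
  by rewrite big_nil -nrm1; exact: rep_const.
rewrite big_cons; apply: rep_ext (rep_mul r0 (rep_expr (al i) r0 (hF i)) IH) => x _.
by rewrite big_cons.
Qed.

(** Substitution is an infinite sum of products, hence preserves the norm. *)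
Lemma rep_comp n k r s (g : 'rV[C]_k -> C) B (F : 'rV[C]_n -> 'rV[C]_k) : 0 < r ->
  rep s g B -> (forall j, rep r (fun x => F x ord0 j) s) ->
  rep r (fun x => g (F x)) B.
Proof.
move=> r0 [b [hb hg]] hF.
apply: (@rep_hsum _ _ _ _ (fun al x => b al * mon (F x) al)
  (fun al => nrm (b al) * wt s al)) => // [al|x xr].
  by apply: rep_scale; exact: rep_mon.
by apply: hg => j; exact: rep_bound (hF j) xr.
Qed.

Lemma mon_at0 n (al : {ffun 'I_n -> nat}) :
  mon (0 : 'rV[C]_n) al = (al == [ffun=> 0%N])%:R.
Proof.
have [->|ne] := eqVneq al; first by rewrite mon0.
have [j hj] : exists j, al j != 0%N.
  apply/existsP; move: ne; apply: contraR; rewrite negb_exists => /forallP h.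
  by apply/eqP/ffunP => j; rewrite ffunE; apply/eqP; have := h j; rewrite negbK.
by rewrite /mon (bigD1 j)//= mxE expr0n (negbTE hj) mul0r.
Qed.

(** Every monomial of positive degree is multiplied by at most [rho / r]. *)
Lemma rep_small n r rho (f : 'rV[C]_n -> C) B : 0 < rho -> rho <= r ->
  f 0 = 0 -> rep r f B -> rep rho f (rho / r * B).
Proof.
move=> rho0 rr f0 [a [ha hf]].
have r0 : 0 < r by exact: lt_le_trans rr.
have a0 : a [ffun=> 0%N] = 0.
  have := hf 0 (inD0 (ltW r0)); rewrite f0 => h; apply: hsum_uniq h.
  have -> : a [ffun=> 0%N] = \sum_(al <- [fset [ffun=> 0%N]]%fset) a al * mon 0 al.
    by rewrite big_seq_fset1 mon_at0 eqxx mulr1.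
  by apply: hsum_fin => al; rewrite inE => /negbTE ne; rewrite mon_at0 ne mulr0.
exists a; split=> [|x xr]; last by apply: hf; exact: inD_le xr.
have rp : 0 <= rho / r by rewrite divr_ge0 ?ltW.
apply: bnd_le (bndZ rp ha) => al.
have [->|ne] := eqVneq al [ffun=> 0%N]; first by rewrite a0 nrm0 !mul0r mulr0.
have [j hj] : exists j, al j != 0%N.
  apply/existsP; move: ne; apply: contraR; rewrite negb_exists => /forallP h.
  by apply/eqP/ffunP => j; rewrite ffunE; apply/eqP; have := h j; rewrite negbK.
rewrite -(decfK hj) !wt_inc [leRHS]mulrCA ler_wpM2l ?nrm_ge0// mulrA divfK ?gt_eqF//.
rewrite (ler_wpM2l (ltW rho0))//; apply: ler_prod => i _.
by rewrite (exprn_ge0 _ (ltW rho0))//= lerXn2r// nnegrE ltW.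
Qed.

Definition zero_on n (s : seq 'I_n) (x : 'rV[C]_n) : 'rV[C]_n :=
  \row_i (if i \in s then 0 else x ord0 i).

Lemma rep_zero_on n r (f : 'rV[C]_n -> C) B s : 0 < r -> rep r f B ->
  rep r (fun x => f (zero_on s x)) B.
Proof.
move=> r0 hf; apply: (rep_comp r0 hf) => j.
apply: (rep_ext (f := fun x => if j \in s then 0 else x ord0 j)) => [x _|].
  by rewrite mxE.
case: (j \in s); last by apply: rep_coord; rewrite ltW.
by apply: rep_leB (rep_const _ _ _); rewrite nrm0 ltW.
Qed.

Lemma rep_had_seq n r (f : 'rV[C]_n -> C) B (s : seq 'I_n) :
  0 < r -> rep r f B -> uniq s ->
  exists h : 'I_n -> 'rV[C]_n -> C, (forall j, rep r (h j) (B / r)) /\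
    forall x, inD r x -> f x = f (zero_on s x) + \sum_(j <- s) x ord0 j * h j x.
Proof.
move=> r0 hf; elim: s => [_|j s IH /= /andP[js us]].
  have B0 : 0 <= B / r by rewrite divr_ge0 ?(rep_ge0 hf)// ltW.
  exists (fun _ _ => 0); split=> [_|x _].
    by apply: rep_leB (rep_const _ _ _); rewrite nrm0.
  by rewrite big_nil addr0; congr f; apply/rowP => i; rewrite mxE.
have [h [hh hE]] := IH us.
have [k [hk kE]] := rep_had1 j r0 hf.
exists (fun i => if i == j then (fun x => k (zero_on s x)) else h i); split=> [i|x xr].
  by case: eqP => // _; exact: rep_zero_on.
rewrite hE// big_cons eqxx addrA; congr (_ + _); last first.
  apply: eq_big_seq => i si; case: eqP => // ij.
  by rewrite ij (negbTE js) in si.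
have xr' : inD r (zero_on s x).
  by move=> i; rewrite mxE; case: ifP => // _; rewrite nrm0 ltW.
rewrite kE// mxE (negbTE js); congr (f _ + _); apply/rowP => i; rewrite !mxE inE.
by case: eqP => //= _; case: ifP.
Qed.

(** Hadamard's lemma with respect to the last group of variables. *)
Lemma rep_had n m r (f : 'rV[C]_(n + m) -> C) B : 0 < r -> rep r f B ->
  exists h : 'I_m -> 'rV[C]_(n + m) -> C, (forall j, rep r (h j) (B / r)) /\
    forall x, inD r x -> f x = f (row_mx (lsubmx x) 0)
      + \sum_j rsubmx x ord0 j * h j x.
Proof.
move=> r0 hf.
have us : uniq [seq rshift n j | j <- index_enum 'I_m].
  by rewrite map_inj_uniq ?index_enum_uniq//; exact: rshift_inj.
have [h [hh hE]] := rep_had_seq r0 hf us.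
exists (fun j => h (rshift n j)); split=> // x xr.
rewrite hE// big_map; congr (f _ + _).
  apply/rowP => i; rewrite mxE; case: (split_ordP i) => j ->.
    rewrite row_mxEl mxE ifN//; apply/mapP => -[k _ /eqP].
    by rewrite eq_lrshift.
  by rewrite row_mxEr mxE ifT//; apply/mapP; exists j; rewrite ?mem_index_enum.
by apply: eq_bigr => j _; rewrite mxE.
Qed.
End PowerSeriesOps.

(** * Germs at the origin *)

Section Germs.
Variable R : realType.
Local Notation C := R[i].

(** The filter of the properties that hold on some polydisc centered at the origin. *)
Definition near0 n : set_system 'rV[C]_n :=
  fun P => exists r : R, 0 < r /\ forall x, inD r x -> P x.

Global Instance near0_filter n : Filter (@near0 n).
Proof.
split.
- by exists 1.
- move=> P Q [r [r0 hP]] [s [s0 hQ]]; exists (Num.min r s); split.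
    by rewrite lt_min r0.
  by move=> x xm; split; [apply: hP|apply: hQ]; apply: inD_le xm; rewrite ge_min lexx ?orbT.
- by move=> P Q PQ [r [r0 hP]]; exists r; split => // x /hP /PQ.
Qed.

Lemma near0W n (P : 'rV[C]_n -> Prop) : (forall x, P x) -> near0 P.
Proof. by move=> h; exists 1. Qed.

Lemma near0S n (P Q : 'rV[C]_n -> Prop) : (forall x, P x -> Q x) -> near0 P -> near0 Q.
Proof. exact: (@filterS _ (@near0 n)). Qed.

Lemma near0S2 n (P Q T : 'rV[C]_n -> Prop) :
  (forall x, P x -> Q x -> T x) -> near0 P -> near0 Q -> near0 T.
Proof. exact: (@filterS2 _ (@near0 n)). Qed.

Lemma near0S3 n (P Q S T : 'rV[C]_n -> Prop) :
  (forall x, P x -> Q x -> S x -> T x) -> near0 P -> near0 Q -> near0 S -> near0 T.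
Proof. exact: (@filterS3 _ (@near0 n)). Qed.

Lemma near0_inD n r : 0 < r -> near0 (fun x : 'rV[C]_n => inD r x).
Proof. by exists r. Qed.

Lemma near0_at0 n (P : 'rV[C]_n -> Prop) : near0 P -> P 0.
Proof. by move=> [r [r0]]; apply; apply: inD0; rewrite ltW. Qed.

Lemma near0_shift n (P : 'rV[C]_n -> Prop) :
  near0 P -> near0 (fun p => near0 (fun v => P (p + v))).
Proof.
move=> [r [r0 hP]]; have r2 : 0 < r / 2 by rewrite divr_gt0.
exists (r / 2); split => // p pr; exists (r / 2); split => // v vr; apply: hP => i.
by rewrite mxE (le_trans (ler_nrmD _ _))//; have := pr i; have := vr i; lra.
Qed.

Definition to0 n m (F : 'rV[C]_n -> 'rV[C]_m) :=
  forall e : R, 0 < e -> near0 (fun x => inD e (F x)).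

Lemma near0_comp n m (F : 'rV[C]_n -> 'rV[C]_m) (P : 'rV[C]_m -> Prop) :
  to0 F -> near0 P -> near0 (fun x => P (F x)).
Proof. by move=> hF [r [r0 hP]]; apply: near0S (hF _ r0) => x /hP. Qed.

(** ** Order of vanishing *)

Definition bigO n (k : nat) (f : 'rV[C]_n -> C) :=
  exists K r : R, 0 < r /\ forall rho x,
    0 <= rho -> rho <= r -> inD rho x -> nrm (f x) <= K * rho ^+ k.

Lemma bigOP n k (f : 'rV[C]_n -> C) : bigO k f -> exists K r : R,
  [/\ 0 < K, 0 < r & forall rho x,
    0 <= rho -> rho <= r -> inD rho x -> nrm (f x) <= K * rho ^+ k].
Proof.
move=> [K [r [r0 h]]]; have K0 : 0 < `|K| + 1 by rewrite ltr_wpDl.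
exists (`|K| + 1), r; split=> //.
move=> rho x rho0 rr xr; rewrite (le_trans (h _ _ rho0 rr xr))//.
rewrite ler_wpM2r ?exprn_ge0// (le_trans (ler_norm K))//; lra.
Qed.

Lemma bigO_ext n k (f g : 'rV[C]_n -> C) :
  near0 (fun x => f x = g x) -> bigO k f -> bigO k g.
Proof.
move=> [s [s0 fg]] [K [r [r0 h]]]; exists K, (Num.min r s); split.
  by rewrite lt_min r0.
move=> rho x rho0; rewrite le_min => /andP[rr rs] xr.
by rewrite -fg; [exact: h|exact: inD_le xr].
Qed.

Lemma bigOD n k (f g : 'rV[C]_n -> C) :
  bigO k f -> bigO k g -> bigO k (fun x => f x + g x).
Proof.
move=> [K [r [r0 hf]]] [L [s [s0 hg]]]; exists (K + L), (Num.min r s); split.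
  by rewrite lt_min r0.
move=> rho x rho0; rewrite le_min => /andP[rr rs] xr.
by rewrite (le_trans (ler_nrmD _ _))// mulrDl lerD ?hf ?hg.
Qed.

Lemma bigOM n k l (f g : 'rV[C]_n -> C) :
  bigO k f -> bigO l g -> bigO (k + l) (fun x => f x * g x).
Proof.
move=> [K [r [r0 hf]]] [L [s [s0 hg]]]; exists (K * L), (Num.min r s); split.
  by rewrite lt_min r0.
move=> rho x rho0; rewrite le_min => /andP[rr rs] xr.
by rewrite nrmM exprD mulrACA ler_pM ?nrm_ge0 ?hf ?hg.
Qed.

Lemma bigO_const n c : bigO 0 (fun _ : 'rV[C]_n => c).
Proof. by exists (nrm c), 1; split=> // rho x _ _ _; rewrite expr0 mulr1. Qed.

Lemma bigOZ n k (f : 'rV[C]_n -> C) c : bigO k f -> bigO k (fun x => c * f x).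
Proof. exact: (bigOM (bigO_const _ c)). Qed.

Lemma bigON n k (f : 'rV[C]_n -> C) : bigO k f -> bigO k (fun x => - f x).
Proof. by move=> /(bigOZ (-1)); apply: bigO_ext; apply: near0W => x; rewrite mulN1r. Qed.

Lemma bigO_zero n k : bigO k (fun _ : 'rV[C]_n => 0).
Proof. by exists 0, 1; split=> // rho x _ _ _; rewrite nrm0 mul0r. Qed.

Lemma bigO_sum n k (I : Type) (s : seq I) (f : I -> 'rV[C]_n -> C) :
  (forall i, bigO k (f i)) -> bigO k (fun x => \sum_(i <- s) f i x).
Proof.
move=> h; elim: s => [|i s IH].
  by apply: bigO_ext (bigO_zero n k); apply: near0W => x; rewrite big_nil.
by apply: bigO_ext (bigOD (h i) IH); apply: near0W => x; rewrite big_cons.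
Qed.

Lemma bigO_coord n j : bigO 1 (fun x : 'rV[C]_n => x ord0 j).
Proof. by exists 1, 1; split=> // rho x _ _ xr; rewrite mul1r expr1. Qed.

Lemma bigOS n k (f : 'rV[C]_n -> C) : bigO k.+1 f -> bigO k f.
Proof.
move=> /bigOP[K [r [K0 r0 h]]]; exists (K * r), r; split=> // rho x rho0 rr xr.
rewrite (le_trans (h _ _ rho0 rr xr))// exprS mulrA ler_wpM2r ?exprn_ge0//.
by rewrite (ler_wpM2l (ltW K0)).
Qed.

Definition bigOv n m k (F : 'rV[C]_n -> 'rV[C]_m) :=
  forall j, bigO k (fun x => F x ord0 j).

Lemma bigOvP n m k (F : 'rV[C]_n -> 'rV[C]_m) : bigOv k F -> exists K r : R,
  [/\ 0 < K, 0 < r & forall rho x,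
    0 <= rho -> rho <= r -> inD rho x -> inD (K * rho ^+ k) (F x)].
Proof.
move=> h; have {}h j := bigOP (h j).
have [K hK] := choice h; have [r hr] := choice hK.
have s0 : 0 < \big[Num.min/1]_j r j.
  by apply/bigmin_gtP; split=> // j _; have [] := hr j.
exists (\sum_j K j + 1), (\big[Num.min/1]_j r j); split=> //.
  by rewrite ltr_wpDl// sumr_ge0// => j _; have [/ltW] := hr j.
move=> rho x rho0 rs xr j; have [K0 r0 hj] := hr j.
rewrite (le_trans (hj _ _ rho0 _ xr))//.
  by rewrite (le_trans rs)// bigmin_le_cond.
rewrite ler_wpM2r ?exprn_ge0//.
rewrite (bigD1 j)//= -addrA lerDl addr_ge0// sumr_ge0// => i _.
by have [/ltW] := hr i.
Qed.

Lemma bigO_comp n m k (g : 'rV[C]_m -> C) (F : 'rV[C]_n -> 'rV[C]_m) :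
  bigO k g -> bigOv 1 F -> bigO k (fun x => g (F x)).
Proof.
move=> [L [s [s0 hg]]] /bigOvP[K [r [K0 r0 hF]]].
exists (L * K ^+ k), (Num.min r (s / K)); split.
  by rewrite lt_min r0 divr_gt0.
move=> rho x rho0; rewrite le_min ler_pdivlMr// => /andP[rr rs] xr.
rewrite -mulrA -exprMn; have := hF _ _ rho0 rr xr; rewrite expr1; apply: hg.
  by rewrite mulr_ge0// ltW.
by rewrite mulrC.
Qed.

Lemma bigOv_to0 n m (F : 'rV[C]_n -> 'rV[C]_m) : bigOv 1 F -> to0 F.
Proof.
move=> /bigOvP[K [r [K0 r0 hF]]] e e0.
have m0 : 0 < Num.min r (e / K) by rewrite lt_min r0 divr_gt0.
exists (Num.min r (e / K)); split=> // x xm.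
have h := hF _ x (ltW m0) _ xm; apply: inD_le (h _); rewrite ?ge_min ?lexx//.
by rewrite expr1 mulrC -ler_pdivlMr// ge_min lexx orbT.
Qed.

(** ** Germs of holomorphic functions at the origin *)

(** A germ is a total function; its values far from the origin are irrelevant. *)
Definition hol n (f : 'rV[C]_n -> C) := exists r B : R, 0 < r /\ rep r f B.

Definition holv n m (F : 'rV[C]_n -> 'rV[C]_m) := forall j, hol (fun x => F x ord0 j).

Lemma hol_ext n (f g : 'rV[C]_n -> C) : near0 (fun x => f x = g x) -> hol f -> hol g.
Proof.
move=> [s [s0 fg]] [r [B [r0 hf]]]; have m0 : 0 < Num.min r s by rewrite lt_min r0.
exists (Num.min r s), B; split=> //.
apply: (rep_ext (f := f)) => [x xr|]; first by apply: fg; apply: inD_le xr; rewrite ge_min lexx orbT.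
by apply: rep_ler hf; rewrite ?(ltW m0)// ge_min lexx.
Qed.

Lemma eq_hol n (f g : 'rV[C]_n -> C) : f =1 g -> hol f -> hol g.
Proof. by move=> /funext ->. Qed.

Lemma hol_const n c : hol (fun _ : 'rV[C]_n => c).
Proof. by exists 1, (nrm c); split=> //; exact: rep_const. Qed.

Lemma hol_coord n j : hol (fun x : 'rV[C]_n => x ord0 j).
Proof. by exists 1, 1; split=> //; exact: rep_coord. Qed.

Lemma hol2 n (f g : 'rV[C]_n -> C) : hol f -> hol g ->
  exists r A B : R, [/\ 0 < r, rep r f A & rep r g B].
Proof.
move=> [r [A [r0 hf]]] [s [B [s0 hg]]].
have m0 : 0 < Num.min r s by rewrite lt_min r0.
exists (Num.min r s), A, B; split=> //.
  by apply: rep_ler hf; rewrite ?(ltW m0)// ge_min lexx.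
by apply: rep_ler hg; rewrite ?(ltW m0)// ge_min lexx orbT.
Qed.

Lemma holD n (f g : 'rV[C]_n -> C) : hol f -> hol g -> hol (fun x => f x + g x).
Proof.
move=> hf hg; have [r [A [B [r0 {}hf {}hg]]]] := hol2 hf hg.
by exists r, (A + B); split=> //; apply: rep_add => //; exact: ltW.
Qed.

Lemma holM n (f g : 'rV[C]_n -> C) : hol f -> hol g -> hol (fun x => f x * g x).
Proof.
move=> hf hg; have [r [A [B [r0 {}hf {}hg]]]] := hol2 hf hg.
by exists r, (A * B); split=> //; exact: rep_mul.
Qed.

Lemma holZ n (f : 'rV[C]_n -> C) c : hol f -> hol (fun x => c * f x).
Proof. exact: holM (hol_const _ c). Qed.

Lemma holN n (f : 'rV[C]_n -> C) : hol f -> hol (fun x => - f x).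
Proof. by move=> /(holZ (-1)); apply: eq_hol => x; rewrite mulN1r. Qed.

Lemma holB n (f g : 'rV[C]_n -> C) : hol f -> hol g -> hol (fun x => f x - g x).
Proof. by move=> hf /holN; exact: holD. Qed.

Lemma hol_sum n (I : Type) (s : seq I) (f : I -> 'rV[C]_n -> C) :
  (forall i, hol (f i)) -> hol (fun x => \sum_(i <- s) f i x).
Proof.
move=> h; elim: s => [|i s IH].
  by apply: eq_hol (hol_const n 0) => x; rewrite big_nil.
by apply: eq_hol (holD (h i) IH) => x; rewrite big_cons.
Qed.

Lemma hol_bigO1 n (f : 'rV[C]_n -> C) : hol f -> f 0 = 0 -> bigO 1 f.
Proof.
move=> [r [B [r0 hf]]] f0; exists (B / r), r; split=> // rho x rho0 rr xr.
have [e|ne] := eqVneq rho 0.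
  suff -> : x = 0 by rewrite f0 nrm0 e mulr0.
  apply/rowP => i; rewrite mxE; apply/eqP; rewrite -nrm_eq0 eq_le nrm_ge0 andbT.
  by rewrite -e xr.
have rho1 : 0 < rho by rewrite lt_neqAle eq_sym ne.
have -> : B / r * rho ^+ 1 = rho / r * B by rewrite expr1; ring.
by apply: rep_bound (rep_small rho1 rr f0 hf) xr.
Qed.

Lemma holv_bigO1 n m (F : 'rV[C]_n -> 'rV[C]_m) : holv F -> F 0 = 0 -> bigOv 1 F.
Proof. by move=> hF F0 j; apply: hol_bigO1 => //; rewrite F0 mxE. Qed.

Lemma holv_to0 n m (F : 'rV[C]_n -> 'rV[C]_m) : holv F -> F 0 = 0 -> to0 F.
Proof. by move=> hF F0; apply: bigOv_to0; exact: holv_bigO1. Qed.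

Lemma holv_small n m (F : 'rV[C]_n -> 'rV[C]_m) s : holv F -> F 0 = 0 -> 0 < s ->
  exists r0 : R, 0 < r0 /\ forall r, 0 < r -> r <= r0 ->
    forall j, rep r (fun x => F x ord0 j) s.
Proof.
move=> hF F0 s0; have [r hr] := choice hF; have [B hB] := choice hr.
pose t j := Num.min (r j) (r j * s / (B j + 1)).
have t0 j : 0 < t j.
  have [rj hj] := hB j; have := rep_ge0 hj => Bj.
  by rewrite lt_min rj divr_gt0 ?mulr_gt0//; lra.
exists (\big[Num.min/1]_j t j); split; first by apply/bigmin_gtP; split.
move=> q q0 qt j; have [rj hj] := hB j; have Bj := rep_ge0 hj.
have : q <= t j by rewrite (le_trans qt)// bigmin_le_cond.
rewrite le_min => /andP[q1 q2].
apply: rep_leB (rep_small q0 q1 _ hj); last by rewrite F0 mxE.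
have B1 : 0 < B j + 1 by lra.
rewrite mulrAC ler_pdivrMr// (le_trans (y := q * (B j + 1)))//.
  by rewrite (ler_wpM2l (ltW q0))//; lra.
by rewrite -ler_pdivlMr// [s * _]mulrC.
Qed.

Lemma hol_comp n m (g : 'rV[C]_m -> C) (F : 'rV[C]_n -> 'rV[C]_m) :
  hol g -> holv F -> F 0 = 0 -> hol (fun x => g (F x)).
Proof.
move=> [s [B [s0 hg]]] hF F0; have [r [r0 hr]] := holv_small hF F0 s0.
by exists r, B; split=> //; apply: rep_comp hg (hr _ _ _).
Qed.

Lemma holv_comp n m k (G : 'rV[C]_m -> 'rV[C]_k) (F : 'rV[C]_n -> 'rV[C]_m) :
  holv G -> holv F -> F 0 = 0 -> holv (fun x => G (F x)).
Proof. by move=> hG hF F0 j; exact: hol_comp (hG j) hF F0. Qed.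

Lemma eq_holv n m (F G : 'rV[C]_n -> 'rV[C]_m) : F =1 G -> holv F -> holv G.
Proof. by move=> /funext ->. Qed.

Lemma holv_const n m c : holv (fun _ : 'rV[C]_n => c : 'rV[C]_m).
Proof. by move=> j; exact: hol_const. Qed.

Lemma holv_id n : holv (fun x : 'rV[C]_n => x).
Proof. by move=> j; exact: hol_coord. Qed.

Lemma holvD n m (F G : 'rV[C]_n -> 'rV[C]_m) : holv F -> holv G -> holv (fun x => F x + G x).
Proof. by move=> hF hG j; apply: eq_hol (holD (hF j) (hG j)) => x; rewrite mxE. Qed.

Lemma holvZ n m (F : 'rV[C]_n -> 'rV[C]_m) (f : 'rV[C]_n -> C) :
  hol f -> holv F -> holv (fun x => f x *: F x).
Proof. by move=> hf hF j; apply: eq_hol (holM hf (hF j)) => x; rewrite mxE. Qed.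

Lemma holvN n m (F : 'rV[C]_n -> 'rV[C]_m) : holv F -> holv (fun x => - F x).
Proof. by move=> hF j; apply: eq_hol (holN (hF j)) => x; rewrite mxE. Qed.

Lemma holvB n m (F G : 'rV[C]_n -> 'rV[C]_m) : holv F -> holv G -> holv (fun x => F x - G x).
Proof. by move=> hF /holvN; exact: holvD. Qed.

Lemma holv_row n m k (F : 'rV[C]_n -> 'rV[C]_m) (G : 'rV[C]_n -> 'rV[C]_k) :
  holv F -> holv G -> holv (fun x => row_mx (F x) (G x)).
Proof.
move=> hF hG j; case: (split_ordP j) => i ->.
  by apply: eq_hol (hF i) => x; rewrite row_mxEl.
by apply: eq_hol (hG i) => x; rewrite row_mxEr.
Qed.

Lemma holv_lsub n m k (F : 'rV[C]_n -> 'rV[C]_(m + k)) :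
  holv F -> holv (fun x => lsubmx (F x)).
Proof. by move=> hF j; apply: eq_hol (hF (lshift k j)) => x; rewrite mxE. Qed.

Lemma holv_rsub n m k (F : 'rV[C]_n -> 'rV[C]_(m + k)) :
  holv F -> holv (fun x => rsubmx (F x)).
Proof. by move=> hF j; apply: eq_hol (hF (rshift m j)) => x; rewrite mxE. Qed.

Lemma holv_mulmx n m k (F : 'rV[C]_n -> 'rV[C]_m) (A : 'rV[C]_n -> 'M[C]_(m, k)) :
  holv F -> (forall i j, hol (fun x => A x i j)) -> holv (fun x => F x *m A x).
Proof.
move=> hF hA j; apply: eq_hol (hol_sum _ (fun i => holM (hF i) (hA i j))) => x.
by rewrite mxE.
Qed.
End Germs.

(** * Derivatives *)

Section Derivatives.
Variable R : realType.
Local Notation C := R[i].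

(** Stated with an order of vanishing, so that differential calculus reduces to the
    arithmetic of [bigO]. *)
Definition hasder n (f : 'rV[C]_n -> C) (p : 'rV[C]_n) (d : 'cV[C]_n) :=
  bigO 2 (fun v => f (p + v) - f p - (v *m d) ord0 ord0).

Definition hasD n m (F : 'rV[C]_n -> 'rV[C]_m) (p : 'rV[C]_n) (A : 'M[C]_(n, m)) :=
  forall k, hasder (fun x => F x ord0 k) p (col k A).

Lemma mulmx_colE n m (v : 'rV[C]_n) (A : 'M[C]_(n, m)) k :
  (v *m col k A) ord0 ord0 = (v *m A) ord0 k.
Proof. by rewrite !mxE; apply: eq_bigr => i _; rewrite mxE. Qed.

Lemma bigO1_lin n m (A : 'M[C]_(n, m)) j : bigO 1 (fun v : 'rV[C]_n => (v *m A) ord0 j).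
Proof.
apply: bigO_ext (bigO_sum (index_enum _) (fun i => bigOZ (A i j) (bigO_coord _ i))).
by apply: near0W => v; rewrite mxE; apply: eq_bigr => i _; rewrite mulrC.
Qed.

(** Compare the sizes of the two sides along a coordinate axis. *)
Lemma bigO2_lin n (d : 'cV[C]_n) :
  bigO 2 (fun v : 'rV[C]_n => (v *m d) ord0 ord0) -> d = 0.
Proof.
move=> /bigOP[K [r [K0 r0 h]]]; apply/colP => j; rewrite mxE; apply: nrm_small => e e0.
pose t := Num.min r (e / K).
have t0 : 0 < t by rewrite lt_min r0 divr_gt0.
have tr : t <= r by rewrite ge_min lexx.
have te : K * t <= e by rewrite mulrC -ler_pdivlMr// ge_min lexx orbT.
have := h t (\row_i (t *+ (i == j))%:C) (ltW t0) tr.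
have -> : ((\row_i (t *+ (i == j))%:C) *m d) ord0 ord0 = t%:C * d j ord0.
  rewrite mxE (bigD1 j)//= mxE eqxx mulr1n big1 ?addr0// => i /negbTE ij.
  by rewrite mxE ij mulr0n mul0r.
rewrite nrmM nrm_real ger0_norm ?(ltW t0)// => hh.
rewrite (le_trans _ te)// -(ler_pM2l t0) (le_trans (hh _))//.
  by move=> i; rewrite mxE nrm_real; case: eqP => _; rewrite ?normr0 ?(ltW t0)// ger0_norm ?(ltW t0).
by rewrite expr2 mulrCA.
Qed.

Lemma hasder_uniq n (f : 'rV[C]_n -> C) p d d' : hasder f p d -> hasder f p d' -> d = d'.
Proof.
move=> h h'; apply/eqP; rewrite -subr_eq0; apply/eqP/bigO2_lin.
apply: bigO_ext (bigOD h' (bigON h)); apply: near0W => v.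
by rewrite mulmxBr [in RHS]mxE [in X in _ = _ + X]mxE; ring.
Qed.

Lemma hasder_ext n (f g : 'rV[C]_n -> C) p d :
  near0 (fun v => f (p + v) = g (p + v)) -> hasder f p d -> hasder g p d.
Proof.
move=> fg; apply: bigO_ext; have := near0_at0 fg; rewrite addr0 => e.
by apply: near0S fg => v ->; rewrite e.
Qed.

Lemma eq_hasder n (f g : 'rV[C]_n -> C) p d : f =1 g -> hasder f p d -> hasder g p d.
Proof. by move=> /funext ->. Qed.

Lemma hasder_O1 n (f : 'rV[C]_n -> C) p d :
  hasder f p d -> bigO 1 (fun v => f (p + v) - f p).
Proof.
move=> /bigOS h; apply: bigO_ext (bigOD h (bigO1_lin d ord0)).
by apply: near0W => v; ring.
Qed.

Lemma hasder_const n (c : C) (p : 'rV[C]_n) : hasder (fun=> c) p 0.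
Proof.
apply: bigO_ext (bigO_zero _ _ _); apply: near0W => v.
by rewrite mulmx0 mxE; ring.
Qed.

Lemma hasder_coord n j (p : 'rV[C]_n) : hasder (fun x => x ord0 j) p (delta_mx j ord0).
Proof.
apply: bigO_ext (bigO_zero _ _ _); apply: near0W => v.
rewrite !mxE (bigD1 j)//= mxE !eqxx big1 => [|i /negbTE ij]; first by rewrite mulr1; ring.
by rewrite mxE ij mulr0.
Qed.

Lemma hasderD n (f g : 'rV[C]_n -> C) p d e :
  hasder f p d -> hasder g p e -> hasder (fun x => f x + g x) p (d + e).
Proof.
move=> hf hg; apply: bigO_ext (bigOD hf hg); apply: near0W => v.
by rewrite mulmxDr [in RHS]mxE; ring.
Qed.

Lemma hasderZ n (f : 'rV[C]_n -> C) p d c :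
  hasder f p d -> hasder (fun x => c * f x) p (c *: d).
Proof.
move=> hf; apply: bigO_ext (bigOZ c hf); apply: near0W => v.
by rewrite -scalemxAr [in RHS]mxE; ring.
Qed.

Lemma hasder_sum n (I : Type) (s : seq I) (f : I -> 'rV[C]_n -> C) p d :
  (forall i, hasder (f i) p (d i)) ->
  hasder (fun x => \sum_(i <- s) f i x) p (\sum_(i <- s) d i).
Proof.
move=> h; elim: s => [|i s IH].
  by rewrite big_nil; apply: eq_hasder (hasder_const 0 p) => x; rewrite big_nil.
rewrite big_cons; apply: eq_hasder (hasderD (h i) IH) => x.
by rewrite big_cons.
Qed.

Lemma hasderM n (f g : 'rV[C]_n -> C) p d e :
  hasder f p d -> hasder g p e ->
  hasder (fun x => f x * g x) p (g p *: d + f p *: e).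
Proof.
move=> hf hg.
have h := bigOM (hasder_O1 hf) (hasder_O1 hg).
apply: bigO_ext (bigOD h (bigOD (bigOZ (g p) hf) (bigOZ (f p) hg))).
apply: near0W => v; rewrite mulmxDr -!scalemxAr [in RHS]mxE.
by rewrite [in RHS]mxE [in X in _ = _ - (_ + X)]mxE; ring.
Qed.

Lemma hasD_O1 n m (F : 'rV[C]_n -> 'rV[C]_m) p A :
  hasD F p A -> bigOv 1 (fun v => F (p + v) - F p).
Proof.
by move=> h j; apply: bigO_ext (hasder_O1 (h j)); apply: near0W => v; rewrite !mxE.
Qed.

Lemma hasder_comp n m (g : 'rV[C]_m -> C) (F : 'rV[C]_n -> 'rV[C]_m) p A d :
  hasD F p A -> hasder g (F p) d -> hasder (fun x => g (F x)) p (A *m d).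
Proof.
move=> hF hg.
have h2 : bigO 2 (fun v => ((F (p + v) - F p - v *m A) *m d) ord0 ord0).
  apply: bigO_ext (bigO_sum (index_enum _) (fun i => bigOZ (d i ord0) (hF i))).
  apply: near0W => v; rewrite [in RHS]mxE; apply: eq_bigr => i _.
  by rewrite mulmx_colE !mxE mulrC.
apply: bigO_ext (bigOD (bigO_comp hg (hasD_O1 hF)) h2); apply: near0W => v.
rewrite [F p + _]addrC subrK (mulmxBl (F (p + v) - F p) (v *m A)) mulmxA.
have subE (X Y : 'M[C]_1) : (X - Y) ord0 ord0 = X ord0 ord0 - Y ord0 ord0 by rewrite !mxE.
by rewrite subE; ring.
Qed.

Lemma hasD_comp n m k (G : 'rV[C]_m -> 'rV[C]_k) (F : 'rV[C]_n -> 'rV[C]_m) p A B :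
  hasD F p A -> hasD G (F p) B -> hasD (fun x => G (F x)) p (A *m B).
Proof. by move=> hF hG j; rewrite colE -mulmxA -colE; exact: hasder_comp hF (hG j). Qed.

Lemma hasD_uniq n m (F : 'rV[C]_n -> 'rV[C]_m) p A B : hasD F p A -> hasD F p B -> A = B.
Proof.
move=> hA hB; apply/matrixP => i j.
by have /colP/(_ i) := hasder_uniq (hA j) (hB j); rewrite !mxE.
Qed.

Lemma hasD_ext n m (F G : 'rV[C]_n -> 'rV[C]_m) p A :
  near0 (fun v => F (p + v) = G (p + v)) -> hasD F p A -> hasD G p A.
Proof. by move=> h hF j; apply: hasder_ext (hF j); apply: near0S h => v ->. Qed.

Lemma hasDD n m (F G : 'rV[C]_n -> 'rV[C]_m) p A B :
  hasD F p A -> hasD G p B -> hasD (fun x => F x + G x) p (A + B).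
Proof.
move=> hF hG j; have := hasderD (hF j) (hG j); rewrite -raddfD.
by apply: eq_hasder => x; rewrite mxE.
Qed.

Lemma hasD_lin n m (A : 'M[C]_(n, m)) p : hasD (fun x => x *m A) p A.
Proof.
move=> j; apply: bigO_ext (bigO_zero _ _ _); apply: near0W => v.
rewrite mulmx_colE mulmxDl [in (_ + _ : 'rV__) _ _]mxE; ring.
Qed.

Lemma hasD_row n m k (F : 'rV[C]_n -> 'rV[C]_m) (G : 'rV[C]_n -> 'rV[C]_k) p A B :
  hasD F p A -> hasD G p B -> hasD (fun x => row_mx (F x) (G x)) p (row_mx A B).
Proof.
move=> hF hG j; case: (split_ordP j) => i ->.
  by rewrite colKl; apply: eq_hasder (hF i) => x; rewrite row_mxEl.
by rewrite colKr; apply: eq_hasder (hG i) => x; rewrite row_mxEr.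
Qed.

(** Near the origin a holomorphic germ has holomorphic partial derivatives: they are
    the values at zero increment of the quotients given by Hadamard's lemma applied
    to [f (p + v)]. *)
Lemma hol_hasder n (f : 'rV[C]_n -> C) : hol f ->
  exists d : 'rV[C]_n -> 'cV[C]_n, (forall j, hol (fun p => d p j ord0)) /\
    near0 (fun p => hasder f p (d p)).
Proof.
move=> [r [B [r0 hf]]].
have r2 : 0 < r / 2 by rewrite divr_gt0.
have hg : rep (r / 2) (fun X : 'rV[C]_(n + n) => f (lsubmx X + rsubmx X)) B.
  apply: rep_comp hf _ => // j.
  apply: (@rep_leB _ _ _ _ (r / 2 + r / 2)); first by lra.
  have h1 := @rep_coord R (n + n) (r / 2) (lshift n j) (ltW r2).
  have h2 := @rep_coord R (n + n) (r / 2) (rshift n j) (ltW r2).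
  by apply: rep_ext (rep_add h1 h2 (ltW r2)) => X _; rewrite !mxE.
have [h [hh hE]] := rep_had r2 hg.
exists (fun p => \col_j h j (row_mx p 0)); split=> [j|].
  apply: (eq_hol (f := fun p => h j (row_mx p 0))) => [p|]; first by rewrite mxE.
  apply: (@hol_comp _ _ _ (h j) (fun p => row_mx p 0)).
  - exact: (ex_intro _ (r / 2) (ex_intro _ (B / (r / 2)) (conj r2 (hh j)))).
  - by apply: (@holv_row _ _ _ _ (fun p => p) (fun=> 0)); [exact: holv_id|exact: holv_const].
  - by rewrite row_mx0.
exists (r / 2); split=> // p pr.
have [m hm] := choice (fun j => rep_had r2 (hh j)).
exists (\sum_(j < n) \sum_(k < n) B / (r / 2) / (r / 2)), (r / 2); split=> // rho v rho0 rr vr.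
have inX : inD (r / 2) (row_mx p v).
  move=> i; case: (split_ordP i) => k ->; rewrite ?row_mxEl ?row_mxEr//.
  exact: inD_le vr _.
have -> : f (p + v) - f p - (v *m (\col_j h j (row_mx p 0))) ord0 ord0
   = \sum_j \sum_k v ord0 j * v ord0 k * m j k (row_mx p v).
  have := hE _ inX; rewrite !(row_mxKl, row_mxKr) addr0 => ->.
  rewrite [X in X - _ - _]addrC addrK mxE -sumrB.
  apply: eq_bigr => j _; have [_ hm2] := hm j.
  rewrite hm2// row_mxKl row_mxKr mxE mulrDr [X in X - _]addrC addrK mulr_sumr.
  by apply: eq_bigr => k _; rewrite mulrA.
rewrite (le_trans (ler_nrm_sum _ _ _))// mulr_suml ler_sum// => j _.
rewrite (le_trans (ler_nrm_sum _ _ _))// mulr_suml ler_sum// => k _.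
rewrite nrmM mulrC; have [hm1 _] := hm j.
rewrite ler_pM ?nrm_ge0//; first exact: rep_bound (hm1 k) inX.
by rewrite nrmM expr2 ler_pM ?nrm_ge0.
Qed.

(** An arbitrary value is returned where [f] has no derivative. *)
Definition der n (f : 'rV[C]_n -> C) (p : 'rV[C]_n) : 'cV[C]_n :=
  xget 0 [set d | hasder f p d].

Definition Dm n m (F : 'rV[C]_n -> 'rV[C]_m) (p : 'rV[C]_n) : 'M[C]_(n, m) :=
  \matrix_(j, k) der (fun x => F x ord0 k) p j ord0.

Lemma derE n (f : 'rV[C]_n -> C) p d : hasder f p d -> der f p = d.
Proof.
move=> h; apply: (hasder_uniq _ h).
by have := @xgetPex _ 0 [set d | hasder f p d] (ex_intro _ d h).
Qed.

Lemma der_hasder n (f : 'rV[C]_n -> C) p d : hasder f p d -> hasder f p (der f p).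
Proof. by move=> h; rewrite (derE h). Qed.

Lemma col_Dm n m (F : 'rV[C]_n -> 'rV[C]_m) p k :
  col k (Dm F p) = der (fun x => F x ord0 k) p.
Proof. by apply/colP => i; rewrite !mxE. Qed.

Lemma DmE n m (F : 'rV[C]_n -> 'rV[C]_m) p A : hasD F p A -> Dm F p = A.
Proof.
move=> h; apply/matrixP => i j; rewrite mxE (derE (h j)); by rewrite mxE.
Qed.

Lemma hol_der n (f : 'rV[C]_n -> C) : hol f -> near0 (fun p => hasder f p (der f p)).
Proof. by move=> /hol_hasder[d [_ h]]; apply: near0S h => p /der_hasder. Qed.

Lemma hol_derj n (f : 'rV[C]_n -> C) j : hol f -> hol (fun p => der f p j ord0).
Proof. by move=> /hol_hasder[d [hd h]]; apply: hol_ext (hd j); apply: near0S h => p /derE ->. Qed.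

Lemma holv_hasD n m (F : 'rV[C]_n -> 'rV[C]_m) : holv F ->
  near0 (fun p => hasD F p (Dm F p)).
Proof.
move=> hF; suff: near0 (fun p => forall k, hasder (fun x => F x ord0 k) p (col k (Dm F p))) by [].
have [r hr] := choice (fun k => hol_der (hF k)).
exists (\big[Num.min/1]_k r k); split.
  by apply/bigmin_gtP; split=> // k _; have [] := hr k.
move=> x xr k; rewrite col_Dm; have [_] := hr k; apply; apply: inD_le xr.
exact: bigmin_le_cond.
Qed.

Lemma holv_Dm n m (F : 'rV[C]_n -> 'rV[C]_m) : holv F ->
  forall i j, hol (fun p => Dm F p i j).
Proof. by move=> hF i j; apply: eq_hol (hol_derj i (hF j)) => p; rewrite mxE. Qed.
End Derivatives.

(** * The implicit function theorem *)

Section ImplicitFunctions.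
Variable R : realType.
Local Notation C := R[i].

Lemma bnd_geometric : bnd (fun k : nat => 2^-1 ^+ k : R) 2.
Proof.
have geo N : \sum_(k < N) 2^-1 ^+ k = 2 - 2 * 2^-1 ^+ N :> R.
  elim: N => [|N IH]; first by rewrite big_ord0 expr0; ring.
  by rewrite big_ord_recr /= IH exprS; field.
move=> J; have [N hN] : exists N, forall k, k \in J -> (k < N)%N.
  exists (\max_(k <- J) k).+1 => k kJ; rewrite ltnS.
  exact: (@leq_bigmax_seq _ (enum_fset J) xpredT id k).
rewrite (le_trans (y := \sum_(k < N) 2^-1 ^+ k))//; last first.
  by rewrite geo gerBl mulr_ge0// exprn_ge0// invr_ge0.
have -> : \sum_(k < N) 2^-1 ^+ k = \sum_(k <- [fset k in iota 0 N]%fset) 2^-1 ^+ k :> R.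
  rewrite -(big_mkord xpredT (fun k => 2^-1 ^+ k : R)) /index_iota subn0.
  apply: perm_big; apply: uniq_perm; rewrite ?iota_uniq ?fset_uniq//.
  by move=> k; rewrite !inE.
have sub : (J `<=` [fset k in iota 0 N])%fset.
  by apply/fsubsetP => k /hN kN; rewrite !inE mem_iota.
rewrite [leRHS](big_fsetID _ (mem J)) /=.
have -> : [fset x in [fset k in iota 0 N] | x \in J]%fset = J.
  apply/fsetP => k; rewrite !inE; case: (boolP (k \in J)) => kJ; rewrite ?andbF//.
  by have := fsubsetP sub _ kJ; rewrite !inE => ->.
by rewrite lerDl sumr_ge0// => k _; rewrite exprn_ge0// invr_ge0.
Qed.

Lemma holv_rep n m (F : 'rV[C]_n -> 'rV[C]_m) : holv F ->
  exists r B : R, [/\ 0 < r, 0 <= B & forall j, rep r (fun x => F x ord0 j) B].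
Proof.
move=> hF; have [r hr] := choice hF; have [B hB] := choice hr.
exists (\big[Num.min/1]_j r j), (\sum_j B j).
have B0 j : 0 <= B j by have [_ /rep_ge0] := hB j.
split; first by apply/bigmin_gtP; split=> // j _; have [] := hB j.
  by apply: sumr_ge0.
move=> j; have [rj hj] := hB j.
apply: (@rep_leB _ _ _ _ (B j)); first by rewrite (bigD1 j)//= lerDl sumr_ge0.
apply: rep_ler hj; last exact: bigmin_le_cond.
by apply/ltW/bigmin_gtP; split=> // i _; have [] := hB i.
Qed.

Lemma rep_sum n r (I : Type) (s : seq I) (f : I -> 'rV[C]_n -> C) (b : I -> R) :
  0 <= r -> (forall i, rep r (f i) (b i)) ->
  rep r (fun x => \sum_(i <- s) f i x) (\sum_(i <- s) b i).
Proof.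
move=> r0 h; elim: s => [|i s IH].
  rewrite big_nil -nrm0; apply: rep_ext (@rep_const _ _ _ _) => x _.
  by rewrite big_nil.
by rewrite big_cons; apply: rep_ext (rep_add (h i) IH r0) => x _; rewrite big_cons.
Qed.

Lemma inD_row n m r (x : 'rV[C]_n) (y : 'rV[C]_m) :
  inD r x -> inD r y -> inD r (row_mx x y).
Proof.
by move=> hx hy i; case: (split_ordP i) => k ->; rewrite ?row_mxEl ?row_mxEr.
Qed.

Lemma inD_lsub n m r (X : 'rV[C]_(n + m)) : inD r X -> inD r (lsubmx X).
Proof. by move=> h i; rewrite mxE. Qed.

Lemma inD_rsub n m r (X : 'rV[C]_(n + m)) : inD r X -> inD r (rsubmx X).
Proof. by move=> h i; rewrite mxE. Qed.

(** A germ [g] whose restriction to [x = 0] vanishes to order two is a contraction in [y]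
    in the following sense: Hadamard's lemma gives
    [g (x, y + t) - g (x, y) = \sum_k t_k H_k (x, y, t)] with [H_k 0 = 0]. *)
Lemma contraction n m (g : 'rV[C]_(n + m) -> 'rV[C]_m) :
  holv g -> g 0 = 0 -> bigOv 2 (fun y => g (row_mx 0 y)) ->
  exists (s : R) (H : 'I_m -> 'I_m -> 'rV[C]_(n + m + m) -> C), [/\ 0 < s,
    forall j k, rep s (H j k) (2 * m.+1%:R)^-1 &
    forall X : 'rV[C]_(n + m + m), inD s X -> forall j,
     g (lsubmx X + row_mx 0 (rsubmx X)) ord0 j
     = g (lsubmx X) ord0 j + \sum_k rsubmx X ord0 k * H j k X].
Proof.
move=> hg g0 g2; have [r [B [r0 B0 hr]]] := holv_rep hg.
have r2 : 0 < r / 2 by rewrite divr_gt0.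
have hG j : rep (r / 2) (fun X : 'rV[C]_(n + m + m) =>
    g (lsubmx X + row_mx 0 (rsubmx X)) ord0 j) B.
  apply: (@rep_comp _ _ _ _ r (fun X => g X ord0 j) _
    (fun X => lsubmx X + row_mx 0 (rsubmx X))) => // i.
  have h1 := @rep_coord R (n + m + m) (r / 2) (lshift m i) (ltW r2).
  apply: (@rep_leB _ _ _ _ (r / 2 + r / 2)); first by lra.
  case: (split_ordP i) h1 => k -> h1.
    apply: (@rep_leB _ _ _ _ (r / 2)); first by lra.
    by apply: rep_ext h1 => X _; rewrite !(row_mxEl, mxE) addr0.
  have h2 := @rep_coord R (n + m + m) (r / 2) (rshift (n + m) k) (ltW r2).
  apply: rep_ext (rep_add h1 h2 (ltW r2)) => X _.
  by rewrite [in RHS]mxE row_mxEr !mxE.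
have [H hH] := choice (fun j => rep_had r2 (hG j)).
have HE X j : inD (r / 2) X -> g (lsubmx X + row_mx 0 (rsubmx X)) ord0 j
     = g (lsubmx X) ord0 j + \sum_k rsubmx X ord0 k * H j k X.
  move=> XD; have [_ h] := hH j; rewrite h//.
  by rewrite row_mxKl row_mxKr row_mx0 addr0.
have H0 j k : H j k 0 = 0.
  suff /colP/(_ k) : \col_k H j k 0 = 0 by rewrite !mxE.
  apply: bigO2_lin.
  have hd i : bigO 1 (fun y : 'rV[C]_m => H j i (row_mx 0 y) - H j i 0).
    apply: hol_bigO1; last by rewrite row_mx0 subrr.
    apply: holB (hol_const _ _).
    apply: (@hol_comp _ _ _ (H j i) (fun y => row_mx 0 y)); last by rewrite row_mx0.
      have [h _] := hH j.
      exact: (ex_intro _ (r / 2) (ex_intro _ (B / (r / 2)) (conj r2 (h i)))).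
    by apply: (@holv_row _ _ _ _ (fun=> 0) (fun y => y)); [exact: holv_const|exact: holv_id].
  have hs := bigO_sum (index_enum _) (fun i => bigOM (bigO_coord _ i) (hd i)).
  apply: bigO_ext (bigOD (g2 j) (bigON hs)).
  exists (r / 2); split=> // y yD.
  have inX : inD (r / 2) (row_mx (0 : 'rV[C]_(n + m)) y).
    by apply: inD_row => //; apply: inD0; exact: ltW.
  have := HE _ j inX; rewrite row_mxKl row_mxKr add0r g0 [in X in X + _]mxE add0r => ->.
  rewrite mxE -sumrB; apply: eq_bigr => i _.
  by rewrite [(\col__ _) _ _]mxE; ring.
have m0 : 0 < (2 * m.+1%:R)^-1 :> R by rewrite invr_gt0 mulr_gt0// ltr0n.
pose K := B / (r / 2) + 1.
have K0 : 0 < K by rewrite /K ltr_wpDl// divr_ge0// ltW.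
pose s := Num.min (r / 2) (r / 2 * (2 * m.+1%:R)^-1 / K).
have s0 : 0 < s by rewrite lt_min r2 divr_gt0// mulr_gt0.
have sr : s <= r / 2 by rewrite ge_min lexx.
exists s, H; split=> // [j k|X XD j]; last by apply: HE; exact: inD_le XD.
have [h _] := hH j; apply: rep_leB (rep_small s0 sr (H0 j k) (h k)).
rewrite mulrAC ler_pdivrMr// (le_trans (y := s * K))//.
  by rewrite (ler_wpM2l (ltW s0))// /K; lra.
by rewrite -ler_pdivlMr// [_^-1 * _]mulrC ge_min lexx orbT.
Qed.

Lemma inD_bigmax n (x : 'rV[C]_n) : inD (\big[Num.max/0]_j nrm (x ord0 j)) x.
Proof. by move=> j; exact: le_bigmax_cond. Qed.

Lemma inD_half n (x : 'rV[C]_n) r : inD r x ->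
  (forall e, inD e x -> inD (e / 2) x) -> x = 0.
Proof.
move=> xr h; have := h _ (inD_bigmax x); set M := \big[_/_]_j _ => hM.
have M0 : 0 <= M by exact: bigmax_ge_id.
have : M <= M / 2 by apply: bigmax_le => [|j _]; rewrite ?divr_ge0.
move=> MM; apply/rowP => j; rewrite mxE; apply/eqP; rewrite -nrm_eq0 eq_le nrm_ge0 andbT.
by rewrite (le_trans (inD_bigmax x j))// -/M; lra.
Qed.

(** The implicit function theorem, by Picard iteration in the algebra of power series
    that converge absolutely on a polydisc. *)
Lemma implicit_function n m (g : 'rV[C]_(n + m) -> 'rV[C]_m) :
  holv g -> g 0 = 0 -> bigOv 2 (fun y => g (row_mx 0 y)) ->
  exists F : 'rV[C]_n -> 'rV[C]_m, [/\ holv F, F 0 = 0 &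
    near0 (fun X => rsubmx X = g X <-> rsubmx X = F (lsubmx X))].
Proof.
move=> hg g0 g2; have [s' [H [s'0 hH HE]]] := contraction hg g0 g2.
pose s := s' / 2; have s0 : 0 < s by rewrite divr_gt0.
have ss : s + s = s' by rewrite /s; lra.
have m0 : 0 < m.+1%:R :> R by rewrite ltr0n.
have m1 : m%:R <= m.+1%:R :> R by rewrite ler_nat.
have hg0 : holv (fun x : 'rV[C]_n => g (row_mx x 0)).
  apply: holv_comp => //; last by rewrite row_mx0.
  by apply: (@holv_row _ _ _ _ (fun p => p) (fun=> 0)); [exact: holv_id|exact: holv_const].
have s2 : 0 < s / 2 by rewrite divr_gt0.
have g00 : g (row_mx (0 : 'rV_n) 0) = 0 by rewrite row_mx0.
have [r1 [r10 hr1]] := holv_small hg0 g00 s2.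
pose r := Num.min r1 s.
have r0 : 0 < r by rewrite lt_min r10.
have rs : r <= s by rewrite ge_min lexx orbT.
have rr1 : r <= r1 by rewrite ge_min lexx.
have {}hr1 := hr1 r r0 rr1.
(* the increments of g in y *)
have inX (x : 'rV[C]_n) (y y' : 'rV[C]_m) : inD r x -> inD s y -> inD s y' -> inD s' (row_mx (row_mx x y) (y' - y)).
  move=> xr ys ys'; apply: inD_row; first by apply: inD_row; [apply: inD_le xr|apply: inD_le ys]; lra.
  move=> j; rewrite !mxE (le_trans (ler_nrmB _ _))//; have := ys j; have := ys' j; lra.
have incr x y y' j : inD r x -> inD s y -> inD s y' ->
    g (row_mx x y') ord0 j - g (row_mx x y) ord0 j
    = \sum_k (y' - y) ord0 k * H j k (row_mx (row_mx x y) (y' - y)).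
  move=> xr ys ys'; have := HE _ (inX _ _ _ xr ys ys') j.
  rewrite row_mxKl row_mxKr add_row_mx addr0 addrC subrK => ->.
  by rewrite addrAC subrr add0r.
have lip x y y' e : inD r x -> inD s y -> inD s y' -> inD e (y' - y) ->
    inD (e / 2) (g (row_mx x y') - g (row_mx x y)).
  move=> xr ys ys' he j; rewrite [in nrm _]mxE [in X in nrm (_ + X)]mxE incr//.
  have e0 : 0 <= e by rewrite (le_trans (nrm_ge0 _) (he j)).
  rewrite (le_trans (ler_nrm_sum _ _ _))//.
  rewrite (le_trans (y := \sum_(k < m) e * (2 * m.+1%:R)^-1))//.
    apply: ler_sum => k _; rewrite nrmM ler_pM ?nrm_ge0//.
    exact: rep_bound (hH j k) (inX _ _ _ xr ys ys').
  rewrite sumr_const card_ord -[leLHS]mulr_natr -[leLHS]mulrA ler_wpM2l//.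
  rewrite invfM -mulrA ler_piMr ?invr_ge0// mulrC ler_pdivrMr// mul1r.
  exact: m1.
(* Picard iteration *)
pose F := fix F k x := if k is k'.+1 then g (row_mx x (F k' x)) else 0 : 'rV[C]_m.
pose d k x := F k.+1 x - F k x.
have dE k x j : d k x ord0 j = F k.+1 x ord0 j - F k x ord0 j by rewrite /d !mxE.
have step k : (forall j, rep r (fun x => F k x ord0 j) (s - s * 2^-1 ^+ k)) /\
    (forall j, rep r (fun x => d k x ord0 j) (s * 2^-1 ^+ k.+1)).
  elim: k => [|k [IH1 IH2]].
    split=> j.
      rewrite expr0 mulr1 subrr -nrm0; apply: rep_ext (@rep_const _ _ _ _) => x _.
      by rewrite mxE.
    by rewrite expr1; apply: rep_ext (hr1 j) => x _; rewrite /d /= subr0.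
  have q0 : 0 <= s * 2^-1 ^+ k.+1 by rewrite mulr_ge0 ?ltW// exprn_gt0// invr_gt0.
  have q1 : s * 2^-1 ^+ k.+1 <= s.
    by rewrite ler_piMr ?(ltW s0)// exprn_ile1// ?invr_ge0// invf_le1// ler1n.
  have IH1s j : rep r (fun x => F k x ord0 j) s.
    apply: rep_leB (IH1 j); by rewrite gerBl mulr_ge0 ?(ltW s0) ?exprn_ge0 ?invr_ge0.
  have S1 j : rep r (fun x => F k.+1 x ord0 j) (s - s * 2^-1 ^+ k.+1).
    apply: (@rep_leB _ _ _ _ (s - s * 2^-1 ^+ k + s * 2^-1 ^+ k.+1)).
      by rewrite exprS; lra.
    apply: rep_ext (rep_add (IH1 j) (IH2 j) (ltW r0)) => x _.
    by rewrite dE addrC subrK.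
  have S1s j : rep r (fun x => F k.+1 x ord0 j) s.
    by apply: rep_leB (S1 j); rewrite gerBl.
  split=> // j.
  apply: (@rep_leB _ _ _ _ (\sum_(l < m) s * 2^-1 ^+ k.+1 * (2 * m.+1%:R)^-1)).
    rewrite sumr_const card_ord -[leLHS]mulr_natr -[leLHS]mulrA [in leRHS]exprS [in leRHS]mulrCA.
    rewrite [leRHS]mulrC ler_wpM2l// invfM -mulrA ler_piMr ?invr_ge0//.
    by rewrite mulrC ler_pdivrMr// mul1r.
  pose X x := row_mx (row_mx x (F k x)) (d k x).
  have repX i : rep r (fun x => X x ord0 i) s'.
    case: (split_ordP i) => i1 ->; last first.
      apply: (rep_ext (f := fun x => d k x ord0 i1)); first by move=> x _; rewrite row_mxEr.
      by apply: rep_leB (IH2 i1); rewrite (le_trans q1)//; lra.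
    case: (split_ordP i1) => i2 ->.
      apply: (rep_ext (f := fun x => x ord0 i2)); first by move=> x _; rewrite !row_mxEl.
      by apply: (@rep_leB _ _ _ _ r); [lra|apply: rep_coord; exact: ltW].
    apply: (rep_ext (f := fun x => F k x ord0 i2)).
      by move=> x _; rewrite row_mxEl row_mxEr.
    by apply: rep_leB (IH1s i2); lra.
  have hl l := rep_mul r0 (IH2 l) (rep_comp r0 (hH j l) repX).
  apply: rep_ext (rep_sum (index_enum _) (ltW r0) hl) => x xr.
  rewrite dE; apply/esym/(@incr x (F k x) (F k.+1 x) j) => // i.
    exact: rep_bound (IH1s i) xr.
  exact: rep_bound (S1s i) xr.
have hb : bnd (fun k : nat => s * 2^-1 ^+ k.+1) s.
  have := bndZ (ltW s2) bnd_geometric; have -> : s / 2 * 2 = s by field.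
  by apply: bnd_le => k; rewrite exprS mulrA.
have [L hL] : exists L : 'rV[C]_n -> 'rV[C]_m,
    forall x, inD r x -> forall j, hsum (fun k : nat => d k x ord0 j) (L x ord0 j).
  have ex x : exists y : 'rV[C]_m, inD r x -> forall j, hsum (fun k : nat => d k x ord0 j) (y ord0 j).
    have [xr|nx] := pselect (inD r x); last by exists 0.
    have exj j : exists l, hsum (fun k : nat => d k x ord0 j) l.
      apply: (@hsum_ex _ _ _ s); apply: bnd_le hb => k.
      by have [_ h] := step k; exact: rep_bound (h j) xr.
    have [l hl] := choice exj; exists (\row_j l j) => _ j; by rewrite mxE.
  by have [L hL] := choice ex; exists L.
have repL j : rep r (fun x => L x ord0 j) s.
  apply: (@rep_hsum _ _ _ _ (fun k x => d k x ord0 j) _ _ _ r0 _ hb) => [k|x xr].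
    by have [_ h] := step k.
  exact: hL.
have Ls x : inD r x -> inD s (L x) by move=> xr j; exact: rep_bound (repL j) xr.
have Fs k x : inD r x -> inD s (F k x).
  move=> xr j; have [h _] := step k; rewrite (le_trans (rep_bound (h j) xr))//.
  by rewrite gerBl mulr_ge0 ?(ltW s0)// exprn_ge0// invr_ge0.
have lim x e : inD r x -> 0 < e -> exists N, forall k, (N <= k)%N -> inD e (L x - F k x).
  move=> xr e0; have [J hJ] := choice (fun j => hL x xr j _ e0).
  exists (\max_j \max_(k <- J j) k.+1) => k Nk j.
  have -> : (L x - F k x) ord0 j = L x ord0 j - \sum_(i <- [fset i in iota 0 k]%fset) d i x ord0 j.
    rewrite !mxE; congr (_ - _).
    have -> : \sum_(i <- [fset i in iota 0 k]%fset) d i x ord0 j = \sum_(i < k) d i x ord0 j.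
      rewrite -(big_mkord xpredT (fun i => d i x ord0 j)) /index_iota subn0.
      apply: perm_big; apply: uniq_perm; rewrite ?iota_uniq ?fset_uniq//.
      by move=> i; rewrite !inE.
    elim: k {Nk} => [|k IH]; first by rewrite big_ord0 mxE.
    by rewrite big_ord_recr /= -IH dE addrC subrK.
  apply: hJ; apply/fsubsetP => i iJ; rewrite !inE mem_iota add0n /= (leq_trans _ Nk)//.
  rewrite (leq_trans _ (leq_bigmax j))//.
  exact: (@leq_bigmax_seq _ (enum_fset (J j)) xpredT succn i).
have fix_L x : inD r x -> L x = g (row_mx x (L x)).
  move=> xr; apply/rowP => j; apply/eqP; rewrite -subr_eq0; apply/eqP/nrm_small => e e0.
  have e2 : 0 < e / 2 by rewrite divr_gt0.
  have [N hN] := lim x _ xr e2.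
  have h1 := hN _ (leqnSn N) j.
  have h2 := lip x _ _ _ xr (Fs N x xr) (Ls x xr) (hN _ (leqnn N)) j.
  rewrite !mxE in h1 h2.
  have -> : L x ord0 j - g (row_mx x (L x)) ord0 j
    = (L x ord0 j - g (row_mx x (F N x)) ord0 j) -
      (g (row_mx x (L x)) ord0 j - g (row_mx x (F N x)) ord0 j) by ring.
  rewrite (le_trans (ler_nrmB _ _))//; move: h1 h2; rewrite /=; lra.
have uniq_L x y : inD r x -> inD s y -> y = g (row_mx x y) -> y = L x.
  move=> xr ys ye; apply/eqP; rewrite -subr_eq0; apply/eqP.
  apply: (@inD_half _ _ s'); last first.
    by move=> e he; rewrite ye [in X in _ - X]fix_L//; apply: lip => //; exact: Ls.
  move=> j; rewrite !mxE (le_trans (ler_nrmB _ _))//.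
  by have := ys j; have := Ls x xr j; lra.
exists L; split.
- by move=> j; exists r, s.
- apply/esym/uniq_L; last by rewrite row_mx0 g0.
    by apply: inD0; exact: ltW.
  by apply: inD0; exact: ltW.
exists r; split=> // X Xr; have xr := inD_lsub Xr; have yr := inD_rsub Xr.
split=> e; last by rewrite -[X in g X]hsubmxK e -fix_L.
apply: uniq_L => //; first exact: inD_le yr.
by rewrite hsubmxK.
Qed.
End ImplicitFunctions.

(** * Conjugate germs, second derivatives and inverse functions *)

(** Proves [hol] and [holv] along the structure of the function. For each composition, it
    remains to prove that the inner map vanishes at the origin. *)
Ltac holt := repeat match goal with
  | H : hol ?f |- hol ?f => exact H
  | H : holv ?f |- holv ?f => exact H
  | |- holv (fun x => x) => exact: holv_id
  | |- holv (fun x => ?c) => exact: (holv_const _ c)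
  | |- hol (fun x => ?c) => exact: (hol_const _ c)
  | |- hol (fun x => x ord0 ?j) => exact: (hol_coord _ j)
  | |- holv (fun x => row_mx _ _) => refine (holv_row _ _)
  | |- holv (fun x => lsubmx _) => refine (holv_lsub _)
  | |- holv (fun x => rsubmx _) => refine (holv_rsub _)
  | |- holv (@lsubmx _ _ _ _) => exact: (holv_lsub (@holv_id _ _))
  | |- holv (@rsubmx _ _ _ _) => exact: (holv_rsub (@holv_id _ _))
  | |- holv (fun x => - _) => refine (holvN _)
  | |- holv (fun x => _ + - _) => refine (holvB _ _)
  | |- holv (fun x => _ + _) => refine (holvD _ _)
  | |- holv (fun x => _ *: _) => refine (holvZ _ _)
  | |- holv (fun x => _ *m _) => refine (holv_mulmx _ _)
  | H : holv ?F |- hol (fun x => ?F x ord0 ?j) => exact (H j)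
  | |- hol (fun x => - _) => refine (holN _)
  | |- hol (fun x => _ + - _) => refine (holB _ _)
  | |- hol (fun x => _ + _) => refine (holD _ _)
  | |- hol (fun x => _ * _) => refine (holM _ _)
  | H : holv ?F |- holv (fun x => ?F _) => refine (holv_comp H _ _)
  | H : hol ?F |- hol (fun x => ?F _) => refine (hol_comp H _ _)
  | H : holv ?F |- hol (fun x => ?F _ ord0 ?j) => refine (hol_comp (H j) _ _)
  | |- forall _, _ => intro
  | |- holv ?f => lazymatch f with
    | (fun _ => _) => fail
    | _ => refine (@eq_holv _ _ _ (fun x => f x) f (fun=> erefl) _)
    end
  end.

Section Symmetries.
Variable R : realType.
Local Notation C := R[i].

(** ** Conjugate germs *)

Definition cj m n (A : 'M[C]_(m, n)) : 'M[C]_(m, n) := map_mx conjc A.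

(** Conjugation of the coefficients of the series. *)
Definition star n (f : 'rV[C]_n -> C) (x : 'rV[C]_n) : C := (f (cj x))^*%C.

Definition starv n m (F : 'rV[C]_n -> 'rV[C]_m) (x : 'rV[C]_n) : 'rV[C]_m := cj (F (cj x)).

Lemma lsub0 m n1 n2 : lsubmx (0 : 'M[C]_(m, n1 + n2)) = 0.
Proof. by apply/matrixP => i j; rewrite !mxE. Qed.

Lemma rsub0 m n1 n2 : rsubmx (0 : 'M[C]_(m, n1 + n2)) = 0.
Proof. by apply/matrixP => i j; rewrite !mxE. Qed.

Lemma cjK m n : involutive (@cj m n).
Proof. by move=> A; apply/matrixP => i j; rewrite !mxE conjcK. Qed.

Lemma cj0 m n : cj (0 : 'M[C]_(m, n)) = 0.
Proof. by rewrite /cj map_mx0. Qed.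

Lemma cjD m n (A B : 'M[C]_(m, n)) : cj (A + B) = cj A + cj B.
Proof. exact: map_mxD. Qed.

Lemma cjN m n (A : 'M[C]_(m, n)) : cj (- A) = - cj A.
Proof. exact: map_mxN. Qed.

Lemma cjZ m n a (A : 'M[C]_(m, n)) : cj (a *: A) = a^*%C *: cj A.
Proof. exact: map_mxZ. Qed.

Lemma cjM m n p (A : 'M[C]_(m, n)) (B : 'M[C]_(n, p)) : cj (A *m B) = cj A *m cj B.
Proof. exact: map_mxM. Qed.

Lemma cj_row m n1 n2 (A : 'M[C]_(m, n1)) (B : 'M[C]_(m, n2)) :
  cj (row_mx A B) = row_mx (cj A) (cj B).
Proof. exact: map_row_mx. Qed.

Lemma cj_lsub m n1 n2 (A : 'M[C]_(m, n1 + n2)) : cj (lsubmx A) = lsubmx (cj A).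
Proof. exact: map_lsubmx. Qed.

Lemma cj_rsub m n1 n2 (A : 'M[C]_(m, n1 + n2)) : cj (rsubmx A) = rsubmx (cj A).
Proof. exact: map_rsubmx. Qed.

Lemma cj_col m n k (A : 'M[C]_(m, n)) : cj (col k A) = col k (cj A).
Proof. by apply/colP => i; rewrite !mxE. Qed.

Lemma cjE m n (A : 'M[C]_(m, n)) i j : cj A i j = (A i j)^*%C.
Proof. by rewrite mxE. Qed.

Lemma inD_cj n r (x : 'rV[C]_n) : inD r x -> inD r (cj x).
Proof. by move=> h j; rewrite mxE nrm_conj. Qed.

Lemma near0_cj n (P : 'rV[C]_n -> Prop) : near0 P -> near0 (fun x => P (cj x)).
Proof. by move=> [r [r0 h]]; exists r; split=> // x /inD_cj /h. Qed.

Lemma bigO_cj n k (f : 'rV[C]_n -> C) : bigO k f -> bigO k (star f).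
Proof.
move=> [K [r [r0 h]]]; exists K, r; split=> // rho x rho0 rr /inD_cj xr.
by rewrite nrm_conj; exact: h.
Qed.

Lemma hol_star n (f : 'rV[C]_n -> C) : hol f -> hol (star f).
Proof.
move=> [r [B [r0 [a [ha hf]]]]]; exists r, B; split=> //.
exists (fun al => (a al)^*%C); split=> [|x /inD_cj xr].
  by apply: bnd_le ha => al; rewrite nrm_conj.
apply: eq_hsum (hsum_conj (hf _ xr)) => al; rewrite rmorphM /= rmorph_prod.
congr (_ * _); apply: eq_bigr => i _.
by rewrite mxE rmorphXn /= conjcK.
Qed.

Lemma holv_star n m (F : 'rV[C]_n -> 'rV[C]_m) : holv F -> holv (starv F).
Proof. by move=> hF j; apply: eq_hol (hol_star (hF j)) => x; rewrite cjE. Qed.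

Lemma hasder_star n (f : 'rV[C]_n -> C) p d :
  hasder f p d -> hasder (star f) (cj p) (cj d).
Proof.
move=> /bigO_cj; apply: bigO_ext; apply: near0W => v.
rewrite /star !rmorphB /= cjD cjK; congr (_ - _).
by rewrite -cjE cjM cjK.
Qed.

Lemma hasD_star n m (F : 'rV[C]_n -> 'rV[C]_m) p A :
  hasD F p A -> hasD (starv F) (cj p) (cj A).
Proof.
move=> h k; have := hasder_star (h k); rewrite cj_col.
by apply: eq_hasder => x; rewrite /star cjE.
Qed.

(** ** Symmetry of second derivatives *)

Lemma hol_hadamard n (f : 'rV[C]_n -> C) : hol f ->
  exists h : 'I_n -> 'rV[C]_n -> C, (forall j, hol (h j)) /\
    near0 (fun x => f x = f 0 + \sum_j x ord0 j * h j x).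
Proof.
move=> [r [B [r0 hf]]].
have [h [hh hE]] := rep_had_seq r0 hf (index_enum_uniq _).
exists h; split=> [j|].
  exact: (ex_intro _ r (ex_intro _ (B / r) (conj r0 (hh j)))).
exists r; split=> // x xr; rewrite [LHS]hE//; congr (f _ + _).
by apply/rowP => i; rewrite !mxE mem_index_enum.
Qed.

Lemma near0_eq_der n (f g : 'rV[C]_n -> C) : hol f ->
  near0 (fun x => f x = g x) -> near0 (fun x => der g x = der f x).
Proof.
move=> hf fg; apply: near0S2 (hol_der hf) (near0_shift fg) => x hx e.
exact/derE/(hasder_ext e).
Qed.

(** Hadamard, twice: with [f = f 0 + \sum_l x_l h_l], both mixed derivatives at the origin
    are [d_k h_l + d_l h_k]. *)
Lemma der_sym0 n (f : 'rV[C]_n -> C) i j : hol f ->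
  der (fun x => der f x i ord0) 0 j ord0 = der (fun x => der f x j ord0) 0 i ord0.
Proof.
move=> hf; have [h [hh hE]] := hol_hadamard hf.
pose q l x := h l x + \sum_k x ord0 k * der (h k) x l ord0.
have hn : near0 (fun x => forall k, hasder (h k) x (der (h k) x)).
  pose H x : 'rV[C]_n := \row_k h k x.
  have hH : holv H by move=> k; apply: eq_hol (hh k) => x; rewrite mxE.
  apply: near0S (holv_hasD hH) => x hx k; have := hx k; rewrite col_Dm.
  by under eq_fun do rewrite mxE.
have dE l : near0 (fun x => der f x l ord0 = q l x).
  have h1 : near0 (fun x => der (fun x => f 0 + \sum_k x ord0 k * h k x) x l ord0 = q l x).
    apply: near0S hn => x hx.
    have := hasder_sum (index_enum _) (fun k => hasderM (hasder_coord k x) (hx k)).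
    move=> /(hasderD (hasder_const (f 0) x)) /derE ->.
    rewrite add0r summxE /q.
    under eq_bigr do rewrite !mxE eqxx andbT.
    rewrite big_split /=; congr (_ + _).
    rewrite (bigD1 l)//= eqxx mulr1 big1 ?addr0// => k /negbTE kl.
    by rewrite eq_sym kl mulr0.
  have e1 := near0_eq_der hf hE.
  by apply: near0S2 e1 h1 => x <-.
have dq l k : der (q l) 0 k ord0 = der (h l) 0 k ord0 + der (h k) 0 l ord0.
  have hd m := near0_at0 (hol_der (hol_derj l (hh m))).
  have := hasder_sum (index_enum _) (fun m => hasderM (hasder_coord m 0) (hd m)).
  move=> /(hasderD (near0_at0 hn l)) /derE ->.
  rewrite mxE summxE; congr (_ + _).
  under eq_bigr do rewrite !mxE eqxx andbT mul0r addr0.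
  rewrite (bigD1 k)//= eqxx mulr1 big1 ?addr0// => m /negbTE kl.
  by rewrite eq_sym kl mulr0.
have e l k : der (fun x => der f x l ord0) 0 k ord0 = der (q l) 0 k ord0.
  by rewrite (near0_at0 (near0_eq_der (hol_derj l hf) (dE l))).
by rewrite !e !dq addrC.
Qed.

(** Substitution of [p + v] in the series of [f], on a polydisc of half the radius. *)
Lemma hol_recenter n (f : 'rV[C]_n -> C) : hol f -> near0 (fun p => hol (fun v => f (p + v))).
Proof.
move=> [r [B [r0 hf]]]; have r2 : 0 < r / 2 by rewrite divr_gt0.
exists (r / 2); split=> // p pr; exists (r / 2), B; split=> //.
apply: rep_comp hf _ => // j.
apply: (@rep_leB _ _ _ _ (nrm (p ord0 j) + r / 2)); first by have := pr j; lra.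
apply: rep_ext (rep_add (rep_const _ _ (p ord0 j)) (rep_coord j (ltW r2)) (ltW r2)) => x _.
by rewrite mxE.
Qed.

Lemma hasder_shift n (f : 'rV[C]_n -> C) p v d :
  hasder (fun v => f (p + v)) v d <-> hasder f (p + v) d.
Proof.
by split; apply: bigO_ext; apply: near0W => w; rewrite addrA.
Qed.

Lemma der_shift n (f : 'rV[C]_n -> C) p v : der (fun v => f (p + v)) v = der f (p + v).
Proof.
rewrite /der; congr xget; apply/seteqP; split=> d; exact: (hasder_shift f p v d).1 || exact: (hasder_shift f p v d).2.
Qed.

Lemma der_sym n (f : 'rV[C]_n -> C) : hol f -> near0 (fun p => forall i j,
  der (fun x => der f x i ord0) p j ord0 = der (fun x => der f x j ord0) p i ord0).
Proof.
move=> /hol_recenter; apply: near0S => p hp i j.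
have := der_sym0 i j hp; under eq_fun do rewrite der_shift.
rewrite (der_shift (fun x => der f x i ord0)) addr0 => ->.
under eq_fun do rewrite der_shift.
by rewrite (der_shift (fun x => der f x j ord0)) addr0.
Qed.

(** ** Inverse functions *)

(** The equation [Psi q = c] is [q = q - (Psi q - c) A^-1], whose right-hand side has no
    linear term in [q]. *)
Lemma inverse_function n (Psi : 'rV[C]_n -> 'rV[C]_n) (A : 'M[C]_n) :
  holv Psi -> Psi 0 = 0 -> hasD Psi 0 A -> A \in unitmx ->
  exists Phi : 'rV[C]_n -> 'rV[C]_n, [/\ holv Phi, Phi 0 = 0,
    near0 (fun q => Phi (Psi q) = q) & near0 (fun c => Psi (Phi c) = c)].
Proof.
move=> hPsi Psi0 dPsi Au.
pose g (X : 'rV[C]_(n + n)) := rsubmx X - (Psi (rsubmx X) - lsubmx X) *m invmx A.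
have hg : holv g by rewrite /g; holt; rewrite rsub0.
have g0 : g 0 = 0 by rewrite /g rsub0 lsub0 Psi0 subrr mul0mx subrr.
have g2 : bigOv 2 (fun y => g (row_mx 0 y)).
  move=> j; apply: bigO_ext (bigO_sum (index_enum _) (fun i => bigOZ (- invmx A i j) (dPsi i))).
  apply: near0W => y; rewrite /g row_mxKl row_mxKr subr0.
  have -> : y - Psi y *m invmx A = - ((Psi y - y *m A) *m invmx A).
    by rewrite mulmxBl mulmxK// opprB.
  rewrite [in RHS]mxE [in X in - X]mxE -sumrN; apply: eq_bigr => i _.
  by rewrite mulmx_colE Psi0 add0r !mxE; ring.
have [Phi [hPhi Phi0 hE]] := implicit_function hg g0 g2.
have gE X : (rsubmx X = g X) <-> Psi (rsubmx X) = lsubmx X.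
  split=> [e|e]; last by rewrite /g e subrr mul0mx subr0.
  apply/eqP; rewrite -subr_eq0 -[X in X == _](mulmxKV Au); apply/eqP.
  suff -> : (Psi (rsubmx X) - lsubmx X) *m invmx A = 0 by rewrite mul0mx.
  by apply/eqP; rewrite -oppr_eq0 -(inj_eq (addrI (rsubmx X))) addr0 -/(g X) -e.
exists Phi; split=> //.
  have t : to0 (fun q => row_mx (Psi q) q).
    by apply: holv_to0; [holt|rewrite Psi0 row_mx0].
  apply: near0S (near0_comp t hE) => q; rewrite gE row_mxKl row_mxKr => -[h _].
  by rewrite -h.
have t : to0 (fun q => row_mx q (Phi q)).
  by apply: holv_to0; [holt|rewrite Phi0 row_mx0].
apply: near0S (near0_comp t hE) => q; rewrite gE row_mxKl row_mxKr => -[_ h].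
exact: h.
Qed.
End Symmetries.

(** * Normal coordinates *)

Section NormalCoordinates.
Variable R : realType.
Local Notation C := R[i].

Lemma bigO_at0 n k (f : 'rV[C]_n -> C) : bigO k.+1 f -> f 0 = 0.
Proof.
move=> [K [r [r0 h]]]; apply/eqP; rewrite -nrm_eq0 eq_le nrm_ge0 andbT.
have := h 0 0 (lexx 0) (ltW r0) (inD0 (lexx 0)).
by rewrite expr0n mulr0.
Qed.

Lemma bigOv_at0 n m k (F : 'rV[C]_n -> 'rV[C]_m) : bigOv k.+1 F -> F 0 = 0.
Proof. by move=> h; apply/rowP => j; rewrite (bigO_at0 (h j)) mxE. Qed.

Lemma bigOvZ n m k (F : 'rV[C]_n -> 'rV[C]_m) c : bigOv k F -> bigOv k (fun x => c *: F x).
Proof. by move=> h j; apply: bigO_ext (bigOZ c (h j)); apply: near0W => x; rewrite mxE. Qed.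

Lemma bigOvD n m k (F G : 'rV[C]_n -> 'rV[C]_m) :
  bigOv k F -> bigOv k G -> bigOv k (fun x => F x + G x).
Proof. by move=> h h' j; apply: bigO_ext (bigOD (h j) (h' j)); apply: near0W => x; rewrite mxE. Qed.

Lemma bigOv_comp n m l k (G : 'rV[C]_m -> 'rV[C]_l) (F : 'rV[C]_n -> 'rV[C]_m) :
  bigOv k G -> holv F -> F 0 = 0 -> bigOv k (fun x => G (F x)).
Proof. by move=> hG hF F0 j; exact: bigO_comp (hG j) (holv_bigO1 hF F0). Qed.

Lemma bigOv_ext n m k (F G : 'rV[C]_n -> 'rV[C]_m) :
  near0 (fun x => F x = G x) -> bigOv k F -> bigOv k G.
Proof. by move=> e h j; apply: bigO_ext (h j); apply: near0S e => x ->. Qed.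

Lemma bigOv_star n m k (F : 'rV[C]_n -> 'rV[C]_m) : bigOv k F -> bigOv k (starv F).
Proof. by move=> h j; apply: bigO_ext (bigO_cj (h j)); apply: near0W => x; rewrite cjE. Qed.

(** The factor of [v = (w - conj w) / (2 i)]. *)
Definition c2 : C := (2 * 'i%C)^-1.

Lemma i_sqr : 'i%C * 'i%C = -1 :> C.
Proof. by rewrite -expr2 sqr_i. Qed.

Lemma i_neq0 : 'i%C != 0 :> C.
Proof. by rewrite -nrm_eq0 nrm_i oner_neq0. Qed.

Lemma c2K : c2 * (2 * 'i%C) = 1.
Proof. by rewrite mulVf// mulf_neq0 ?i_neq0// pnatr_eq0. Qed.

Lemma c2E : c2 = - ('i%C / 2).
Proof.
apply: (mulIf (x := 2 * 'i%C)); first by rewrite mulf_neq0 ?i_neq0// pnatr_eq0.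
by rewrite c2K mulNr mulrA divfK ?pnatr_eq0// i_sqr opprK.
Qed.

Lemma conj_i : ('i%C : C)^*%C = - 'i%C.
Proof. by apply/eqP; rewrite eq_complex /= oppr0 !eqxx. Qed.

Lemma conjM (x y : C) : (x * y)^*%C = x^*%C * y^*%C. Proof. exact: rmorphM. Qed.

Lemma conjN (x : C) : (- x)^*%C = - x^*%C. Proof. exact: rmorphN. Qed.

Lemma conjD (x y : C) : (x + y)^*%C = x^*%C + y^*%C. Proof. exact: rmorphD. Qed.

Lemma conj_c2 : c2^*%C = - c2.
Proof. by rewrite c2E conjN conjM conj_i conjc_inv conjc_nat; ring. Qed.

Definition zero_simp := (row_mx0, lsub0, rsub0, cj0, addr0, add0r, subr0, subrr, scaler0, oppr0).

(** The defining function [v + T], complexified: [q] and [k] stand for a point and for the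
    conjugate of a point of the ambient space, with coordinates [(z, w)]. *)
Definition defS (T : 'rV[C]_((1 + 2) + (1 + 2)) -> 'rV[C]_2) (q k : 'rV[C]_(1 + 2)) : 'rV[C]_2 :=
  c2 *: (rsubmx q - rsubmx k) + T (row_mx q k).

(** Changes of the coordinate [w] only. *)
Definition chart (X : 'rV[C]_(1 + 2) -> 'rV[C]_2) (q : 'rV[C]_(1 + 2)) : 'rV[C]_(1 + 2) :=
  row_mx (lsubmx q) (rsubmx q + X q).

Lemma split_uv n (u v a b : 'rV[C]_n) :
  c2 *: (u + 'i%C *: v + a - (u - 'i%C *: v + b)) = v + c2 *: (a - b).
Proof. by apply/rowP => j; rewrite !mxE -[X in _ = X + _]mul1r -c2K; ring. Qed.

Lemma defS_conj T : near0 (fun x => T (row_mx (cj (rsubmx x)) (cj (lsubmx x))) = cj (T x)) ->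
  near0 (fun x : 'rV[C]_((1 + 2) + (1 + 2)) =>
    defS T (cj (rsubmx x)) (cj (lsubmx x)) = cj (defS T (lsubmx x) (rsubmx x))).
Proof.
apply: near0S => x e; rewrite /defS e hsubmxK cjD cjZ conj_c2 cjD cjN !cj_rsub.
by rewrite scaleNr -scalerN opprB.
Qed.

Lemma starv_chart X q : starv (chart X) q = row_mx (lsubmx q) (rsubmx q + starv X q).
Proof. by rewrite /starv /chart cj_row cjD -cj_lsub -cj_rsub !cjK. Qed.

(** The linear part of the equation is [v], so the implicit function theorem applies. The
    equation is real, hence its solution is preserved by the exchange of the point with
    its conjugate. *)
Lemma graph_in_chart (T : 'rV[C]_((1 + 2) + (1 + 2)) -> 'rV[C]_2) (X : 'rV[C]_(1 + 2) -> 'rV[C]_2) :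
  holv T -> bigOv 2 T ->
  near0 (fun x => T (row_mx (cj (rsubmx x)) (cj (lsubmx x))) = cj (T x)) ->
  holv X -> bigOv 2 X ->
  exists F : 'rV[C]_(1 + 1 + 2) -> 'rV[C]_2, [/\ holv F,
    near0 (fun x : 'rV[C]_(1 + 1 + 2 + 2) =>
      let z := lsubmx (lsubmx (lsubmx x)) in let ze := rsubmx (lsubmx (lsubmx x)) in
      let u := rsubmx (lsubmx x) in let v := rsubmx x in
      defS T (chart X (row_mx z (u + 'i%C *: v))) (starv (chart X) (row_mx ze (u - 'i%C *: v))) = 0
      <-> v = F (lsubmx x)) &
    near0 (fun t : 'rV[C]_(1 + 1 + 2) =>
      F (row_mx (row_mx (cj (rsubmx (lsubmx t))) (cj (lsubmx (lsubmx t)))) (cj (rsubmx t))) = cj (F t))].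
Proof.
move=> hT T2 /defS_conj Sconj hX X2; have T0 := bigOv_at0 T2; have X0 := bigOv_at0 X2.
have hX' := holv_star hX.
have X0' : starv X 0 = 0 by rewrite /starv cj0 X0 cj0.
pose P := chart X.
have hP : holv P by rewrite /P /chart; holt.
have P0 : P 0 = 0 by rewrite /P /chart !zero_simp X0 row_mx0.
have hP' := holv_star hP.
have P0' : starv P 0 = 0 by rewrite /starv cj0 P0 cj0.
have PE' q : starv P q = row_mx (lsubmx q) (rsubmx q + starv X q).
  by rewrite /starv /P /chart cj_row cjD -cj_lsub -cj_rsub !cjK.
have rP q : rsubmx (P q) = rsubmx q + X q by rewrite /P /chart row_mxKr.
have rP' q : rsubmx (starv P q) = rsubmx q + starv X q by rewrite PE' row_mxKr.
have PX : P = chart X by []; clearbody P.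
pose qx (x : 'rV[C]_(1 + 1 + 2 + 2)) := row_mx (lsubmx (lsubmx (lsubmx x))) (rsubmx (lsubmx x) + 'i%C *: rsubmx x).
pose kx (x : 'rV[C]_(1 + 1 + 2 + 2)) := row_mx (rsubmx (lsubmx (lsubmx x))) (rsubmx (lsubmx x) - 'i%C *: rsubmx x).
have hq : holv qx by rewrite /qx; holt.
have q0 : qx 0 = 0 by rewrite /qx !zero_simp.
have hk : holv kx by rewrite /kx; holt.
have k0 : kx 0 = 0 by rewrite /kx !zero_simp.
pose g3 x := - (c2 *: (X (qx x) - starv X (kx x)) + T (row_mx (P (qx x)) (starv P (kx x)))).
have hg3 : holv g3 by rewrite /g3; holt; rewrite ?q0 ?k0 ?P0 ?P0' ?row_mx0.
have g30 : g3 0 = 0 by rewrite /g3 q0 k0 P0 P0' X0 X0' row_mx0 T0 !zero_simp.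
have g32 : bigOv 2 (fun y => g3 (row_mx 0 y)).
  pose e (y : 'rV[C]_2) : 'rV[C]_(1 + 1 + 2 + 2) := row_mx 0 y.
  have he : holv e by rewrite /e; holt.
  have e0 : e 0 = 0 by rewrite /e row_mx0.
  have h1 : bigOv 2 (fun y => X (qx (e y))).
    apply: (@bigOv_comp _ _ _ _ X (fun y => qx (e y)) X2); last by rewrite e0 q0.
    exact: holv_comp hq he e0.
  have h2 : bigOv 2 (fun y => starv X (kx (e y))).
    apply: (@bigOv_comp _ _ _ _ (starv X) (fun y => kx (e y)) (bigOv_star X2)); last by rewrite e0 k0.
    exact: holv_comp hk he e0.
  have h3 : bigOv 2 (fun y => T (row_mx (P (qx (e y))) (starv P (kx (e y))))).
    apply: (@bigOv_comp _ _ _ _ T (fun y => row_mx (P (qx (e y))) (starv P (kx (e y))))) T2 _ _.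
      apply: holv_row; [apply: (holv_comp hP (holv_comp hq he e0))|apply: (holv_comp hP' (holv_comp hk he e0))].
        by rewrite e0 q0.
      by rewrite e0 k0.
    by rewrite e0 q0 k0 P0 P0' row_mx0.
  have := bigOvZ (-1) (bigOvD (bigOvZ c2 (bigOvD h1 (bigOvZ (-1) h2))) h3).
  by apply: bigOv_ext; apply: near0W => y; rewrite /g3 -/(e y) !scaleN1r.
have [F [hF F0 FE]] := implicit_function hg3 g30 g32.
have SF : near0 (fun x => defS T (P (qx x)) (starv P (kx x)) = 0 <-> rsubmx x = F (lsubmx x)).
  apply: near0S FE => x <-; rewrite /defS rP rP'.
  have -> : c2 *: (rsubmx (qx x) + X (qx x) - (rsubmx (kx x) + starv X (kx x))) =
     rsubmx x + c2 *: (X (qx x) - starv X (kx x)).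
    by rewrite /qx /kx !row_mxKr split_uv.
  rewrite -addrA; split=> [/eqP|->]; first by rewrite addr_eq0 => /eqP.
  by rewrite addNr.
have Fsym : near0 (fun t : 'rV[C]_(1 + 1 + 2) =>
    F (row_mx (row_mx (cj (rsubmx (lsubmx t))) (cj (lsubmx (lsubmx t)))) (cj (rsubmx t))) = cj (F t)).
  pose sw (x : 'rV[C]_(1 + 1 + 2 + 2)) : 'rV[C]_(1 + 1 + 2 + 2) :=
    row_mx (row_mx (row_mx (rsubmx (lsubmx (lsubmx x))) (lsubmx (lsubmx (lsubmx x)))) (rsubmx (lsubmx x))) (rsubmx x).
  have hsw : holv sw by rewrite /sw; holt.
  have sw0 : sw 0 = 0 by rewrite /sw !zero_simp.
  have t1 : to0 (fun t => row_mx t (F t)) by apply: holv_to0; [holt|rewrite F0 row_mx0].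
  have t2 : to0 (fun x => row_mx (P (qx x)) (starv P (kx x))).
    by apply: holv_to0; [holt|rewrite q0 k0 P0 P0' row_mx0].
  have t3 := near0_comp (holv_to0 hsw sw0) (near0_cj SF).
  apply: near0S3 (near0_comp t1 SF) (near0_comp t1 (near0_comp t2 Sconj)) (near0_comp t1 t3) => t.
  rewrite row_mxKl !row_mxKr !row_mxKl; set x := row_mx t (F t).
  move=> [_ /(_ erefl) d0]; move: (congr1 (@cj R _ _) d0); rewrite cj0 => {}d0 d1.
  have {d0 d1} := etrans d1 d0.
  have -> : cj (starv P (kx x)) = P (qx (cj (sw x))).
    rewrite /starv cjK; congr P; rewrite /kx /qx /sw !cj_row !(row_mxKl, row_mxKr).
    by rewrite cjD cjN cjZ conj_i scaleNr opprK.
  have -> : cj (P (qx x)) = starv P (kx (cj (sw x))).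
    rewrite /starv; congr (cj (P _)); rewrite /kx /qx /sw !cj_row !(row_mxKl, row_mxKr).
    by rewrite cjD cjN cjZ conj_i !cjK scaleNr opprK.
  move=> h [/(_ h) e _]; move: e.
  by rewrite /sw !cj_row !(row_mxKl, row_mxKr) => ->.
by rewrite PX in SF; exists F.
Qed.

(** The totally real surface [z = 0] of the submanifold is given by [v = i Y (u)], and the
    Segre variety of each of its points is a graph over the [z]-axis. The new [w] is chosen
    constant on these Segre varieties: then the equation of the submanifold reduces to
    [v = 0] as soon as one of the two variables [z] and [ze] vanishes. *)
Lemma normal_coordinates (T : 'rV[C]_((1 + 2) + (1 + 2)) -> 'rV[C]_2) :
  holv T -> bigOv 2 T ->
  near0 (fun x => T (row_mx (cj (rsubmx x)) (cj (lsubmx x))) = cj (T x)) ->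
  exists (X : 'rV[C]_(1 + 2) -> 'rV[C]_2) (F : 'rV[C]_(1 + 1 + 2) -> 'rV[C]_2),
  [/\ holv X /\ bigOv 2 X, holv F,
    near0 (fun x : 'rV[C]_(1 + 1 + 2 + 2) =>
      let z := lsubmx (lsubmx (lsubmx x)) in let ze := rsubmx (lsubmx (lsubmx x)) in
      let u := rsubmx (lsubmx x) in let v := rsubmx x in
      defS T (chart X (row_mx z (u + 'i%C *: v))) (starv (chart X) (row_mx ze (u - 'i%C *: v))) = 0
      <-> v = F (lsubmx x)),
    near0 (fun x : 'rV[C]_(1 + 2) => F (row_mx (row_mx (lsubmx x) 0) (rsubmx x)) = 0) &
    near0 (fun t : 'rV[C]_(1 + 1 + 2) =>
      F (row_mx (row_mx (cj (rsubmx (lsubmx t))) (cj (lsubmx (lsubmx t)))) (cj (rsubmx t))) = cj (F t))].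
Proof.
move=> hT T2 Tsym; have T0 := bigOv_at0 T2.
have i2 : 'i%C * 'i%C = -1 :> C := i_sqr.
have Sconj := defS_conj Tsym.
(* the totally real surface of points of M with z = 0 *)
pose g1 (x : 'rV[C]_(2 + 2)) := 'i%C *: T (row_mx (row_mx 0 (lsubmx x - rsubmx x)) (row_mx 0 (lsubmx x + rsubmx x))).
have hg1 : holv g1 by rewrite /g1; holt; rewrite !zero_simp.
have g10 : g1 0 = 0 by rewrite /g1 !zero_simp T0 scaler0.
have g12 : bigOv 2 (fun y => g1 (row_mx 0 y)).
  rewrite /g1; apply: bigOvZ; apply: bigOv_ext (@bigOv_comp _ _ _ _ T (fun y => row_mx (row_mx 0 (- y)) (row_mx 0 y)) T2 _ _).
  - by apply: near0W => y; rewrite row_mxKl row_mxKr sub0r add0r.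
  - by holt.
  - by rewrite !zero_simp.
have [Y [hY Y0 YE]] := implicit_function hg1 g10 g12.
have SY : near0 (fun x : 'rV[C]_(2 + 2) =>
    defS T (row_mx 0 (lsubmx x - rsubmx x)) (row_mx 0 (lsubmx x + rsubmx x)) = 0
    <-> rsubmx x = Y (lsubmx x)).
  apply: near0S YE => x <-; rewrite /defS /g1 !row_mxKr; set t := T _.
  set s := lsubmx x; set y := rsubmx x.
  have -> : c2 *: (s - y - (s + y)) = 'i%C *: y.
    by apply/rowP => j; rewrite !mxE c2E; field.
  split=> [/eqP|->].
    rewrite addr_eq0 => /eqP e.
    by rewrite -[LHS]opprK -scaleN1r -i2 -scalerA scalerN e opprK.
  by rewrite scalerA i2 scaleN1r addNr.
have Y2 : bigOv 2 Y.
  have h : bigOv 2 (fun s => g1 (row_mx s (Y s))).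
    rewrite /g1; apply: bigOvZ; apply: bigOv_ext (@bigOv_comp _ _ _ _ T
      (fun s => row_mx (row_mx 0 (s - Y s)) (row_mx 0 (s + Y s))) T2 _ _).
    - by apply: near0W => y; rewrite row_mxKl row_mxKr.
    - by holt.
    - by rewrite Y0 !zero_simp.
  have t : to0 (fun s => row_mx s (Y s)) by apply: holv_to0; [holt|rewrite Y0 row_mx0].
  apply: bigOv_ext h; apply: near0S (near0_comp t YE) => s.
  by rewrite row_mxKl row_mxKr => -[_ e]; rewrite -e.
have SYs : near0 (fun s => defS T (row_mx 0 (s - Y s)) (row_mx 0 (s + Y s)) = 0).
  have t : to0 (fun s => row_mx s (Y s)) by apply: holv_to0; [holt|rewrite Y0 row_mx0].
  by apply: near0S (near0_comp t SY) => s; rewrite row_mxKl row_mxKr => -[_]; exact.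
have Ycj : near0 (fun s => Y (cj s) = - cj (Y s)).
  have t1 : to0 (fun s : 'rV[C]_2 => row_mx (row_mx (0 : 'rV[C]_1) (s - Y s)) (row_mx (0 : 'rV[C]_1) (s + Y s))).
    by apply: holv_to0; [holt|rewrite Y0 !zero_simp].
  have t2 : to0 (fun s => row_mx s (- starv Y s)).
    apply: holv_to0; last by rewrite /starv cj0 Y0 !zero_simp.
    have hY' := holv_star hY; by holt.
  apply: near0S3 SYs (near0_comp t1 Sconj) (near0_cj (near0_comp t2 SY)) => s.
  rewrite !row_mxKl !row_mxKr !cj_row !cj0 /starv !cjK => -> e [h _].
  by apply/esym/h; rewrite opprK -cjN -!cjD e cj0.
(* Segre varieties of the points of that surface *)
pose g2 (x : 'rV[C]_(1 + 2 + 2)) := (- (2 * 'i%C)) *: T (row_mx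
  (row_mx (lsubmx (lsubmx x)) (rsubmx (lsubmx x) + Y (rsubmx (lsubmx x)) + rsubmx x))
  (row_mx 0 (rsubmx (lsubmx x) + Y (rsubmx (lsubmx x))))).
have hg2 : holv g2 by rewrite /g2; holt; rewrite ?Y0 !zero_simp ?Y0 ?zero_simp.
have g20 : g2 0 = 0 by rewrite /g2 !zero_simp Y0 !zero_simp T0 scaler0.
have g22 : bigOv 2 (fun y => g2 (row_mx 0 y)).
  rewrite /g2; apply: bigOvZ; apply: bigOv_ext (@bigOv_comp _ _ _ _ T (fun y => row_mx (row_mx 0 y) 0) T2 _ _).
  - by apply: near0W => y; rewrite row_mxKl row_mxKr !zero_simp Y0 !zero_simp.
  - by holt.
  - by rewrite !zero_simp.
have [Z [hZ Z0 ZE]] := implicit_function hg2 g20 g22.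
have SZ : near0 (fun x : 'rV[C]_(1 + 2 + 2) =>
    defS T (row_mx (lsubmx (lsubmx x)) (rsubmx (lsubmx x) + Y (rsubmx (lsubmx x)) + rsubmx x))
      (row_mx 0 (rsubmx (lsubmx x) + Y (rsubmx (lsubmx x)))) = 0
    <-> rsubmx x = Z (lsubmx x)).
  apply: near0S ZE => x <-; rewrite /defS /g2 !row_mxKr; set t := T _.
  rewrite [_ + rsubmx x]addrC addrK; set y := rsubmx x.
  split=> [/eqP|->].
    rewrite addr_eq0 => /eqP e.
    by rewrite scaleNr -scalerN -e scalerA mulrC c2K scale1r.
  by rewrite scalerA mulrN c2K scaleN1r addNr.
have Z2 : bigOv 2 Z.
  have h : bigOv 2 (fun x => g2 (row_mx x (Z x))).
    rewrite /g2; apply: bigOvZ; apply: bigOv_ext (@bigOv_comp _ _ _ _ T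
      (fun x => row_mx (row_mx (lsubmx x) (rsubmx x + Y (rsubmx x) + Z x)) (row_mx 0 (rsubmx x + Y (rsubmx x)))) T2 _ _).
    - by apply: near0W => y; rewrite row_mxKl row_mxKr.
    - by holt; rewrite !zero_simp.
    - by rewrite Z0 !zero_simp Y0 !zero_simp.
  have t : to0 (fun s => row_mx s (Z s)) by apply: holv_to0; [holt|rewrite Z0 row_mx0].
  apply: bigOv_ext h; apply: near0S (near0_comp t ZE) => s.
  by rewrite row_mxKl row_mxKr => -[_ e]; rewrite -e.
have Zs : near0 (fun s => Z (row_mx 0 s) = - (Y s + Y s)).
  have t : to0 (fun s : 'rV[C]_2 => row_mx (row_mx (0 : 'rV[C]_1) s) (- (Y s + Y s))).
    by apply: holv_to0; [holt|rewrite Y0 !zero_simp].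
  apply: near0S2 (near0_comp t SZ) SYs => s; rewrite !row_mxKl !row_mxKr => -[h _] e.
  by rewrite -h// opprD addrA addrK.
pose X (x : 'rV[C]_(1 + 2)) := Y (rsubmx x) + Z x.
have hX : holv X by rewrite /X; holt; rewrite rsub0.
have X2 : bigOv 2 X.
  rewrite /X; apply: bigOvD Z2.
  by apply: bigOv_comp Y2 _ _; [holt|rewrite rsub0].
have X0 : X 0 = 0 by rewrite /X rsub0 Y0 Z0 addr0.
have hX' := holv_star hX.
have [F [hF SF Fsym]] := graph_in_chart hT T2 Tsym hX X2.
exists X, F; split=> //.
have t1 : to0 (fun x : 'rV[C]_(1 + 2) => row_mx (row_mx (row_mx (lsubmx x) (0 : 'rV[C]_1)) (rsubmx x)) (0 : 'rV[C]_2)).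
  by apply: holv_to0; [holt|rewrite !zero_simp].
have t2 : to0 (fun x : 'rV[C]_(1 + 2) => row_mx x (Z x)).
  by apply: holv_to0; [holt|rewrite Z0 !zero_simp].
have t3 : to0 (fun x : 'rV[C]_(1 + 2) => rsubmx x) by apply: holv_to0; [holt|rewrite rsub0].
apply: near0S3 (near0_comp t1 SF) (near0_comp t2 SZ)
  (near0_comp t3 (filterI (near0_cj Zs) Ycj)) => x; rewrite !row_mxKl !row_mxKr => hS [_ /(_ erefl) hz] [zs ys].
apply/esym/hS; rewrite starv_chart /chart !(row_mxKl, row_mxKr) scaler0 subr0 addr0.
rewrite -[RHS]hz; congr (defS T (row_mx _ _) (row_mx _ _)).
  by rewrite /X !row_mxKr hsubmxK addrA.
congr (_ + _); rewrite /starv /X cj_row cj0 row_mxKr zs.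
by rewrite opprD addrA subrr add0r ys opprK cjK.
Qed.
End NormalCoordinates.

(** * Norms and differentials over a numeric field *)

Section MatrixNorms.
Variable K : numFieldType.

Lemma ler_mx_coord m n (x : 'M[K]_(m, n)) i j : `|x i j| <= `|x|.
Proof.
rewrite [leRHS]/Num.norm /= mx_normE -[leLHS]nngE num_le.
exact: (@le_bigmax _ _ _ _ (fun i => `|x i.1 i.2|%:nng) (i, j)).
Qed.

Lemma mx_norm_le m n (x : 'M[K]_(m, n)) b :
  0 <= b -> (forall i j, `|x i j| <= b) -> `|x| <= b.
Proof.
move=> /nonnegP[{}b] h; rewrite [leLHS]/Num.norm /= mx_normE num_le.
by apply/bigmax_leP; split=> [|[i j] _ /=]; rewrite -num_le//=.
Qed.

Lemma lim_seq_eq (u : nat -> K) (l : K) :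
  (forall e, 0 < e -> exists N, forall m, (N <= m)%N -> `|l - u m| <= e) ->
  lim (u @ \oo) = l.
Proof.
move=> h; apply: cvg_lim => //; apply/cvgrPdist_le => e e0.
by have [N hN] := h _ e0; exists N.
Qed.

Lemma mulmx_bound m n (A : 'M[K]_(m, n)) : exists2 c : K, 0 <= c &
  forall v : 'rV[K]_m, `|v *m A| <= c * `|v|.
Proof.
exists (\sum_i \sum_j `|A i j|) => [|v].
  by apply: sumr_ge0 => i _; apply: sumr_ge0.
have c0 : 0 <= \sum_i \sum_j `|A i j| by apply: sumr_ge0 => i _; apply: sumr_ge0.
apply: mx_norm_le => [|i j]; first by rewrite mulr_ge0.
rewrite mxE (le_trans (ler_norm_sum _ _ _))// mulr_suml ler_sum// => k _.
rewrite normrM mulrC ler_pM//; last by rewrite (ord1 i) ler_mx_coord.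
by rewrite (bigD1 j)//= lerDl sumr_ge0.
Qed.

Lemma linear_lipschitz_continuous (V W : normedModType K) (f : {linear V -> W}) c :
  0 <= c -> (forall v, `|f v| <= c * `|v|) -> continuous f.
Proof.
move=> c0 hc v; apply/cvgrPdist_le => e e0; apply/nbhs_normP.
have c1 : 0 < c + 1 by rewrite ltr_wpDl.
exists (e / (c + 1)); first by rewrite /= divr_gt0.
move=> w /= /ltW vw; rewrite -linearB (le_trans (hc _))//.
rewrite (le_trans (y := (c + 1) * `|v - w|))//; first by rewrite ler_wpM2r// lerDl.
by rewrite mulrC -ler_pdivlMr.
Qed.

(** A quadratic remainder is a little-o of the increment. *)
Lemma quadratic_differentiable (V W : normedModType K) (f : V -> W) p (df : {linear V -> W}) b c d :
  0 <= b -> (forall v, `|df v| <= b * `|v|) -> 0 < d -> 0 <= c ->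
  (forall v, `|v| < d -> `|f (p + v) - f p - df v| <= c * `|v| ^+ 2) ->
  differentiable f p /\ 'd f p = df :> (V -> W).
Proof.
move=> b0 hb d0 c0 h.
have ctn : continuous df by exact: linear_lipschitz_continuous hb.
have o1 : f \o shift p = cst (f p) + df +o_ 0 id.
  apply/eqaddoP => e e0; apply/nbhs_normP.
  have c1 : 0 < c + 1 by rewrite ltr_wpDl.
  have [m' m'0 [md me]] : exists2 m' : K, 0 < m' & m' <= d /\ m' <= e / (c + 1).
    have ec : 0 < e / (c + 1) by rewrite divr_gt0.
    have /orP[le1|le1] := real_leVge (gtr0_real d0) (gtr0_real ec).
      by exists d.
    by exists (e / (c + 1)).
  exists m' => //= v /=; rewrite sub0r normrN => vm.
  rewrite !fctE /= opprD addrA [v + p]addrC.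
  rewrite (le_trans (h _ (lt_le_trans vm md)))// expr2 mulrA ler_wpM2r//.
  rewrite (le_trans (y := (c + 1) * `|v|))//; first by rewrite ler_wpM2r// lerDl.
  by rewrite mulrC -ler_pdivlMr// (le_trans (ltW vm)).
have dE := diff_unique ctn o1; split=> //.
by apply/diff_locallyP; rewrite dE; split.
Qed.

Lemma quadratic_differentiable_mx m n (f : 'rV[K]_m -> 'rV[K]_n) p (A : 'M[K]_(m, n)) c d :
  0 < d -> 0 <= c ->
  (forall v, `|v| < d -> `|f (p + v) - f p - v *m A| <= c * `|v| ^+ 2) ->
  differentiable f p /\ 'J f p = A.
Proof.
move=> d0 c0 h; have [b b0 hb] := mulmx_bound A.
have [df dE] := @quadratic_differentiable 'rV[K]_m 'rV[K]_n f p (mulmxr A) b c d b0 hb d0 c0 h.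
by split=> //; apply/row_matrixP => i; rewrite !rowE mul_rV_lin1 dE.
Qed.

Lemma quadratic_is_derive (V W : normedModType K) (f : V -> W) (a v : V) (w : W) c d :
  0 < d -> 0 <= c ->
  (forall h : K, `|h| < d -> `|f (a + h *: v) - f a - h *: w| <= c * `|h| ^+ 2) ->
  is_derive a v f w.
Proof.
move=> d0 c0 hf.
have hc : (fun h => h^-1 *: ((f \o shift a) (h *: v) - f a)) @ 0^' --> w.
  apply/cvgrPdist_le => e e0; rewrite near_withinE; apply/nbhs_normP.
  have c1 : 0 < c + 1 by rewrite ltr_wpDl.
  have [m' m'0 [md me]] : exists2 m' : K, 0 < m' & m' <= d /\ m' <= e / (c + 1).
    have ec : 0 < e / (c + 1) by rewrite divr_gt0.
    have /orP[le1|le1] := real_leVge (gtr0_real d0) (gtr0_real ec).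
      by exists d.
    by exists (e / (c + 1)).
  exists m' => //= h /=; rewrite sub0r normrN => hm h0.
  have -> : w - h^-1 *: (f (h *: v + a) - f a) = - (h^-1 *: (f (a + h *: v) - f a - h *: w)).
    by rewrite [a + _]addrC [in RHS]scalerBr scalerA mulVf// scale1r opprB.
  rewrite normrN normrZ normfV ler_pdivrMl ?normr_gt0//.
  rewrite (le_trans (hf _ (lt_le_trans hm md)))// expr2 mulrCA ler_wpM2l//.
  rewrite (le_trans (y := (c + 1) * `|h|))//; first by rewrite ler_wpM2r// lerDl.
  by rewrite mulrC -ler_pdivlMr// (le_trans (ltW hm)).
by apply: DeriveDef; [apply/cvg_ex; exists w|exact: cvg_lim hc].
Qed.

End MatrixNorms.

(** * Evaluation of power series; real analytic functions *)

Section Boxes.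
Variable n : nat.

Definition ffun_val m (al : {ffun 'I_n -> 'I_m}) : {ffun 'I_n -> nat} :=
  [ffun i => nat_of_ord (al i)].

(** The multi-indices over which the partial sums of the statement range. *)
Definition box m : {fset {ffun 'I_n -> nat}} :=
  [fset x in map (@ffun_val m) (index_enum {ffun 'I_n -> 'I_m})]%fset.

Lemma ffun_val_inj m : injective (@ffun_val m).
Proof.
move=> al be /ffunP e; apply/ffunP => i; apply/val_inj.
by have := e i; rewrite !ffunE.
Qed.

Lemma mem_box m (be : {ffun 'I_n -> nat}) : (be \in box m) = [forall i, (be i < m)%N].
Proof.
rewrite !inE; apply/mapP/forallP => [[al _ ->] i|h]; first by rewrite ffunE.
exists [ffun i => Ordinal (h i)]; first exact: mem_index_enum.
by apply/ffunP => i; rewrite !ffunE.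
Qed.

Lemma psum_box (K : numFieldType) (a : mpseries n K) (x : 'rV[K]_n) m :
  psum a x m = \sum_(be <- box m) a be * \prod_(i < n) x ord0 i ^+ be i.
Proof.
rewrite (perm_big (map (@ffun_val m) (index_enum {ffun 'I_n -> 'I_m}))) /=.
  rewrite big_map; apply: eq_bigr => al _; congr (_ * _).
  by apply: eq_bigr => i _; rewrite ffunE.
apply: uniq_perm => [||be]; rewrite ?fset_uniq//; last by rewrite !inE.
by rewrite map_inj_uniq ?index_enum_uniq//; exact: ffun_val_inj.
Qed.

Lemma box_cofinal (J : {fset {ffun 'I_n -> nat}}) :
  exists N, forall m, (N <= m)%N -> (J `<=` box m)%fset.
Proof.
exists (\max_(be <- J) \max_i (be i).+1) => m Nm.
apply/fsubsetP => be bJ; rewrite mem_box; apply/forallP => i.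
rewrite (leq_trans _ Nm)// (leq_trans (@leq_bigmax _ (fun i => (be i).+1) i))//.
exact: (@leq_bigmax_seq _ (enum_fset J) xpredT (fun be => \max_i (be i).+1) be).
Qed.
End Boxes.

Section Evaluation.
Variable R : realType.
Local Notation C := R[i].

Definition rc m n (x : 'M[R]_(m, n)) : 'M[C]_(m, n) := map_mx (real_complex R) x.

Lemma rcE m n (x : 'M[R]_(m, n)) i j : rc x i j = (x i j)%:C.
Proof. by rewrite mxE. Qed.

Lemma rcD m n (x y : 'M[R]_(m, n)) : rc (x + y) = rc x + rc y.
Proof. exact: map_mxD. Qed.

Lemma rcB m n (x y : 'M[R]_(m, n)) : rc (x - y) = rc x - rc y.
Proof. exact: map_mxB. Qed.

Lemma rc0 m n : rc (0 : 'M[R]_(m, n)) = 0.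
Proof. exact: map_mx0. Qed.

Lemma rcM m n p (x : 'M[R]_(m, n)) (y : 'M[R]_(n, p)) : rc (x *m y) = rc x *m rc y.
Proof. exact: map_mxM. Qed.

Lemma cj_rc m n (x : 'M[R]_(m, n)) : cj (rc x) = rc x.
Proof. by apply/matrixP => i j; rewrite !mxE conjc_real. Qed.

Lemma mon_rc n (x : 'rV[R]_n) al : mon (rc x) al = (\prod_(i < n) x ord0 i ^+ al i)%:C.
Proof.
by rewrite rmorph_prod; apply: eq_bigr => i _; rewrite rcE rmorphXn.
Qed.

Lemma wt_box n (a : {ffun 'I_n -> nat} -> R) (r : R) m :
  psum a (const_mx r) m = \sum_(be <- box n m) a be * wt r be.
Proof.
rewrite psum_box; apply: eq_bigr => be _; congr (_ * _).
by apply: eq_bigr => i _; rewrite mxE.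
Qed.

Lemma bnd_box n (b : {ffun 'I_n -> nat} -> R) B :
  (forall al, 0 <= b al) -> (forall m, \sum_(be <- box n m) b be <= B) -> bnd b B.
Proof.
move=> b0 h J; have [N hN] := box_cofinal J; rewrite (le_trans _ (h N))//.
move: (box n N) (hN N (leqnn N)) => I sub.
rewrite [leRHS](big_fsetID _ (mem J)) /=.
have -> : [fset x in I | x \in J]%fset = J.
  apply/fsetP => k; rewrite !inE; case: (boolP (k \in J)) => kJ; rewrite ?andbF//.
  by rewrite (fsubsetP sub _ kJ).
by rewrite lerDl sumr_ge0.
Qed.

Lemma psum_hsum n (a : mpseries n C) (x : 'rV[C]_n) l :
  hsum (fun al => a al * mon x al) l ->
  forall e : R, 0 < e -> exists N, forall m, (N <= m)%N -> nrm (l - psum a x m) <= e.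
Proof.
move=> h e e0; have [J0 hJ] := h _ e0; have [N hN] := box_cofinal J0.
by exists N => m /hN /hJ; rewrite psum_box.
Qed.

Lemma mpeval_hsum n (a : mpseries n C) (x : 'rV[C]_n) l :
  hsum (fun al => a al * mon x al) l -> mpeval a x = l.
Proof.
move=> h; apply: lim_seq_eq => e e0.
have eE : e = (complex.Re e)%:C by rewrite RRe_real// gtr0_real.
rewrite eE ltcR in e0; have [N hN] := psum_hsum h e0.
by exists N => m /hN; rewrite eE nrmE lecR.
Qed.

Lemma ReD (x y : C) : complex.Re (x + y) = complex.Re x + complex.Re y.
Proof. by case: x; case: y. Qed.

Lemma ReN (x : C) : complex.Re (- x) = - complex.Re x.
Proof. by case: x. Qed.

Lemma ImD (x y : C) : complex.Im (x + y) = complex.Im x + complex.Im y.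
Proof. by case: x; case: y. Qed.

Lemma ImN (x : C) : complex.Im (- x) = - complex.Im x.
Proof. by case: x. Qed.

Lemma Re_sum (I : Type) (s : seq I) (f : I -> C) :
  complex.Re (\sum_(i <- s) f i) = \sum_(i <- s) complex.Re (f i).
Proof. exact: (big_morph _ ReD). Qed.

Lemma Im_sum (I : Type) (s : seq I) (f : I -> C) :
  complex.Im (\sum_(i <- s) f i) = \sum_(i <- s) complex.Im (f i).
Proof. exact: (big_morph _ ImD). Qed.

Lemma ReMr (x : C) (r : R) : complex.Re (x * r%:C) = complex.Re x * r.
Proof. by case: x => a b /=; rewrite mulr0 subr0. Qed.

Lemma ReMl (x : C) (r : R) : complex.Re (r%:C * x) = r * complex.Re x.
Proof. by rewrite mulrC ReMr mulrC. Qed.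

Lemma ImMr (x : C) (r : R) : complex.Im (x * r%:C) = complex.Im x * r.
Proof. by case: x => a b /=; rewrite mulr0 add0r. Qed.

Lemma ImMl (x : C) (r : R) : complex.Im (r%:C * x) = r * complex.Im x.
Proof. by rewrite mulrC ImMr mulrC. Qed.

Lemma mpeval_Re n (a : mpseries n C) (x : 'rV[R]_n) l :
  hsum (fun al => a al * mon (rc x) al) l ->
  mpeval (fun al => complex.Re (a al)) x = complex.Re l.
Proof.
move=> h; apply: lim_seq_eq => e e0.
have [N hN] := psum_hsum h e0; exists N => m /hN; apply: le_trans.
suff -> : complex.Re l - psum (fun al => complex.Re (a al)) x m
   = complex.Re (l - psum a (rc x) m) by exact: nrm_Re.
rewrite !psum_box ReD ReN Re_sum; congr (_ - _); apply: eq_bigr => al _.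
by have := mon_rc x al; rewrite /mon => ->; rewrite ReMr.
Qed.

Lemma mpconverges_C n (a : mpseries n C) r B :
  bnd (fun al => nrm (a al) * wt r al) B -> mpconverges r%:C a.
Proof.
move=> h; exists B%:C => m; rewrite psum_box.
have -> : \sum_(be <- box n m) `|a be| * \prod_(i < n) (const_mx r%:C : 'rV[C]_n) ord0 i ^+ be i
  = (\sum_(be <- box n m) nrm (a be) * wt r be)%:C.
  rewrite rmorph_sum; apply: eq_bigr => be _; rewrite rmorphM; congr (_ * _).
  by rewrite rmorph_prod; apply: eq_bigr => i _; rewrite mxE rmorphXn.
by rewrite lecR; exact: h.
Qed.

Lemma mpconverges_Re n (a : mpseries n C) r B : 0 <= r ->
  bnd (fun al => nrm (a al) * wt r al) B -> mpconverges r (fun al => complex.Re (a al)).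
Proof.
move=> r0 h; exists B => m; rewrite wt_box (le_trans _ (h (box n m)))//.
by apply: ler_sum => al _; rewrite ler_wpM2r ?wt_ge0// nrm_Re.
Qed.

Lemma mpconverges_bnd n (a : mpseries n R) r : 0 <= r -> mpconverges r a ->
  exists B, bnd (fun al => nrm (a al)%:C * wt r al) B.
Proof.
move=> r0 [B hB]; exists B; apply: bnd_box => [al|m].
  by rewrite mulr_ge0 ?nrm_ge0 ?wt_ge0.
have := hB m; rewrite wt_box; apply: le_trans.
by apply: ler_sum => al _; rewrite nrm_real.
Qed.

Lemma inD_rc n r (x : 'rV[R]_n) : `|x| <= r -> inD r (rc x).
Proof. by move=> xr i; rewrite rcE nrm_real (le_trans (ler_mx_coord _ _ _)). Qed.

(** The Taylor series at the origin, summed at complex points. *)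
Lemma analytic_complexify n (f : 'rV[R]_n -> R) : analytic_at f 0 ->
  exists g : 'rV[C]_n -> C, [/\ hol g, near0 (fun x => star g x = g x) &
    exists2 r, 0 < r & forall x : 'rV[R]_n, `|x| < r -> g (rc x) = (f x)%:C].
Proof.
move=> [r [a [r0 ha hf]]]; have [B hB] := mpconverges_bnd (ltW r0) ha.
have ex x : exists l, inD r x -> hsum (fun al => (a al)%:C * mon x al) l.
  have [xr|nx] := pselect (inD r x); last by exists 0.
  have [|l hl] := @hsum_ex _ _ (fun al => (a al)%:C * mon x al) B; last by exists l.
  apply: bnd_le hB => al; rewrite nrmM ler_wpM2l ?nrm_ge0//; exact: nrm_mon.
have [g hg] := choice ex.
have gstar x : inD r x -> star g x = g x.
  move=> xr; apply: (hsum_uniq _ (hg _ xr)).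
  apply: eq_hsum (hsum_conj (hg _ (inD_cj xr))) => al.
  rewrite rmorphM rmorph_prod /= oppr0; congr (_ * _).
  by apply: eq_bigr => i _; rewrite cjE rmorphXn /= conjcK.
exists g; split.
- by exists r, B; split=> //; exists (fun al => (a al)%:C).
- by exists r.
- exists r => // x xr; have xD := inD_rc (ltW xr).
  have := gstar _ xD; rewrite /star cj_rc => gr.
  have gRe : g (rc x) = (complex.Re (g (rc x)))%:C.
    move: gr; case: (g (rc x)) => u v /= [h]; congr Complex.
    by apply/eqP; rewrite -[_ == _](mulrn_eq0 v 2) mulr2n -[X in X + _]h addNr.
  rewrite gRe; congr (_%:C); rewrite hf ?subr0//.
  by have := mpeval_Re (hg _ xD).
Qed.

(** The series recentred at [p], whose coefficients are replaced by their real parts. *)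
Lemma hol_analytic n (g : 'rV[C]_n -> C) : hol g ->
  exists2 r, 0 < r & forall p : 'rV[R]_n, `|p| <= r ->
    analytic_at (fun x => complex.Re (g (rc x))) p.
Proof.
move=> [r [B [r0 hf]]]; have r2 : 0 < r / 2 by rewrite divr_gt0.
exists (r / 2) => // p pr.
have [a [ha hg]] : rep (r / 2) (fun v => g (rc p + v)) B.
  apply: rep_comp hf _ => // j.
  apply: (@rep_leB _ _ _ _ (nrm (rc p ord0 j) + r / 2)).
    by have := inD_rc pr j; lra.
  apply: rep_ext (rep_add (rep_const _ _ (rc p ord0 j)) (rep_coord j (ltW r2)) (ltW r2)) => x _.
  by rewrite [RHS]mxE.
exists (r / 2), (fun al => complex.Re (a al)); split=> //.
  exact: mpconverges_Re (ltW r2) ha.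
move=> x xp; have := hg _ (inD_rc (ltW xp)).
have -> : rc p + rc (x - p) = rc x by rewrite -rcD addrC subrK.
by move=> /mpeval_Re ->.
Qed.
End Evaluation.

(** * Real derivatives and brackets *)

(** Differentiability over an abstract field [K]; it is used for [K = R[i]]. *)
Definition differentiable_rV (K : numFieldType) n m (F : 'rV[K]_n -> 'rV[K]_m) (p : 'rV[K]_n) :=
  differentiable F p.

Section RealDerivatives.
Variable R : realType.
Local Notation C := R[i].

Definition ReM m n (A : 'M[C]_(m, n)) : 'M[R]_(m, n) := map_mx (@complex.Re R) A.
Definition ImM m n (A : 'M[C]_(m, n)) : 'M[R]_(m, n) := map_mx (@complex.Im R) A.

Lemma ReM_rc m n (A : 'M[R]_(m, n)) : ReM (rc A) = A.
Proof. by apply/matrixP => i j; rewrite !mxE. Qed.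

Lemma ReMB m n (A B : 'M[C]_(m, n)) : ReM (A - B) = ReM A - ReM B.
Proof. by apply/matrixP => i j; rewrite !mxE ReD ReN. Qed.

Lemma ImMB m n (A B : 'M[C]_(m, n)) : ImM (A - B) = ImM A - ImM B.
Proof. by apply/matrixP => i j; rewrite !mxE ImD ImN. Qed.

Lemma ReM_rcM m n p (v : 'M[R]_(m, n)) (A : 'M[C]_(n, p)) : ReM (rc v *m A) = v *m ReM A.
Proof.
apply/matrixP => i j; rewrite !mxE Re_sum; apply: eq_bigr => k _.
by rewrite !mxE ReMl.
Qed.

Lemma ImM_rcM m n p (v : 'M[R]_(m, n)) (A : 'M[C]_(n, p)) : ImM (rc v *m A) = v *m ImM A.
Proof.
apply/matrixP => i j; rewrite !mxE Im_sum; apply: eq_bigr => k _.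
by rewrite !mxE ImMl.
Qed.

Lemma hasD_bound n m (F : 'rV[C]_n -> 'rV[C]_m) p A : hasD F p A ->
  exists K r : R, [/\ 0 < K, 0 < r & forall rho v, 0 <= rho -> rho <= r -> inD rho v ->
    inD (K * rho ^+ 2) (F (p + v) - F p - v *m A)].
Proof.
move=> h; apply: bigOvP => j; apply: bigO_ext (h j); apply: near0W => v.
by rewrite mulmx_colE !mxE.
Qed.

Lemma norm_real_of n (v : 'rV[C]_n) :
  exists2 rho : R, 0 <= rho & @Num.norm C 'rV[C]_n v = rho%:C /\ inD rho v.
Proof.
have v0 : 0 <= `|v| by [].
exists (complex.Re `|v|); first by rewrite -ler0c RRe_real// ger0_real.
have e : `|v| = (complex.Re `|v|)%:C by rewrite RRe_real// ger0_real.
by split=> // i; rewrite -lecR -e -nrmE; exact: ler_mx_coord.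
Qed.

Lemma hasD_differentiable n m (F : 'rV[C]_n -> 'rV[C]_m) p A :
  hasD F p A -> differentiable_rV F p.
Proof.
move=> /hasD_bound[K [r [K0 r0 h]]].
have [| |v vr|//] := @quadratic_differentiable_mx C n m F p A K%:C r%:C.
- by rewrite ltcR.
- by rewrite ler0c ltW.
have [rho rho0 [vE vD]] := norm_real_of v.
rewrite vE ltcR in vr; rewrite vE -rmorphXn -rmorphM.
apply: mx_norm_le => [|i j]; first by rewrite ler0c mulr_ge0 ?exprn_ge0// ltW.
by rewrite (ord1 i) nrmE lecR; exact: h (ltW vr) vD j.
Qed.

Lemma near0_real n (P : 'rV[C]_n -> Prop) : near0 P -> \forall x \near (0 : 'rV[R]_n), P (rc x).
Proof.
move=> [r [r0 h]]; apply/nbhs_normP; exists r => // x /=.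
by rewrite sub0r normrN => xr; apply: h; exact: inD_rc (ltW xr).
Qed.

Section Parts.
Variables (n m : nat) (F : 'rV[C]_n -> 'rV[C]_m) (f : 'rV[R]_n -> 'rV[R]_m).
Variables (p : 'rV[R]_n) (A : 'M[C]_(n, m)).
Hypothesis FA : hasD F (rc p) A.

Lemma diff_part (part : forall k l, 'M[C]_(k, l) -> 'M[R]_(k, l)) :
  (forall k l (B D : 'M[C]_(k, l)), part _ _ (B - D) = part _ _ B - part _ _ D) ->
  (forall (v : 'rV[R]_n) (B : 'M[C]_(n, m)), part _ _ (rc v *m B) = v *m part _ _ B) ->
  (forall (B : 'rV[C]_m) j, `|part _ _ B ord0 j| <= nrm (B ord0 j)) ->
  (\forall x \near p, f x = part _ _ (F (rc x))) ->
  differentiable f p /\ 'J f p = part _ _ A.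
Proof.
move=> pB pM pN /nbhs_normP[d d0 fF]; have [K [r [K0 r0 h]]] := hasD_bound FA.
apply: (@quadratic_differentiable_mx _ _ _ _ _ _ K (Num.min d r)) => [||v].
- by rewrite lt_min d0.
- exact: ltW.
rewrite lt_min => /andP[vd vr].
rewrite !fF/=; last 2 first.
- by rewrite subrr normr0.
- by rewrite opprD addrA subrr sub0r normrN.
rewrite rcD -pB -pM -pB.
apply: mx_norm_le => [|i j]; first by rewrite mulr_ge0 ?exprn_ge0// ltW.
rewrite (ord1 i) (le_trans (pN _ _))//.
exact: h (ltW vr) (inD_rc (lexx _)) j.
Qed.

Lemma diff_Re : (\forall x \near p, f x = ReM (F (rc x))) ->
  differentiable f p /\ 'J f p = ReM A.
Proof.
apply: (diff_part (part := ReM)) => [k l|v B|B j]; first exact: ReMB.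
  exact: ReM_rcM.
by rewrite mxE nrm_Re.
Qed.

Lemma diff_Im : (\forall x \near p, f x = ImM (F (rc x))) ->
  differentiable f p /\ 'J f p = ImM A.
Proof.
apply: (diff_part (part := ImM)) => [k l|v B|B j]; first exact: ImMB.
  exact: ImM_rcM.
by rewrite mxE nrm_Im.
Qed.
End Parts.

(** The bracket of holomorphic vector fields; on real points it is the bracket of the
    complexified fields. *)
Definition br n (X Y : 'rV[C]_n -> 'rV[C]_n) (p : 'rV[C]_n) : 'rV[C]_n :=
  X p *m Dm Y p - Y p *m Dm X p.

(** Real and imaginary parts of a holomorphic field have as real differentials the real and
    imaginary parts of its complex differential. *)
Lemma clie_br n (X Y : 'rV[R]_n -> 'rV[C]_n) (X' Y' : 'rV[C]_n -> 'rV[C]_n) p :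
  (\forall x \near p, X x = X' (rc x)) -> (\forall x \near p, Y x = Y' (rc x)) ->
  hasD X' (rc p) (Dm X' (rc p)) -> hasD Y' (rc p) (Dm Y' (rc p)) ->
  clie X Y p = br X' Y' (rc p).
Proof.
move=> XX YY dX dY.
have hRe (Z : 'rV[R]_n -> 'rV[C]_n) Z' : (\forall x \near p, Z x = Z' (rc x)) ->
    \forall x \near p, field_re Z x = ReM (Z' (rc x)).
  by apply: filterS => x; rewrite /field_re => ->.
have hIm (Z : 'rV[R]_n -> 'rV[C]_n) Z' : (\forall x \near p, Z x = Z' (rc x)) ->
    \forall x \near p, field_im Z x = ImM (Z' (rc x)).
  by apply: filterS => x; rewrite /field_im => ->.
have [dXr JXr] := diff_Re dX (hRe _ _ XX).
have [dXi JXi] := diff_Im dX (hIm _ _ XX).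
have [dYr JYr] := diff_Re dY (hRe _ _ YY).
have [dYi JYi] := diff_Im dY (hIm _ _ YY).
have Xp := nbhs_singleton XX; have Yp := nbhs_singleton YY.
rewrite /clie /lie !deriveEjacobian// JXr JXi JYr JYi /br -Xp -Yp.
have mulE (v : 'rV[C]_n) (A : 'M[C]_n) k :
    (v *m A) ord0 k = Complex ((ReM v *m ReM A) ord0 k - (ImM v *m ImM A) ord0 k)
                      ((ReM v *m ImM A) ord0 k + (ImM v *m ReM A) ord0 k).
  apply/eqP; rewrite eq_complex /=; apply/andP; split; apply/eqP.
    rewrite !mxE Re_sum -sumrB; apply: eq_bigr => i _.
    by rewrite !mxE; case: (v ord0 i) (A i k) => [? ?] [? ?].
  rewrite !mxE Im_sum -big_split; apply: eq_bigr => i _.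
  by rewrite !mxE; case: (v ord0 i) (A i k) => [? ?] [? ?] /=; rewrite addrC.
apply/rowP => k; rewrite [in RHS]mxE [in X in _ = _ + X]mxE !mulE.
rewrite [LHS]mxE /field_re /field_im -!/(ReM _) -!/(ImM _).
move: (ReM (X p) *m ReM _) (ImM (X p) *m ImM _) (ReM (Y p) *m ReM _) (ImM (Y p) *m ImM _).
move: (ReM (X p) *m ImM _) (ImM (X p) *m ReM _) (ReM (Y p) *m ImM _) (ImM (Y p) *m ReM _).
move=> a1 a2 a3 a4 a5 a6 a7 a8; apply/eqP; rewrite eq_complex /=.
by apply/andP; split; apply/eqP; rewrite !mxE; ring.
Qed.

Lemma tangent_kernel n m (F : 'rV[C]_n -> 'rV[C]_m) (A : 'M[C]_(n, m)) (g : R -> 'rV[R]_n) v :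
  hasD F (rc (g 0)) A -> is_derive (0 : R) (1 : R) g v ->
  (\forall t \near (0 : R), F (rc (g t)) = 0) -> rc v *m A = 0.
Proof.
move=> FA dg F0.
have [|fr Jr] := diff_Re (f := fun x => ReM (F (rc x))) FA; first by apply: filterE.
have [|fi Ji] := diff_Im (f := fun x => ImM (F (rc x))) FA; first by apply: filterE.
have gd : differentiable g 0 by apply/derivable1_diffP; case: dg.
have gv : 'd g 0 1 = v by rewrite -deriveE//; exact: derive_val.
have key (f : 'rV[R]_n -> 'rV[R]_m) : differentiable f (g 0) ->
    (\forall t \near (0 : R), f (g t) = 0) -> v *m 'J f (g 0) = 0.
  move=> df /nbhs_normP[d d0 f0].
  have fg t : `|t| < d -> f (g t) = 0 by move=> td; apply: f0; rewrite /= sub0r normrN.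
  have -> : v *m 'J f (g 0) = 'D_1 (f \o g) 0.
    rewrite deriveE; last exact: differentiable_comp.
    by rewrite diff_comp//= gv /jacobian mul_rV_lin1.
  have h : is_derive (0 : R) (1 : R) (f \o g) 0.
    apply: (@quadratic_is_derive _ _ _ _ _ _ _ 0 d) => // h hd.
    by rewrite add0r [h *: _]mulr1 /= !fg ?normr0// subrr scaler0 subr0 normr0 mul0r.
  exact: derive_val.
have er : v *m ReM A = 0.
  rewrite -Jr; apply: key => //; apply: filterS F0 => t ->.
  by apply/matrixP => i j; rewrite !mxE.
have ei : v *m ImM A = 0.
  rewrite -Ji; apply: key => //; apply: filterS F0 => t ->.
  by apply/matrixP => i j; rewrite !mxE.
apply/rowP => j; apply/eqP; rewrite eq_complex; apply/andP; split; apply/eqP.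
  by have /rowP/(_ j) := er; rewrite -ReM_rcM !mxE.
by have /rowP/(_ j) := ei; rewrite -ImM_rcM !mxE.
Qed.

Lemma curve_derive n (g : 'rV[C]_1 -> 'rV[C]_n) (A : 'M[C]_(1, n)) :
  hasD g 0 A ->
  is_derive (0 : R) (1 : R) (fun t : R => ReM (g (rc t%:M))) (ReM (row ord0 A)).
Proof.
move=> /hasD_bound[K [r [K0 r0 h]]].
apply: (@quadratic_is_derive _ _ _ _ _ _ _ K r) => //; first exact: ltW.
move=> t tr; rewrite add0r [t *: _]mulr1.
have -> : rc (0 : R)%:M = 0 :> 'rV[C]_1 by apply/rowP => j; rewrite !mxE mul0rn.
have tD : inD `|t| (rc t%:M : 'rV[C]_1).
  by move=> i; rewrite rcE mxE !ord1 eqxx mulr1n nrm_real.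
have := h _ _ (normr_ge0 t) (ltW tr) tD; rewrite add0r => hD.
apply: mx_norm_le => [|i j]; first by rewrite mulr_ge0 ?exprn_ge0// ltW.
rewrite (ord1 i) (le_trans _ (hD j))//.
have -> : (ReM (g (rc t%:M)) - ReM (g 0) - t *: ReM (row ord0 A)) ord0 j =
   complex.Re ((g (rc t%:M) - g 0 - rc t%:M *m A) ord0 j).
  rewrite !mxE !(ReD, ReN) big_ord1 !mxE eqxx mulr1n ReMl.
  by rewrite (_ : ord0 = 0).
exact: nrm_Re.
Qed.
End RealDerivatives.

(** * Push-forward of vector fields *)

Section VectorFields.
Variable R : realType.
Local Notation C := R[i].

Lemma hasDZ n m (F : 'rV[C]_n -> 'rV[C]_m) p A c :
  hasD F p A -> hasD (fun x => c *: F x) p (c *: A).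
Proof.
move=> h j; have := hasderZ c (h j); rewrite -linearZ /=.
by apply: eq_hasder => x; rewrite mxE.
Qed.

Lemma hasDB n m (F G : 'rV[C]_n -> 'rV[C]_m) p A B :
  hasD F p A -> hasD G p B -> hasD (fun x => F x - G x) p (A - B).
Proof.
move=> hF /(hasDZ (-1)) hG; have := hasDD hF hG; rewrite scaleN1r.
by apply: hasD_ext; apply: near0W => v; rewrite scaleN1r.
Qed.

Lemma eq_hasD n m (F G : 'rV[C]_n -> 'rV[C]_m) p A : F =1 G -> hasD F p A -> hasD G p A.
Proof. by move=> /funext ->. Qed.

Lemma hasD_const n m (c : 'rV[C]_m) (p : 'rV[C]_n) : hasD (fun=> c) p 0.
Proof.
move=> j; have -> : col j (0 : 'M[C]_(n, m)) = 0 by apply/colP => i; rewrite !mxE.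
exact: hasder_const.
Qed.

Lemma near0_Dm n m (F G : 'rV[C]_n -> 'rV[C]_m) : holv F ->
  near0 (fun x => F x = G x) -> near0 (fun x => Dm G x = Dm F x).
Proof.
move=> hF FG; apply: near0S2 (holv_hasD hF) (near0_shift FG) => x hx e.
exact/DmE/(hasD_ext e).
Qed.

(** Projections onto the two factors of a product, as matrices acting on the right. *)
Definition pl n1 n2 : 'M[C]_(n1 + n2, n1) := col_mx 1%:M 0.
Definition pr n1 n2 : 'M[C]_(n1 + n2, n2) := col_mx 0 1%:M.

Lemma mul_pl m n1 n2 (X : 'M[C]_(m, n1 + n2)) : X *m pl n1 n2 = lsubmx X.
Proof. by rewrite -{1}[X]hsubmxK mul_row_col mulmx1 mulmx0 addr0. Qed.

Lemma mul_pr m n1 n2 (X : 'M[C]_(m, n1 + n2)) : X *m pr n1 n2 = rsubmx X.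
Proof. by rewrite -{1}[X]hsubmxK mul_row_col mulmx1 mulmx0 add0r. Qed.

Lemma hasD_lsub n m1 m2 (F : 'rV[C]_n -> 'rV[C]_(m1 + m2)) p A :
  hasD F p A -> hasD (fun x => lsubmx (F x)) p (lsubmx A).
Proof.
move=> h; rewrite -mul_pl; apply: eq_hasD (hasD_comp h (hasD_lin (pl m1 m2) _)) => x.
by rewrite mul_pl.
Qed.

Lemma hasD_rsub n m1 m2 (F : 'rV[C]_n -> 'rV[C]_(m1 + m2)) p A :
  hasD F p A -> hasD (fun x => rsubmx (F x)) p (rsubmx A).
Proof.
move=> h; rewrite -mul_pr; apply: eq_hasD (hasD_comp h (hasD_lin (pr m1 m2) _)) => x.
by rewrite mul_pr.
Qed.

Lemma hasD_id n (p : 'rV[C]_n) : hasD (fun x => x) p 1%:M.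
Proof. by apply: eq_hasD (hasD_lin 1%:M p) => x; rewrite mulmx1. Qed.

(** Brackets are natural under holomorphic maps: the second derivatives of the map cancel
    by symmetry. *)
Lemma br_push n m (Th : 'rV[C]_n -> 'rV[C]_m) (X Y : 'rV[C]_m -> 'rV[C]_m)
    (x y : 'rV[C]_n -> 'rV[C]_n) :
  holv Th -> Th 0 = 0 -> holv X -> holv Y -> holv x -> holv y ->
  near0 (fun t => X (Th t) = x t *m Dm Th t) ->
  near0 (fun t => Y (Th t) = y t *m Dm Th t) ->
  near0 (fun t => br X Y (Th t) = br x y t *m Dm Th t).
Proof.
move=> hTh Th0 hX hY hx hy Xx Yy.
have half (Z : 'rV[C]_m -> 'rV[C]_m) (w z : 'rV[C]_n -> 'rV[C]_n) : holv Z -> holv z ->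
    near0 (fun t => Z (Th t) = z t *m Dm Th t) ->
    near0 (fun t => w t *m Dm Th t *m Dm Z (Th t) = w t *m Dm z t *m Dm Th t
      + \row_k \sum_i \sum_a w t ord0 i * z t ord0 a * der (fun s => Dm Th s a k) t i ord0).
  move=> hZ hz Zz.
  have hD : near0 (fun t => forall a k, hasder (fun s => Dm Th s a k) t (der (fun s => Dm Th s a k) t)).
    pose H t : 'rV[C]_(n * m) := mxvec (Dm Th t).
    have hH : holv H.
      move=> j; case: (mxvec_indexP j) => a k; apply: eq_hol (holv_Dm hTh a k) => t.
      by rewrite mxvecE.
    apply: near0S (holv_hasD hH) => t ht a k; have := ht (mxvec_index a k).
    by rewrite col_Dm; under eq_fun do rewrite mxvecE.
  have hZTh : holv (fun t => Z (Th t)) by holt.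
  have e1 := near0_Dm hZTh Zz.
  have e2 : near0 (fun t => Dm (fun t => Z (Th t)) t = Dm Th t *m Dm Z (Th t)).
    apply: near0S2 (holv_hasD hTh) (near0_comp (holv_to0 hTh Th0) (holv_hasD hZ)) => t h1 h2.
    exact/DmE/hasD_comp.
  apply: near0S3 (filterI e1 e2) hD (holv_hasD hz) => t [E1 E2] hDt hzt.
  rewrite -mulmxA -E2 -E1; apply/rowP => k; rewrite [LHS]mxE [in RHS]mxE -mulmxA.
  rewrite [(w t *m _) _ _]mxE [X in _ = _ + X]mxE -big_split /=; apply: eq_bigr => i _.
  have hk : hasder (fun s => (z s *m Dm Th s) ord0 k) t
     (\sum_a (Dm Th t a k *: col a (Dm z t) + z t ord0 a *: der (fun s => Dm Th s a k) t)).
    apply: eq_hasder (hasder_sum (index_enum _) (fun a => hasderM (hzt a) (hDt a k))) => s.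
    by rewrite mxE.
  rewrite [Dm _ _ _ _]mxE (derE hk) summxE mulr_sumr.
  rewrite [(Dm z t *m _) _ _]mxE mulr_sumr -big_split /=; apply: eq_bigr => a _.
  by rewrite !mxE; ring.
have sym : near0 (fun t => forall k i a, der (fun s => Dm Th s a k) t i ord0
     = der (fun s => Dm Th s i k) t a ord0).
  have [r hr] := choice (fun k => der_sym (hTh k)).
  exists (\big[Num.min/1]_k r k); split.
    by apply/bigmin_gtP; split=> // k _; have [] := hr k.
  move=> t tr k i a; have [_ h] := hr k.
  have E b : (fun s => Dm Th s b k) = (fun s => der (fun x => Th x ord0 k) s b ord0).
    by apply/funext => s; rewrite mxE.
  by rewrite !E; apply: h; apply: inD_le tr; exact: bigmin_le_cond.
apply: near0S3 (filterI Xx Yy) (filterI (half Y x y hY hy Yy) (half X y x hX hx Xx)) sym.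
move=> t [EX EY] [HY HX] St.
rewrite /br EX EY HY HX mulmxBl.
rewrite (_ : \row_k _ = \row_k \sum_i \sum_a y t ord0 i * x t ord0 a * der (fun s => Dm Th s a k) t i ord0).
  by rewrite opprD addrACA subrr addr0.
apply/rowP => k; rewrite !mxE exchange_big /=; apply: eq_bigr => i _; apply: eq_bigr => a _.
by rewrite St [y t _ _ * _]mulrC.
Qed.

Lemma holv_br n (X Y : 'rV[C]_n -> 'rV[C]_n) : holv X -> holv Y -> holv (br X Y).
Proof.
by move=> hX hY; apply: holvB; apply: holv_mulmx => //; exact: holv_Dm.
Qed.
End VectorFields.

(** * The complexified graph *)

Section Complexification.
Variable R : realType.
Local Notation C := R[i].
Local Notation i := ('i%C : C).
Implicit Types (t : 'rV[C]_((1 + 2) + (1 + 2))) (m : 'rV[C]_(1 + 1 + 2)).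

Lemma hasD_bigO2 n k (F : 'rV[C]_n -> 'rV[C]_k) : bigOv 2 F -> hasD F 0 0.
Proof.
move=> h j; apply: bigO_ext (h j); apply: near0W => v.
by rewrite add0r (bigO_at0 (h j)) subr0 mulmx_colE mulmx0 mxE subr0.
Qed.

Lemma ic2 : i * c2 R = 2^-1.
Proof. by rewrite c2E mulrN mulrA i_sqr mulNr opprK mul1r. Qed.

Lemma addhalf n (x : 'rV[C]_n) : 2^-1 *: x + 2^-1 *: x = x.
Proof. by rewrite -scalerDl (_ : 2^-1 + 2^-1 = 1) ?scale1r//; field. Qed.

(** ** The complexified graph [v = z ze G (z, ze, u)] *)

Variable G : 'rV[C]_(1 + 1 + 2) -> 'rV[C]_2.

Definition zz m : C := lsubmx (lsubmx m) ord0 ord0 * rsubmx (lsubmx m) ord0 ord0.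

Definition graphF m : 'rV[C]_2 := zz m *: G m.

Definition swap4 m : 'rV[C]_(1 + 1 + 2) :=
  row_mx (row_mx (cj (rsubmx (lsubmx m))) (cj (lsubmx (lsubmx m)))) (cj (rsubmx m)).

(** The point [(z, ze, u)], where [u = (w + om) / 2], at which the graphing function of
    [graph_def] is evaluated. *)
Definition mid t : 'rV[C]_(1 + 1 + 2) :=
  row_mx (row_mx (lsubmx (lsubmx t)) (lsubmx (rsubmx t)))
    (2^-1 *: (rsubmx (lsubmx t) + rsubmx (rsubmx t))).

Lemma swap4D m1 m2 : swap4 (m1 + m2) = swap4 m1 + swap4 m2.
Proof. by rewrite /swap4 !linearD /= !cjD !add_row_mx. Qed.

Lemma lsubZ n1 n2 c (x : 'rV[C]_(n1 + n2)) : lsubmx (c *: x) = c *: lsubmx x.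
Proof. by apply/rowP => j; rewrite !mxE. Qed.

Lemma rsubZ n1 n2 c (x : 'rV[C]_(n1 + n2)) : rsubmx (c *: x) = c *: rsubmx x.
Proof. by apply/rowP => j; rewrite !mxE. Qed.

Lemma swap4Z (r : R) m : swap4 (r%:C *: m) = r%:C *: swap4 m.
Proof. by rewrite /swap4 !(lsubZ, rsubZ) !cjZ !conjc_real !scale_row_mx. Qed.

Lemma swap4_mid (a b : 'rV[C]_(1 + 2)) :
  swap4 (mid (row_mx a b)) = mid (row_mx (cj b) (cj a)).
Proof.
rewrite /swap4 /mid !(row_mxKl, row_mxKr) cjZ cjD !cj_lsub !cj_rsub.
by rewrite conjc_inv conjc_nat [X in _ *: X]addrC.
Qed.

(** [graph_def t = 0] is the equation of the complexified graph at
    [t = (z, w, ze, om)]. *)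
Definition graph_def t : 'rV[C]_2 :=
  c2 R *: (rsubmx (lsubmx t) - rsubmx (rsubmx t)) - graphF (mid t).

Definition of_mid m (f : 'rV[C]_2) : 'rV[C]_((1 + 2) + (1 + 2)) :=
  row_mx (row_mx (lsubmx (lsubmx m)) (rsubmx m + i *: f))
         (row_mx (rsubmx (lsubmx m)) (rsubmx m - i *: f)).

Lemma mid_of_mid m f : mid (of_mid m f) = m.
Proof.
rewrite /mid /of_mid !(row_mxKl, row_mxKr) addrACA subrr addr0 scalerDr addhalf.
by rewrite !hsubmxK.
Qed.

Lemma of_midE m f : c2 R *: (rsubmx (lsubmx (of_mid m f)) - rsubmx (rsubmx (of_mid m f))) = f.
Proof.
rewrite /of_mid !(row_mxKl, row_mxKr) opprD addrACA subrr add0r opprK -scalerDl.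
by rewrite scalerA -mulr2n -[_ *+ 2]mulr_natl c2K scale1r.
Qed.

Lemma of_midK t f : c2 R *: (rsubmx (lsubmx t) - rsubmx (rsubmx t)) = f ->
  of_mid (mid t) f = t.
Proof.
move=> <-; rewrite /of_mid /mid !(row_mxKl, row_mxKr) scalerA ic2.
set w := rsubmx (lsubmx t); set o := rsubmx (rsubmx t).
have -> : 2^-1 *: (w + o) + 2^-1 *: (w - o) = w.
  by rewrite -scalerDr addrACA subrr addr0 scalerDr addhalf.
have -> : 2^-1 *: (w + o) - 2^-1 *: (w - o) = o.
  by rewrite -scalerBr opprB (addrC o) addrACA subrr add0r scalerDr addhalf.
by rewrite !hsubmxK.
Qed.

Lemma graph_def_of_mid m : graph_def (of_mid m (graphF m)) = 0.
Proof. by rewrite /graph_def mid_of_mid of_midE subrr. Qed.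

Hypothesis hG : holv G.

Lemma hol_zz : hol zz.
Proof. by rewrite /zz; apply: holM; [have h := holv_lsub (holv_lsub (@holv_id R _))|have h := holv_rsub (holv_lsub (@holv_id R _))]; exact: h. Qed.

Lemma holv_graphF : holv graphF.
Proof. exact: holvZ hol_zz hG. Qed.

Lemma graphF0 : graphF 0 = 0.
Proof. by rewrite /graphF /zz !lsub0 mxE mul0r scale0r. Qed.

Lemma holv_mid : holv mid.
Proof. by rewrite /mid; holt. Qed.

Lemma mid0 : mid 0 = 0.
Proof. by rewrite /mid !(lsub0, rsub0, addr0, scaler0, row_mx0). Qed.

Lemma holv_graph_def : holv graph_def.
Proof.
have hF := holv_graphF; have hm := holv_mid.
by rewrite /graph_def; holt; exact: mid0.
Qed.

(** ** Segre form: the same equation solved for [w] *)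

(** The variables [(z, ze, om)]: fixing the conjugate variables [(ze, om)] gives a Segre
    variety. *)
Definition seg t : 'rV[C]_(1 + 1 + 2) :=
  row_mx (row_mx (lsubmx (lsubmx t)) (lsubmx (rsubmx t))) (rsubmx (rsubmx t)).

Definition seg_def (Y : 'rV[C]_(1 + 1 + 2) -> 'rV[C]_2) t : 'rV[C]_2 :=
  rsubmx (lsubmx t) - rsubmx (rsubmx t) - Y (seg t).

(** The unknown [y = w - om] solves [y = 2 i F (z, ze, om + y / 2)], and [F] is a multiple of
    [z ze]. *)
Lemma segre_form : exists Y E : 'rV[C]_(1 + 1 + 2) -> 'rV[C]_2,
  [/\ holv Y, holv E, near0 (fun m => Y m = zz m *: E m),
    near0 (fun m => E m = (2 * i) *: G (row_mx (lsubmx m) (rsubmx m + 2^-1 *: Y m))) &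
    Y 0 = 0 /\ near0 (fun t => graph_def t = 0 <-> seg_def Y t = 0)].
Proof.
pose e (x : 'rV[C]_(1 + 1 + 2 + 2)) : 'rV[C]_(1 + 1 + 2) :=
  row_mx (lsubmx (lsubmx x)) (rsubmx (lsubmx x) + 2^-1 *: rsubmx x).
pose g x := (2 * i) *: graphF (e x).
have he : holv e by rewrite /e; holt.
have e0 : e 0 = 0 by rewrite /e !(lsub0, rsub0, addr0, scaler0, row_mx0).
have hF := holv_graphF.
have hg : holv g by rewrite /g; holt.
have g0 : g 0 = 0 by rewrite /g e0 graphF0 scaler0.
have g2 : bigOv 2 (fun y => g (row_mx 0 y)).
  move=> j; apply: bigO_ext (bigO_zero R 2 2); apply: near0W => y.
  have z0 : zz (e (row_mx 0 y)) = 0 by rewrite /zz /e !row_mxKl !lsub0 mxE mul0r.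
  by rewrite /g /graphF z0 scale0r scaler0 mxE.
have [Y [hY Y0 YE]] := implicit_function hg g0 g2.
pose E m := (2 * i) *: G (row_mx (lsubmx m) (rsubmx m + 2^-1 *: Y m)).
have hE : holv E by rewrite /E; holt; rewrite lsub0 rsub0 Y0 scaler0 addr0 row_mx0.
exists Y, E; split=> //.
- have t1 : to0 (fun m => row_mx m (Y m)) by apply: holv_to0; [holt|rewrite Y0 row_mx0].
  apply: near0S (near0_comp t1 YE) => m; rewrite row_mxKl row_mxKr => -[_ /(_ erefl) ->].
  by rewrite /g /graphF /e /zz !row_mxKl !row_mxKr /E !scalerA [in RHS]mulrC.
- exact: near0W.
split=> //.
have t1 : to0 (fun t => row_mx (seg t) (rsubmx (lsubmx t) - rsubmx (rsubmx t))).
  by apply: holv_to0; [rewrite /seg; holt|rewrite /seg !(lsub0, rsub0, subrr, row_mx0)].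
apply: near0S (near0_comp t1 YE) => t; rewrite row_mxKl row_mxKr => h.
have eE : e (row_mx (seg t) (rsubmx (lsubmx t) - rsubmx (rsubmx t))) = mid t.
  rewrite /e !(row_mxKl, row_mxKr) /seg /mid ?(row_mxKl, row_mxKr); congr row_mx.
  rewrite scalerBr scalerDr addrCA; congr (_ + _).
  by rewrite -{1}[X in X - _]addhalf addrK.
rewrite /graph_def /seg_def; split=> [/eqP|/eqP]; rewrite subr_eq0 => /eqP e1; apply/eqP; rewrite subr_eq0; apply/eqP.
  by apply/h; rewrite /g eE -e1 scalerA mulrC c2K scale1r.
by move/h: e1 => ->; rewrite /g eE scalerA c2K scale1r.
Qed.
End Complexification.

(** * The realification of holomorphic coordinates *)

Section RealPoints.
Variable R : realType.
Local Notation C := R[i].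
Local Notation i := ('i%C : C).

Lemma rc_ReM n m (x : 'M[C]_(n, m)) : rc (ReM x) = 2^-1 *: (x + cj x).
Proof.
apply/matrixP => j k; rewrite !mxE.
by rewrite addcJ mulrA mulVf ?mul1r// pnatr_eq0.
Qed.

Lemma rc_ImM n m (x : 'M[C]_(n, m)) : rc (ImM x) = c2 R *: (x - cj x).
Proof.
apply/matrixP => j k; rewrite !mxE subcJ mulrAC mulrA c2K mul1r.
by [].
Qed.

Lemma rc_row m n1 n2 (A : 'M[R]_(m, n1)) (B : 'M[R]_(m, n2)) :
  rc (row_mx A B) = row_mx (rc A) (rc B).
Proof. exact: map_row_mx. Qed.

Lemma to_complexE n (p : 'rV[R]_(n + n)) :
  to_complex p = lsubmx (rc p) + i *: rsubmx (rc p).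
Proof. by apply/rowP => j; rewrite !mxE [LHS]complexE. Qed.

Lemma cj_to_complex n (p : 'rV[R]_(n + n)) :
  cj (to_complex p) = lsubmx (rc p) - i *: rsubmx (rc p).
Proof.
rewrite to_complexE cjD cjZ cj_lsub cj_rsub cj_rc conj_i.
by rewrite scaleNr.
Qed.

Lemma to_complex_row n (x : 'rV[C]_n) : to_complex (row_mx (ReM x) (ImM x)) = x.
Proof.
rewrite /to_complex row_mxKl row_mxKr; apply/rowP => j; rewrite !mxE.
by case: (x ord0 j).
Qed.
End RealPoints.

Section Realification.
Variable R : realType.
Local Notation C := R[i].
Local Notation i := ('i%C : C).
Variable n : nat.
Variables Psi Phi : 'rV[C]_n -> 'rV[C]_n.
Hypotheses (hPsi : holv Psi) (hPhi : holv Phi) (Psi0 : Psi 0 = 0) (Phi0 : Phi 0 = 0).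
Hypotheses (PhiK : near0 (fun q => Phi (Psi q) = q)) (PsiK : near0 (fun c => Psi (Phi c) = c)).

(** The holomorphic map that extends [(q, cj q) |-> (Re (Psi q), Im (Psi q))]. *)
Definition Th (t : 'rV[C]_(n + n)) : 'rV[C]_(n + n) :=
  row_mx (2^-1 *: (Psi (lsubmx t) + starv Psi (rsubmx t)))
         (c2 R *: (Psi (lsubmx t) - starv Psi (rsubmx t))).

Definition Ti (P : 'rV[C]_(n + n)) : 'rV[C]_(n + n) :=
  row_mx (Phi (lsubmx P + i *: rsubmx P)) (starv Phi (lsubmx P - i *: rsubmx P)).

Lemma holv_Th : holv Th.
Proof. by have h := holv_star hPsi; rewrite /Th; holt; rewrite ?lsub0 ?rsub0. Qed.

Lemma starPsi0 : starv Psi 0 = 0.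
Proof. by rewrite /starv cj0 Psi0 cj0. Qed.

Lemma starPhi0 : starv Phi 0 = 0.
Proof. by rewrite /starv cj0 Phi0 cj0. Qed.

Lemma Th0 : Th 0 = 0.
Proof. by rewrite /Th lsub0 rsub0 starPsi0 Psi0 subrr addr0 !scaler0 row_mx0. Qed.

Lemma holv_Ti : holv Ti.
Proof.
have h := holv_star hPhi; rewrite /Ti; holt;
  by rewrite lsub0 rsub0 scaler0 ?addr0 ?subr0.
Qed.

Lemma Ti0 : Ti 0 = 0.
Proof. by rewrite /Ti lsub0 rsub0 scaler0 addr0 subr0 starPhi0 Phi0 row_mx0. Qed.

Lemma lTh t : lsubmx (Th t) + i *: rsubmx (Th t) = Psi (lsubmx t).
Proof.
rewrite /Th row_mxKl row_mxKr scalerA ic2 -scalerDr addrACA subrr addr0.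
by rewrite scalerDr addhalf.
Qed.

Lemma rTh t : lsubmx (Th t) - i *: rsubmx (Th t) = starv Psi (rsubmx t).
Proof.
rewrite /Th row_mxKl row_mxKr scalerA ic2 -scalerBr opprB (addrC (starv _ _) (- _)) addrACA.
by rewrite subrr add0r scalerDr addhalf.
Qed.

Lemma ThK : near0 (fun t => Ti (Th t) = t).
Proof.
have tl : to0 (fun t : 'rV[C]_(n + n) => lsubmx t) by apply: holv_to0; [holt|exact: lsub0].
have tr : to0 (fun t : 'rV[C]_(n + n) => rsubmx t) by apply: holv_to0; [holt|exact: rsub0].
apply: near0S2 (near0_comp tl PhiK) (near0_comp tr (near0_cj PhiK)) => t e1 e2.
by rewrite /Ti lTh rTh e1 /starv cjK e2 cjK hsubmxK.
Qed.

Lemma TiK : near0 (fun P => Th (Ti P) = P).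
Proof.
have tl : to0 (fun P : 'rV[C]_(n + n) => lsubmx P + i *: rsubmx P).
  by apply: holv_to0; [holt|rewrite lsub0 rsub0 scaler0 addr0].
have tr : to0 (fun P : 'rV[C]_(n + n) => lsubmx P - i *: rsubmx P).
  by apply: holv_to0; [holt|rewrite lsub0 rsub0 scaler0 subr0].
apply: near0S2 (near0_comp tl PsiK) (near0_comp tr (near0_cj PsiK)) => P e1 e2.
rewrite /Th /Ti row_mxKl row_mxKr e1 /starv cjK e2 cjK.
rewrite addrACA subrr addr0 opprD addrACA subrr add0r opprK -[X in row_mx _ (_ *: X)]scalerDl.
rewrite scalerDr addhalf scalerA -mulr2n -[_ *+ 2]mulr_natl c2K scale1r.
by rewrite hsubmxK.
Qed.

Lemma Ti_rc p : Ti (rc p) = row_mx (Phi (to_complex p)) (cj (Phi (to_complex p))).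
Proof. by rewrite /Ti -to_complexE -cj_to_complex /starv cjK. Qed.

Lemma Th_real q : Th (row_mx q (cj q)) = rc (row_mx (ReM (Psi q)) (ImM (Psi q))).
Proof. by rewrite /Th row_mxKl row_mxKr /starv cjK rc_row rc_ReM rc_ImM. Qed.

Lemma hasD_Th t A B : hasD Psi (lsubmx t) A -> hasD (starv Psi) (rsubmx t) B ->
  hasD Th t (row_mx (2^-1 *: (pl R n n *m A + pr R n n *m B))
                    (c2 R *: (pl R n n *m A - pr R n n *m B))).
Proof.
move=> hA hB.
have h1 : hasD (fun t => Psi (lsubmx t)) t (pl R n n *m A).
  rewrite -mul_pl in hA; apply: eq_hasD (hasD_comp (hasD_lin (pl R n n) t) hA) => x.
  by rewrite mul_pl.
have h2 : hasD (fun t => starv Psi (rsubmx t)) t (pr R n n *m B).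
  rewrite -mul_pr in hB; apply: eq_hasD (hasD_comp (hasD_lin (pr R n n) t) hB) => x.
  by rewrite mul_pr.
exact: hasD_row (hasDZ _ (hasDD h1 h2)) (hasDZ _ (hasDB h1 h2)).
Qed.

Lemma Dm_Th t : hasD Psi (lsubmx t) (Dm Psi (lsubmx t)) ->
  hasD (starv Psi) (rsubmx t) (Dm (starv Psi) (rsubmx t)) ->
  hasD Th t (Dm Th t) /\ forall a b : 'rV[C]_n, row_mx a b *m Dm Th t =
   row_mx (2^-1 *: (a *m Dm Psi (lsubmx t) + b *m Dm (starv Psi) (rsubmx t)))
          (c2 R *: (a *m Dm Psi (lsubmx t) - b *m Dm (starv Psi) (rsubmx t))).
Proof.
move=> hA hB; have h := hasD_Th hA hB; rewrite (DmE h); split=> // a b.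
by rewrite mul_mx_row -!scalemxAr mulmxBr mulmxDr !mulmxA mul_pl mul_pr row_mxKl row_mxKr.
Qed.

Lemma near0_Dm_Th : near0 (fun t => hasD Psi (lsubmx t) (Dm Psi (lsubmx t)) /\
  hasD (starv Psi) (rsubmx t) (Dm (starv Psi) (rsubmx t))).
Proof.
have tl : to0 (fun t : 'rV[C]_(n + n) => lsubmx t) by apply: holv_to0; [holt|exact: lsub0].
have tr : to0 (fun t : 'rV[C]_(n + n) => rsubmx t) by apply: holv_to0; [holt|exact: rsub0].
exact: near0S2 (fun t h1 h2 => conj h1 h2) (near0_comp tl (holv_hasD hPsi))
  (near0_comp tr (holv_hasD (holv_star hPsi))).
Qed.

Lemma Dm_starv q : hasD Psi q (Dm Psi q) -> Dm (starv Psi) (cj q) = cj (Dm Psi q).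
Proof. by move=> h; exact/DmE/hasD_star. Qed.

Lemma Dm_Th_real q (a : 'rV[C]_n) : hasD Psi q (Dm Psi q) ->
  row_mx a (cj a) *m Dm Th (row_mx q (cj q))
  = rc (row_mx (ReM (a *m Dm Psi q)) (ImM (a *m Dm Psi q))).
Proof.
move=> hq; have hq' := hasD_star hq.
have [] := @Dm_Th (row_mx q (cj q)); rewrite ?row_mxKl ?row_mxKr//.
  by rewrite Dm_starv.
move=> _ ->; rewrite Dm_starv// -cjM rc_row rc_ReM rc_ImM.
by [].
Qed.
End Realification.

(** * Tangent vectors of the graph *)

Section Tangents.
Variable R : realType.
Local Notation C := R[i].
Local Notation i := ('i%C : C).
Implicit Types (t : 'rV[C]_((1 + 2) + (1 + 2))) (m : 'rV[C]_(1 + 1 + 2)).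

Lemma hasD_mid t : exists B, hasD (@mid R) t B /\ forall x, x *m B = mid x.
Proof.
have h1 := hasD_lsub (hasD_id t); have h2 := hasD_rsub (hasD_id t).
have h := hasD_row (hasD_row (hasD_lsub h1) (hasD_lsub h2))
  (hasDZ 2^-1 (hasDD (hasD_rsub h1) (hasD_rsub h2))).
eexists; split; first exact: h.
move=> x; rewrite !mul_mx_row -scalemxAr mulmxDr.
by rewrite !(mulmx_lsub, mulmx_rsub) mulmx1.
Qed.

Lemma hasD_seg t : exists B, hasD (@seg R) t B /\ forall x, x *m B = seg x.
Proof.
have h1 := hasD_lsub (hasD_id t); have h2 := hasD_rsub (hasD_id t).
have h := hasD_row (hasD_row (hasD_lsub h1) (hasD_lsub h2)) (hasD_rsub h2).
eexists; split; first exact: h.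
by move=> x; rewrite !mul_mx_row !(mulmx_lsub, mulmx_rsub) mulmx1.
Qed.

Lemma Dm_graph_def (G : 'rV[C]_(1 + 1 + 2) -> 'rV[C]_2) t :
  hasD (graphF G) (mid t) (Dm (graphF G) (mid t)) ->
  hasD (graph_def G) t (Dm (graph_def G) t) /\ forall x,
    x *m Dm (graph_def G) t = c2 R *: (rsubmx (lsubmx x) - rsubmx (rsubmx x))
      - mid x *m Dm (graphF G) (mid t).
Proof.
move=> hF; have [B [hB BE]] := hasD_mid t.
have h1 := hasD_lsub (hasD_id t); have h2 := hasD_rsub (hasD_id t).
have h := hasDB (hasDZ (c2 R) (hasDB (hasD_rsub h1) (hasD_rsub h2))) (hasD_comp hB hF).
have {}h : hasD (graph_def G) t _ := h.
rewrite (DmE h); split=> // x; rewrite mulmxBr -scalemxAr mulmxBr mulmxA BE.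
by rewrite !(mulmx_lsub, mulmx_rsub) mulmx1.
Qed.

Lemma Dm_seg_def (Y : 'rV[C]_(1 + 1 + 2) -> 'rV[C]_2) t :
  hasD Y (seg t) (Dm Y (seg t)) ->
  hasD (seg_def Y) t (Dm (seg_def Y) t) /\ forall x,
    x *m Dm (seg_def Y) t = rsubmx (lsubmx x) - rsubmx (rsubmx x)
      - seg x *m Dm Y (seg t).
Proof.
move=> hF; have [B [hB BE]] := hasD_seg t.
have h1 := hasD_lsub (hasD_id t); have h2 := hasD_rsub (hasD_id t).
have h := hasDB (hasDB (hasD_rsub h1) (hasD_rsub h2)) (hasD_comp hB hF).
have {}h : hasD (seg_def Y) t _ := h.
rewrite (DmE h); split=> // x; rewrite !mulmxBr mulmxA BE.
by rewrite !(mulmx_lsub, mulmx_rsub) mulmx1.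
Qed.

Lemma near0_real1 (P : 'rV[C]_1 -> Prop) : near0 P -> \forall r \near (0 : R), P (rc r%:M).
Proof.
move=> [d [d0 h]]; apply/nbhs_normP; exists d => // r /=; rewrite sub0r normrN => rd.
by apply: h => j; rewrite rcE mxE !ord1 eqxx mulr1n nrm_real ltW.
Qed.

Lemma of_mid_real m f : swap4 m = m -> cj f = f ->
  of_mid m f = row_mx (lsubmx (of_mid m f)) (cj (lsubmx (of_mid m f))).
Proof.
move=> mE fE; rewrite {1}/of_mid /of_mid row_mxKl; congr row_mx.
rewrite cj_row cjD cjZ conj_i fE scaleNr; congr row_mx.
  by rewrite -{1}mE /swap4 row_mxKl row_mxKr.
by congr (_ - _); rewrite -{1}mE /swap4 row_mxKr.
Qed.

Variables Psi : 'rV[C]_(1 + 2) -> 'rV[C]_(1 + 2).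
Variable G : 'rV[C]_(1 + 1 + 2) -> 'rV[C]_2.
Variable M : set 'rV[C]_(1 + 2).

Let real_pt (q : 'rV[C]_(1 + 2)) := row_mx q (cj q).

(** The graph is parametrised by the real points of the space of [(z, ze, u)]; the curve is
    the image of a line. *)
Lemma tangent_curve (p : 'rV[R]_((1 + 2) + (1 + 2))) q (a : 'rV[C]_(1 + 2)) :
  Psi q = to_complex p -> hasD Psi q (Dm Psi q) ->
  hasD (Th Psi) (real_pt q) (Dm (Th Psi) (real_pt q)) ->
  near0 (fun v => M (Psi (q + v)) <-> graph_def G (real_pt (q + v)) = 0) ->
  near0 (fun v => graphF G (swap4 (mid (real_pt q) + v)) = cj (graphF G (mid (real_pt q) + v))) ->
  hasD (graphF G) (mid (real_pt q)) (Dm (graphF G) (mid (real_pt q))) ->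
  graph_def G (real_pt q) = 0 ->
  real_pt a *m Dm (graph_def G) (real_pt q) = 0 ->
  tangent (realification M) p (row_mx (ReM (a *m Dm Psi q)) (ImM (a *m Dm Psi q))).
Proof.
move=> qp hPsi hTh hM hF dF t0; set t := real_pt q; set m0 := mid t; set tau := real_pt a.
have [_ ->] := Dm_graph_def dF => /eqP; rewrite subr_eq0 => /eqP tauE.
have tE : of_mid m0 (graphF G m0) = t.
  by apply: of_midK; apply/eqP; rewrite -subr_eq0; apply/eqP.
pose mx (x : 'rV[C]_1) := m0 + x *m mid tau.
pose th x := of_mid (mx x) (graphF G (mx x)).
have mx0 : mx 0 = m0 by rewrite /mx mul0mx addr0.
have hmx : hasD mx 0 (mid tau).
  have := hasDD (hasD_const m0 (0 : 'rV[C]_1)) (hasD_lin (mid tau) 0).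
  by rewrite add0r; exact.
have hFm : hasD (fun x => graphF G (mx x)) 0 (mid tau *m Dm (graphF G) m0).
  by apply: hasD_comp hmx _; rewrite mx0.
have hth : hasD th 0 tau.
  have h1 := hasD_lsub hmx.
  have := hasD_row (hasD_row (hasD_lsub h1) (hasDD (hasD_rsub hmx) (hasDZ i hFm)))
    (hasD_row (hasD_rsub h1) (hasDB (hasD_rsub hmx) (hasDZ i hFm))).
  by rewrite -[X in hasD _ _ X]/(of_mid (mid tau) (mid tau *m Dm (graphF G) m0)) of_midK.
have th0 : th 0 = t by rewrite /th mx0.
have hg : hasD (fun x => Th Psi (th x)) 0 (tau *m Dm (Th Psi) t).
  by apply: hasD_comp hth _; rewrite th0.
have mxr (r : R) : swap4 (mx (rc r%:M)) = mx (rc r%:M).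
  have sw x : swap4 (mid (real_pt x)) = mid (real_pt x) by rewrite swap4_mid cjK.
  have E : rc r%:M *m mid tau = r%:C *: mid tau.
    by rewrite -mul_scalar_mx; congr (_ *m _); apply/rowP => j; rewrite !mxE !ord1 eqxx !mulr1n.
  by rewrite /mx E swap4D swap4Z !sw.
exists (fun r : R => ReM (Th Psi (th (rc r%:M)))).
have thr (r : R) : cj (graphF G (mx (rc r%:M))) = graphF G (mx (rc r%:M)) ->
    th (rc r%:M) = real_pt (lsubmx (th (rc r%:M))).
  by move=> e; exact: of_mid_real (mxr r) e.
have pE : row_mx (ReM (to_complex p)) (ImM (to_complex p)) = p.
  rewrite -[RHS]hsubmxK; congr row_mx; by apply/rowP => j; rewrite !mxE.
split.
- have -> : rc (0 : R)%:M = 0 :> 'rV[C]_1 by apply/rowP => j; rewrite !mxE mul0rn.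
  by rewrite th0 /t Th_real ReM_rc qp pE.
- have to1 : to0 (fun x => lsubmx (th x) - q).
    have := bigOv_to0 (hasD_O1 (hasD_lsub hth)) => h e e0.
    have tq : lsubmx t = q by exact: row_mxKl.
    by apply: near0S (h e e0) => x; rewrite add0r th0 tq.
  have to2 : to0 (fun x : 'rV[C]_1 => x *m mid tau).
    by apply: holv_to0; [holt|rewrite mul0mx].
  have nn := near0S2 (fun x h1 h2 => conj h1 h2) (near0_comp to1 hM) (near0_comp to2 hF).
  apply: filterS (near0_real1 nn) => r [h1 h2]; rewrite addrC subrK in h1.
  rewrite -/(mx _) mxr in h2; have thE := thr _ (esym h2).
  rewrite /realification /= thE Th_real ReM_rc to_complex_row.
  by apply/h1; rewrite -thE; exact: graph_def_of_mid.
- have := curve_derive hg; rewrite row_id.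
  have -> : tau *m Dm (Th Psi) t = rc (row_mx (ReM (a *m Dm Psi q)) (ImM (a *m Dm Psi q))).
    exact: Dm_Th_real.
  by rewrite ReM_rc.
Qed.
End Tangents.

(** * The (1,0) fields *)

(** In the coordinates [q = (z, w)], where [Psi q] is the point and [Phi] the inverse of [Psi],
    the submanifold is the graph [v = z zb G]; its complexification is also given by
    [w = om + Y (z, ze, om)]. *)

Section Generator.
Variable R : realType.
Local Notation C := R[i].
Local Notation i := ('i%C : C).
Implicit Types (t : 'rV[C]_((1 + 2) + (1 + 2))) (m : 'rV[C]_(1 + 1 + 2)).

Variables (M : set 'rV[C]_(1 + 2)) (Psi Phi : 'rV[C]_(1 + 2) -> 'rV[C]_(1 + 2)).
Hypotheses (hPsi : holv Psi) (hPhi : holv Phi) (Psi0 : Psi 0 = 0) (Phi0 : Phi 0 = 0).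
Hypotheses (PhiK : near0 (fun q => Phi (Psi q) = q)) (PsiK : near0 (fun c => Psi (Phi c) = c)).
Variable G : 'rV[C]_(1 + 1 + 2) -> 'rV[C]_2.
Hypotheses (hG : holv G) (symG : near0 (fun m => G (swap4 m) = cj (G m))).
Hypothesis hM : near0 (fun q => M (Psi q) <-> graph_def G (row_mx q (cj q)) = 0).
Variables Y E : 'rV[C]_(1 + 1 + 2) -> 'rV[C]_2.
Hypotheses (hY : holv Y) (Y0 : Y 0 = 0).
Hypothesis segE : near0 (fun t => graph_def G t = 0 <-> seg_def Y t = 0).

Definition iz : 'I_(1 + 1 + 2) := lshift 2 (lshift 1 ord0).

(** The direction of the Segre variety through the point. *)
Definition lam t : 'rV[C]_(1 + 2) := row_mx 1%:M (row iz (Dm Y (seg t))).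

(** The (1,0) field [d/dz + (dY/dz) d/dw] and its conjugate, complexified. *)
Definition fL t : 'rV[C]_((1 + 2) + (1 + 2)) := row_mx (lam t) 0.

Definition fL' t : 'rV[C]_((1 + 2) + (1 + 2)) :=
  row_mx 0 (starv lam (row_mx (rsubmx t) (lsubmx t))).

(** A holomorphic field on the complexification, transported to the complexified ambient
    space [C^3 x C^3]; on real points it is a complexified field of [R^6]. *)
Definition push (f : 'rV[C]_((1 + 2) + (1 + 2)) -> 'rV[C]_((1 + 2) + (1 + 2))) P :=
  f (Ti Phi P) *m Dm (Th Psi) (Ti Phi P).

Lemma holv_seg : holv (@seg R). Proof. by rewrite /seg; holt. Qed.

Lemma seg0 : seg (0 : 'rV[C]_((1 + 2) + (1 + 2))) = 0.
Proof. by rewrite /seg !(lsub0, rsub0, row_mx0). Qed.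

Lemma holv_lam : holv lam.
Proof.
rewrite /lam; apply: holv_row; first exact: holv_const.
move=> j; apply: (eq_hol (f := fun t => Dm Y (seg t) iz j)) => [t|]; first by rewrite [RHS]mxE.
exact: hol_comp (holv_Dm hY iz j) holv_seg seg0.
Qed.

Lemma holv_fL : holv fL.
Proof. by have h := holv_lam; rewrite /fL; holt. Qed.

Lemma holv_fL' : holv fL'.
Proof.
apply: holv_row; first exact: holv_const.
apply: holv_comp (holv_star holv_lam) _ _; last by rewrite lsub0 rsub0 row_mx0.
by holt.
Qed.

Lemma holv_push f : holv f -> holv (push f).
Proof.
move=> hf; have hT := holv_Ti hPhi; have T0 := Ti0 Phi0.
rewrite /push; holt; first exact: T0.
exact: (@hol_comp _ _ _ (fun t => Dm (Th Psi) t _ _) _ (holv_Dm (holv_Th hPsi) _ _) hT T0).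
Qed.

Lemma push_Th f : near0 (fun t => push f (Th Psi t) = f t *m Dm (Th Psi) t).
Proof. by apply: near0S (ThK PhiK) => t e; rewrite /push e. Qed.

(** Differentiate in [z] the identity [graph_def G = 0] along the parametrisation of the
    graph by [(z, ze, om)]. *)
Lemma fL_tangent : near0 (fun t => seg_def Y t = 0 -> fL t *m Dm (graph_def G) t = 0).
Proof.
pose sg m : 'rV[C]_((1 + 2) + (1 + 2)) :=
  row_mx (row_mx (lsubmx (lsubmx m)) (rsubmx m + Y m)) (row_mx (rsubmx (lsubmx m)) (rsubmx m)).
have hsg : holv sg by rewrite /sg; holt.
have sg0 : sg 0 = 0 by rewrite /sg Y0 !(lsub0, rsub0, addr0, row_mx0).
have segK m : seg (sg m) = m by rewrite /seg /sg !(row_mxKl, row_mxKr) !hsubmxK.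
have sgK t : seg_def Y t = 0 -> sg (seg t) = t.
  rewrite /seg_def => /eqP; rewrite subr_eq0 => /eqP e.
  by rewrite /sg -e /seg !(row_mxKl, row_mxKr) addrC subrK !hsubmxK.
have z m : seg_def Y (sg m) = 0.
  by rewrite /seg_def segK /sg !(row_mxKl, row_mxKr) [_ + Y m]addrC addrK subrr.
have zg : near0 (fun m => graph_def G (sg m) = 0).
  by apply: near0S (near0_comp (holv_to0 hsg sg0) segE) => m h; apply/h.
have hg := holv_graph_def hG.
have key : near0 (fun m => row_mx (row_mx 1%:M (row iz (Dm Y m))) 0 *m Dm (graph_def G) (sg m) = 0).
  apply: near0S3 (near0_shift zg) (holv_hasD hY)
    (near0_comp (holv_to0 hsg sg0) (holv_hasD hg)) => m zm dY dg.
  have h1 := hasD_lsub (hasD_id m); have h2 := hasD_rsub (hasD_id m).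
  have dsg := hasD_row (hasD_row (hasD_lsub h1) (hasDD h2 dY)) (hasD_row (hasD_rsub h1) h2).
  have d0 := hasD_comp dsg dg.
  have /hasD_uniq/(_ d0) e0 : hasD (fun m => graph_def G (sg m)) m 0.
    apply: hasD_ext (hasD_const 0 m); apply: near0S zm => v ->.
    by [].
  have e4 := mulmx0 2 (delta_mx ord0 iz : 'rV[C]_(1 + 1 + 2)).
  rewrite e0 mulmxA in e4; rewrite -[RHS]e4; congr (_ *m _).
  rewrite !mul_mx_row mulmxDr !(mulmx_lsub, mulmx_rsub) mulmx1 -rowE /iz.
  have e1 : rsubmx (delta_mx ord0 (lshift 2 (lshift 1 ord0)) : 'rV[C]_(1 + 1 + 2)) = 0.
    by apply/rowP => j; rewrite !mxE eq_rlshift andbF.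
  have e2 : rsubmx (lsubmx (delta_mx ord0 (lshift 2 (lshift 1 ord0)) : 'rV[C]_(1 + 1 + 2))) = 0.
    by apply/rowP => j; rewrite !mxE (inj_eq (@lshift_inj _ _)) eq_rlshift andbF.
  have e3 : lsubmx (lsubmx (delta_mx ord0 (lshift 2 (lshift 1 ord0)) : 'rV[C]_(1 + 1 + 2))) = 1%:M.
    by apply/rowP => j; rewrite !mxE !ord1.
  by rewrite e1 e2 e3 add0r row_mx0.
apply: near0S (near0_comp (holv_to0 holv_seg seg0) key) => t h e.
by move: h; rewrite sgK.
Qed.

(** ** The generator of the (1,0) tangent spaces *)

Let real_pt (q : 'rV[C]_(1 + 2)) := row_mx q (cj q).
Let cpx (P : 'rV[C]_((1 + 2) + (1 + 2))) : 'rV[C]_(1 + 2) := lsubmx P + i *: rsubmx P.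

Let cpx_to0 : to0 cpx.
Proof. by apply: holv_to0; [rewrite /cpx; holt|rewrite /cpx lsub0 rsub0 scaler0 addr0]. Qed.

Let Ti_to0 : to0 (Ti Phi).
Proof. exact: holv_to0 (holv_Ti hPhi) (Ti0 Phi0). Qed.

Lemma near0_graphF_sym : near0 (fun m => graphF G (swap4 m) = cj (graphF G m)).
Proof.
apply: near0S symG => m e; rewrite /graphF e cjZ; congr (_ *: _).
by rewrite /zz /swap4 !(row_mxKl, row_mxKr) !cjE [RHS]conjM mulrC.
Qed.

Lemma M_graph : near0 (fun P => (M (cpx P) <-> graph_def G (real_pt (Phi (cpx P))) = 0) /\
  (graph_def G (real_pt (Phi (cpx P))) = 0 <-> seg_def Y (real_pt (Phi (cpx P))) = 0)).
Proof.
have t1 : to0 Phi by exact: holv_to0.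
have t2 : to0 real_pt.
  move=> e e0; exists e; split=> // x xe; apply: inD_row => //; exact: inD_cj.
apply: near0S3 (near0_comp cpx_to0 PsiK) (near0_comp cpx_to0 (near0_comp t1 hM))
   (near0_comp cpx_to0 (near0_comp t1 (near0_comp t2 segE))) => P e h1 h2.
by split=> //; rewrite -h1 e.
Qed.

(** On real points the two factors of the complexification are exchanged by conjugation. *)
Lemma push_real p q (a : 'rV[C]_(1 + 2)) : hasD Psi q (Dm Psi q) ->
  Ti Phi (rc p) = real_pt q -> lam (real_pt q) = a ->
  push fL (rc p) = row_mx (2^-1 *: (a *m Dm Psi q)) (c2 R *: (a *m Dm Psi q)) /\
  push fL' (rc p) = cj (push fL (rc p)).
Proof.
move=> dq tq la; have dq' := hasD_star dq.
have [||_ dT] := @Dm_Th _ _ Psi (real_pt q).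
- by rewrite /real_pt row_mxKl.
- by rewrite /real_pt row_mxKr Dm_starv.
have e1 : push fL (rc p) = row_mx (2^-1 *: (a *m Dm Psi q)) (c2 R *: (a *m Dm Psi q)).
  by rewrite /push tq /fL la dT /real_pt row_mxKl mul0mx addr0 subr0.
split=> //; rewrite e1 /push tq /fL' dT /real_pt !row_mxKl row_mxKr mul0mx add0r sub0r.
have -> : starv lam (row_mx (cj q) q) = cj a.
  by rewrite /starv cj_row cjK la.
by rewrite Dm_starv// -cjM cj_row !cjZ conj_c2 conjc_inv conjc_nat scalerN scaleNr.
Qed.

Lemma swap_der n (F : 'rV[C]_(1 + 1 + 2) -> 'rV[C]_n) m A : hasD F m A -> swap4 m = m ->
  near0 (fun v => F (swap4 (m + v)) = cj (F (m + v))) ->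
  forall x, swap4 x *m A = cj (x *m A).
Proof.
move=> dA mE sy.
have h1 := hasD_lsub (hasD_id m); have h2 := hasD_rsub (hasD_id m).
have hP := hasD_row (hasD_row (hasD_rsub h1) (hasD_lsub h1)) h2.
set P := row_mx _ _ in hP.
have PE x : x *m P = cj (swap4 x).
  rewrite /P !mul_mx_row !(mulmx_lsub, mulmx_rsub) mulmx1.
  by rewrite /swap4 !cj_row !cjK.
have dP := hasD_star dA; rewrite -{1}mE -PE in dP.
have := hasD_comp (hasD_lin P m) dP.
have /hasD_uniq h : hasD (fun x => starv (F) (x *m P)) m A.
  apply: hasD_ext dA; apply: near0S sy => v e.
  by rewrite /starv PE cjK e cjK.
move=> /h e x; rewrite [in RHS]e mulmxA PE cjM !cjK.
by [].
Qed.

Lemma row_iz (x : 'rV[C]_1) n (A : 'M[C]_(1 + 1 + 2, n)) :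
  row_mx (row_mx x 0) 0 *m A = x ord0 ord0 *: row iz A.
Proof.
rewrite rowE scalemxAl; congr (_ *m _); apply/rowP => j.
case: (split_ordP j) => j1 ->; last by rewrite row_mxEr !mxE eq_rlshift andbF mulr0.
case: (split_ordP j1) => j2 ->; rewrite row_mxEl.
  by rewrite row_mxEl !mxE !ord1 !eqxx mulr1.
by rewrite row_mxEr !mxE (inj_eq (@lshift_inj _ _)) eq_rlshift andbF mulr0.
Qed.

Lemma real_curve_near n (g : R -> 'rV[R]_n) v (P : 'rV[C]_n -> Prop) :
  is_derive (0 : R) (1 : R) g v -> near0 (fun w => P (rc (g 0) + w)) ->
  \forall r \near (0 : R), P (rc (g r)).
Proof.
move=> dg /near0_real hP.
have gd : differentiable g 0 by apply/derivable1_diffP; case: dg.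
have cg : {for 0, continuous g} by exact: differentiable_continuous.
have c0 : (fun r => g r - g 0) @ (0 : R) --> (0 : 'rV[R]_n).
  by rewrite -(subrr (g 0)); apply: cvgB => //; exact: cvg_cst.
have := c0 _ hP; rewrite /nbhs /= => h0.
near=> r.
have : P (rc (g 0) + rc (g r - g 0)) by near: r; exact: h0.
by rewrite rcB addrC subrK.
Unshelve. all: by end_near.
Qed.

(** The velocity of a curve drawn on the submanifold is killed by the differential of any
    function that vanishes there. *)
Lemma tangent_annihilated : \forall p \near (0 : 'rV[R]_((1 + 2) + (1 + 2))),
  realification M p -> forall v, tangent (realification M) p v ->
  rc v *m (Dm (Ti Phi) (rc p) *m Dm (seg_def Y) (Ti Phi (rc p))) = 0.
Proof.
have hTi := holv_Ti hPhi.
have sT : to0 (fun P => seg (Ti Phi P)).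
  have hs := holv_seg; by apply: holv_to0; [holt; exact: Ti0|rewrite (Ti0 Phi0) seg0].
have f6 := near0_real (near0_shift M_graph).
have f8 := near0_real (near0_comp sT (holv_hasD hY)).
have f9 := near0_real (holv_hasD hTi).
apply: filterS3 f6 f8 f9 => p h6 h8 h9 Mp v [g [gp gM gv]].
have [ds _] := Dm_seg_def h8.
apply: (@tangent_kernel _ _ _ (fun P => seg_def Y (Ti Phi P)) _ g) => //.
  by rewrite gp; apply: hasD_comp h9 _.
pose P6 P := (M (cpx P) <-> graph_def G (real_pt (Phi (cpx P))) = 0) /\
  (graph_def G (real_pt (Phi (cpx P))) = 0 <-> seg_def Y (real_pt (Phi (cpx P))) = 0).
rewrite -gp in h6.
apply: filterS2 gM (@real_curve_near _ g v P6 gv h6) => r Mr [H1 H2].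
by rewrite Ti_rc; move: H1 H2; rewrite /cpx -to_complexE => H1 H2; apply/H2/H1.
Qed.

(** The field is tangent by [fL_tangent] and [tangent_curve]. Conversely a tangent vector is
    annihilated by the differential of [seg_def]; when it is of type (1,0) it has no
    component along the conjugate variables, and the equation determines its component
    along [w] from its component along [z]. *)
Lemma T10_fiber : \forall p \near (0 : 'rV[R]_((1 + 2) + (1 + 2))),
  realification M p -> T10 (realification M) p (push fL (rc p)) /\
  forall X, T10 (realification M) p X -> exists c : C, X = c *: push fL (rc p).
Proof.
have hTi := holv_Ti hPhi; have hF := holv_graphF hG.
have lT : to0 (fun P => lsubmx (Ti Phi P)).
  by apply: holv_to0; [holt|rewrite (Ti0 Phi0) lsub0].
have mT : to0 (fun P => mid (Ti Phi P)).
  have hm := holv_mid R; by apply: holv_to0; [holt; exact: Ti0|rewrite (Ti0 Phi0) mid0].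
have sT : to0 (fun P => seg (Ti Phi P)).
  have hs := holv_seg; by apply: holv_to0; [holt; exact: Ti0|rewrite (Ti0 Phi0) seg0].
have cT : to0 (fun P : 'rV[C]_((1 + 2) + (1 + 2)) => lsubmx P - i *: rsubmx P).
  by apply: holv_to0; [holt|rewrite lsub0 rsub0 scaler0 subr0].
have f1 := near0_real (near0_comp cpx_to0 PsiK).
have f2 := near0_real (near0_comp Ti_to0 (near0_Dm_Th hPsi)).
have f3 := near0_real (near0_comp lT (near0_shift hM)).
have f4 := near0_real (near0_comp mT (near0_shift near0_graphF_sym)).
have f5 := near0_real (near0_comp mT (holv_hasD hF)).
have f6 := near0_real (near0_shift M_graph).
have f7 := near0_real (near0_comp Ti_to0 fL_tangent).
have f8 := near0_real (near0_comp sT (holv_hasD hY)).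
have f9 := near0_real (holv_hasD hTi).
have f10 := near0_real (near0_shift (TiK PsiK)).
have f11 := near0_real (near0_comp cT (holv_hasD (holv_star hPhi))).
have f12 := near0_real (near0_comp cpx_to0 (holv_hasD hPhi)).
apply: filterS (filterI f1 (filterI f2 (filterI f3 (filterI f4 (filterI f5 (filterI f6
  (filterI f7 (filterI f8 (filterI f9 (filterI f10 (filterI f11 (filterI f12
  tangent_annihilated)))))))))))) => p.
move=> [h1 [[h2 h2'] [h3 [h4 [h5 [h6 [h7 [h8 [h9 [h10 [h11 [h12 h13]]]]]]]]]]]] Mp.
have cE : cpx (rc p) = to_complex p by rewrite to_complexE.
set q := Phi (to_complex p).
have tE : Ti Phi (rc p) = real_pt q by exact: Ti_rc.
have lq : lsubmx (real_pt q) = q by exact: row_mxKl.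
have rq : rsubmx (real_pt q) = cj q by exact: row_mxKr.
rewrite cE -/q in h1; rewrite tE lq in h2; rewrite tE lq in h3.
rewrite tE in h4 h5 h7 h8; rewrite tE rq in h2'.
have [Mg gs] := near0_at0 h6; rewrite addr0 cE -/q in Mg gs.
have g0 : graph_def G (real_pt q) = 0 by exact/Mg.
have s0 : seg_def Y (real_pt q) = 0 by exact/gs.
have [dTh _] : hasD (Th Psi) (real_pt q) (Dm (Th Psi) (real_pt q)) /\ True.
  by have [||? _] := @Dm_Th _ _ Psi (real_pt q); rewrite ?lq ?rq.
have [e1 _] := push_real h2 tE erefl.
set xi := lam (real_pt q) *m Dm Psi q in e1.
have ic (x : 'rV[C]_(1 + 2)) : ReM (c2 R *: x) = ImM (2^-1 *: x).
  have half : (2^-1 : C) = (2^-1 : R)%:C by rewrite fmorphV /= rmorph_nat.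
  apply/rowP => j; rewrite !mxE c2E half; case: (x ord0 j) => u v /=; ring.
have sw_fix : swap4 (mid (real_pt q)) = mid (real_pt q) by rewrite swap4_mid cjK.
have [dg gE] := Dm_graph_def h5.
have tan c : tangent (realification M) p
    (row_mx (ReM (c *: xi)) (ImM (c *: xi))).
  rewrite /xi scalemxAl; apply: (@tangent_curve _ Psi G M p q) => //.
  set a := c *: lam _; set D := Dm _ _.
  have x0 : row_mx a 0 *m D = 0.
    have -> : row_mx a 0 = c *: fL (real_pt q) by rewrite /fL scale_row_mx scaler0.
    by rewrite -scalemxAl h7// scaler0.
  have -> : row_mx a (cj a) = row_mx a 0 + row_mx 0 (cj a) by rewrite add_row_mx addr0 add0r.
  rewrite mulmxDl x0 add0r.
  suff -> : row_mx 0 (cj a) *m D = cj (row_mx a 0 *m D) by rewrite x0 cj0.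
  rewrite !gE cjD cjN cjZ conj_c2 -(swap_der h5 sw_fix h4).
  rewrite swap4_mid cj0; move: (_ *m Dm _ _) => y.
  rewrite !(row_mxKl, row_mxKr) rsub0 sub0r subr0 cj_rsub.
  by rewrite scalerN scaleNr.
(* the (1,0) tangent vectors *)
have aff v := h13 Mp v; rewrite tE in aff.
split.
  split.
    rewrite e1; split.
      have := tan 2^-1; congr (tangent _ _ _); apply/rowP => j.
      case: (split_ordP j) => k ->; rewrite [RHS]mxE ?row_mxEl ?row_mxEr.
        by rewrite mxE.
      by have /rowP/(_ k) := ic xi; rewrite !mxE => ->.
    have := tan (c2 R); congr (tangent _ _ _); apply/rowP => j.
    case: (split_ordP j) => k ->; rewrite [RHS]mxE ?row_mxEl ?row_mxEr.
      by have /rowP/(_ k) := ic xi; rewrite !mxE => ->.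
    by rewrite mxE.
  rewrite e1 /Jst row_mxKl row_mxKr scale_row_mx !scalerA; congr row_mx.
    by rewrite -scaleNr c2E opprK mulrC.
  by rewrite ic2.
move=> X [[Xr Xi] JX].
pose tau := X *m Dm (Ti Phi) (rc p).
have XE : X = rc (ReM X) + i *: rc (ImM X).
  by apply/rowP => j; rewrite !mxE -complexE.
have XTh : tau *m Dm (Th Psi) (real_pt q) = X.
  rewrite /tau -mulmxA.
  have : hasD (fun P => Th Psi (Ti Phi P)) (rc p) (Dm (Ti Phi) (rc p) *m Dm (Th Psi) (real_pt q)).
    by apply: hasD_comp h9 _; rewrite tE.
  have /hasD_uniq h : hasD (fun P => Th Psi (Ti Phi P)) (rc p) 1%:M.
    apply: hasD_ext (hasD_id _); by apply: near0S h10 => v ->.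
  by move=> /h <-; rewrite mulmx1.
have tau_s : tau *m Dm (seg_def Y) (real_pt q) = 0.
  rewrite /tau -mulmxA XE mulmxDl -scalemxAl aff ?aff ?scaler0 ?addr0//.
have tk : rsubmx tau = 0.
  have k1 := hasD_lsub (hasD_id (rc p)); have k2 := hasD_rsub (hasD_id (rc p)).
  have k3 := hasD_comp (hasDD k1 (hasDZ i k2)) h12.
  have k4 := hasD_comp (hasDB k1 (hasDZ i k2)) h11.
  have hT : hasD (Ti Phi) (rc p) _ := hasD_row k3 k4.
  rewrite /tau (DmE hT) mul_mx_row row_mxKr mulmxA mulmxBr -scalemxAr.
  rewrite mulmx_lsub mulmx_rsub mulmx1.
  suff -> : lsubmx X = i *: rsubmx X by rewrite subrr mul0mx.
  have := congr1 (fun x => rsubmx x) JX; rewrite /Jst row_mxKr => ->.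
  by rewrite linearZ.
have [_ sE] := Dm_seg_def h8.
exists (lsubmx (lsubmx tau) ord0 ord0).
have tauE : tau = lsubmx (lsubmx tau) ord0 ord0 *: fL (real_pt q).
  move: tau_s; rewrite sE tk rsub0 subr0 => /eqP; rewrite subr_eq0 => /eqP w.
  rewrite /seg tk lsub0 rsub0 row_iz in w.
  rewrite -[LHS]hsubmxK tk /fL scale_row_mx scaler0; congr row_mx.
  rewrite -[LHS]hsubmxK w /lam scale_row_mx; congr row_mx.
  by apply/rowP => j; rewrite !mxE !ord1 eqxx mulr1.
by rewrite -XTh {1}tauE -scalemxAl /push tE.
Qed.
End Generator.

(** * Iterated brackets at the origin *)

Section Brackets.
Variable R : realType.
Local Notation C := R[i].

Lemma hasD_scale n m (f : 'rV[C]_n -> C) (F : 'rV[C]_n -> 'rV[C]_m) p d A :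
  hasder f p d -> hasD F p A -> hasD (fun x => f x *: F x) p (d *m F p + f p *: A).
Proof.
move=> df dF k; have := hasderM df (dF k).
have -> : col k (d *m F p + f p *: A) = F p ord0 k *: d + f p *: col k A.
  by apply/colP => j; rewrite !mxE big_ord1 mulrC.
by apply: eq_hasder => x; rewrite [RHS]mxE.
Qed.

Lemma holv_br_near n (X Z Z' : 'rV[C]_n -> 'rV[C]_n) : holv Z ->
  near0 (fun t => Z t = Z' t) -> near0 (fun t => br X Z' t = br X Z t).
Proof.
by move=> hZ e; apply: near0S2 e (near0_Dm hZ e) => t et dt; rewrite /br dt et.
Qed.

Variables n k : nat.
Local Notation N := ((n + k) + (n + k))%N.

(** Constant components do not contribute to brackets. *)
Lemma br_shape (f a g : 'rV[C]_N -> 'rV[C]_k) (e e0 e1 : 'rV[C]_n) :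
  holv f -> holv a -> holv g ->
  let x t := row_mx (row_mx e (f t)) 0 in
  let y t := row_mx (row_mx e0 (a t)) (row_mx e1 (g t)) in
  near0 (fun t => br x y t = row_mx (row_mx 0 (x t *m Dm a t - y t *m Dm f t))
                                    (row_mx 0 (x t *m Dm g t))).
Proof.
move=> hf ha hg x y.
apply: near0S3 (holv_hasD hf) (holv_hasD ha) (holv_hasD hg) => t df da dg.
have dx := hasD_row (hasD_row (hasD_const e t) df) (hasD_const (0 : 'rV[C]_(n + k)) t).
have dy := hasD_row (hasD_row (hasD_const e0 t) da) (hasD_row (hasD_const e1 t) dg).
rewrite /br (DmE dx) (DmE dy) !mul_mx_row !mulmx0 opp_row_mx add_row_mx opp_row_mx add_row_mx.
by rewrite !oppr0 !addr0.
Qed.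
End Brackets.

Lemma row4_mul (K : nzRingType) n (x0 x1 x2 x3 : 'rV[K]_n) a b :
  (\row_(k < 4) [:: 0; 0; a; b]`_k) *m (\matrix_(k < 4) tnth [tuple x0; x1; x2; x3] k)
  = a *: x2 + b *: x3.
Proof.
rewrite mulmx_sum_row !big_ord_recl big_ord0 !rowK ![(\row__ _) _ _]mxE.
by rewrite /= !scale0r !add0r addr0.
Qed.

Section Independence.
Variable R : realType.
Local Notation C := R[i].
Local Notation i := ('i%C : C).
Implicit Types (t : 'rV[C]_((1 + 2) + (1 + 2))) (m : 'rV[C]_(1 + 1 + 2)).

Variables (M : set 'rV[C]_(1 + 2)) (Psi Phi : 'rV[C]_(1 + 2) -> 'rV[C]_(1 + 2)).
Hypotheses (hPsi : holv Psi) (hPhi : holv Phi) (Psi0 : Psi 0 = 0) (Phi0 : Phi 0 = 0).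
Hypotheses (PhiK : near0 (fun q => Phi (Psi q) = q)) (PsiK : near0 (fun c => Psi (Phi c) = c)).
Variable G : 'rV[C]_(1 + 1 + 2) -> 'rV[C]_2.
Hypotheses (hG : holv G) (symG : near0 (fun m => G (swap4 m) = cj (G m))).
Hypothesis hM : near0 (fun q => M (Psi q) <-> graph_def G (row_mx q (cj q)) = 0).
Variables Y E : 'rV[C]_(1 + 1 + 2) -> 'rV[C]_2.
Hypotheses (hY : holv Y) (Y0 : Y 0 = 0).
Hypothesis segE : near0 (fun t => graph_def G t = 0 <-> seg_def Y t = 0).
Hypotheses (hE : holv E) (YE : near0 (fun m => Y m = zz m *: E m)).
Hypothesis EG : near0 (fun m => E m = (2 * i) *: G (row_mx (lsubmx m) (rsubmx m + 2^-1 *: Y m))).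

(** [ff] and [gg] are the components of [fL] along [w] and of [fL'] along [om]. *)
Let f1 m : 'rV[C]_2 := row iz (Dm Y m).
Let ff t := f1 (seg t).
Let gg t := starv ff (row_mx (rsubmx t) (lsubmx t)).

Lemma fL'E t : fL' Y t = row_mx 0 (row_mx 1%:M (gg t)).
Proof.
rewrite /fL' /gg /starv; move: (cj (row_mx _ _)) => x.
rewrite /lam cj_row; congr row_mx; congr row_mx.
by apply/matrixP => a b; rewrite !mxE !ord1 eqxx rmorph1.
Qed.

Lemma holv_f1 : holv f1.
Proof. by move=> j; apply: eq_hol (holv_Dm hY iz j) => m; rewrite /f1 [RHS]mxE. Qed.

Lemma holv_ff : holv ff.
Proof. exact: holv_comp holv_f1 (@holv_seg R) (@seg0 R). Qed.

Lemma holv_gg : holv gg.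
Proof. by have h := holv_star holv_ff; rewrite /gg; holt; rewrite lsub0 rsub0 row_mx0. Qed.

Let e0 : 'rV[C]_((1 + 2) + (1 + 2)) := row_mx (row_mx 1%:M 0) 0.
Let kk (s : 'rV[C]_1) := (- (2 * i)) *: G (row_mx (row_mx s 0) 0).

(** Leibniz' rule for [Y = z ze E]. *)
Lemma f1E : near0 (fun m => f1 m = rsubmx (lsubmx m) ord0 ord0 *: E m + zz m *: row iz (Dm E m)).
Proof.
have /near0S3 := near0_shift YE; apply; [|exact: holv_hasD hE|exact: near0W (fun=> I)].
move=> m ye dE _.
have d1 : hasder (@zz R) m (rsubmx (lsubmx m) ord0 ord0 *: delta_mx iz ord0
   + lsubmx (lsubmx m) ord0 ord0 *: delta_mx (lshift 2 (rshift 1 ord0)) ord0).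
  have c1 := hasder_coord iz m; have c2 := hasder_coord (lshift 2 (rshift 1 ord0)) m.
  have := hasderM c1 c2; rewrite /zz !mxE /iz.
  by apply: eq_hasder => x; rewrite !mxE.
have d := hasD_scale d1 dE.
have /hasD_ext/(_ d) {}d : near0 (fun v => zz (m + v) *: E (m + v) = Y (m + v)).
  by apply: near0S ye => v ->.
rewrite /f1 (DmE d); apply/rowP => j.
rewrite !mxE big_ord1 !mxE !eqxx /iz (inj_eq (@lshift_inj _ _)) eq_lrshift.
by rewrite mulr1 mulr0 addr0.
Qed.

Let line_to0 : to0 (fun s : 'rV[C]_1 => s *m e0).
Proof. by apply: holv_to0; [holt; exact: hol_const|rewrite mul0mx]. Qed.

Let lineE (s : 'rV[C]_1) : s *m e0 = row_mx (row_mx s 0) 0.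
Proof. by rewrite /e0 !mul_mx_row mulmx1 !mulmx0. Qed.

(** On the complex line [ze = w = om = 0], the coefficient of the conjugate field is
    [- 2 i z G (z, 0, 0)]. *)
Lemma gg_line : near0 (fun s : 'rV[C]_1 => gg (s *m e0) = s ord0 ord0 *: kk s).
Proof.
pose l (s : 'rV[C]_1) : 'rV[C]_(1 + 1 + 2) := row_mx (row_mx 0 s) 0.
have l0 : to0 l by apply: holv_to0; [rewrite /l; holt|rewrite /l !row_mx0].
have z s : zz (l s) = 0 by rewrite /zz /l !row_mxKl mxE mul0r.
apply: near0S (near0_cj (near0_comp l0 (filterI f1E (filterI YE (filterI EG symG))))).
move=> s [h1 [h2 [h3 h4]]].
have -> : gg (s *m e0) = cj (f1 (l (cj s))).
  rewrite /gg lineE !(row_mxKl, row_mxKr) /starv /ff; congr (cj (f1 _)).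
  by rewrite !cj_row /seg !(row_mxKl, row_mxKr) !cj0 lsub0.
rewrite h1 z scale0r addr0 h3 h2 z scale0r scaler0 addr0 !cjZ hsubmxK -h4.
rewrite /l row_mxKl row_mxKr mxE conjcK; congr (_ *: _); rewrite /kk.
rewrite conjM conj_i mulrN conjc_nat; congr (_ *: G _).
by rewrite /swap4 /l !(row_mxKl, row_mxKr) !cj0 cjK.
Qed.

(** The component along [om] of the bracket of [fL] and [fL']. *)
Let bb t := fL Y t *m Dm gg t.

Lemma holv_bb : holv bb.
Proof. exact: holv_mulmx (holv_fL hY) (holv_Dm holv_gg). Qed.

Lemma kk_holv : holv kk.
Proof.
rewrite /kk; apply: holvZ; first exact: hol_const.
by holt; rewrite !row_mx0.
Qed.

Lemma bb_line : near0 (fun s => bb (s *m e0) = kk s + s ord0 ord0 *: row ord0 (Dm kk s)).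
Proof.
have l1 : to0 (fun s : 'rV[C]_1 => row_mx (row_mx s 0) 0 : 'rV[C]_(1 + 1 + 2)).
  by apply: holv_to0; [holt|rewrite !row_mx0].
apply: near0S (filterI (near0_comp line_to0 (holv_hasD holv_gg))
  (filterI (near0_shift gg_line) (filterI (near0_comp l1 f1E) (holv_hasD kk_holv)))).
move=> s [dg [gl [fl dk]]].
have d1 := hasD_scale (hasder_coord ord0 s) dk.
have := hasD_comp (hasD_lin e0 s) dg.
have /hasD_uniq h : hasD (fun s => gg (s *m e0)) s
    (delta_mx ord0 ord0 *m kk s + s ord0 ord0 *: Dm kk s).
  by apply: hasD_ext d1; apply: near0S gl => v ->.
move=> /h; rewrite /bb => e.
have -> : fL Y (s *m e0) = e0.
  rewrite /fL /lam /e0 lineE; congr row_mx; congr row_mx.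
  have -> : row iz (Dm Y (seg (row_mx (row_mx s 0) 0))) = f1 (row_mx (row_mx s 0) 0).
    by rewrite /f1 /seg !(row_mxKl, row_mxKr) lsub0 rsub0.
  by rewrite fl /zz !(row_mxKl, row_mxKr) !mxE mulr0 !scale0r addr0.
rewrite -e; apply/rowP => j; rewrite !mxE big_ord1 !mxE eqxx mul1r.
by [].
Qed.

Lemma bb0 : bb 0 = - (2 * i) *: G 0.
Proof.
have := near0_at0 bb_line; rewrite mul0mx => ->.
by rewrite mxE scale0r addr0 /kk !row_mx0.
Qed.

(** The coefficient of the first bracket along that line is the derivative of
    [- 2 i z G (z, 0, 0)]; its own derivative at the origin is twice that of [- 2 i G]. *)
Lemma Dm_bb0 : fL Y 0 *m Dm bb 0 = - (4 * i) *: row iz (Dm G 0).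
Proof.
have f0 : fL Y 0 = e0.
  rewrite /fL /lam /e0; congr row_mx; congr row_mx; rewrite seg0.
  by have := near0_at0 f1E; rewrite /f1 /zz lsub0 rsub0 !mxE mul0r !scale0r addr0.
have l1 : hasD (fun s : 'rV[C]_1 => row_mx (row_mx s 0) 0 : 'rV[C]_(1 + 1 + 2)) 0
    (row_mx (row_mx 1%:M 0) 0).
  exact: hasD_row (hasD_row (hasD_id _) (hasD_const _ _)) (hasD_const _ _).
have dk : hasD kk 0 (- (2 * i) *: (row_mx (row_mx 1%:M 0) 0 *m Dm G 0)).
  apply: hasDZ; apply: hasD_comp l1 _; rewrite !row_mx0.
  exact: near0_at0 (holv_hasD hG).
have dr : holv (fun s => row ord0 (Dm kk s)).
  by move=> j; apply: eq_hol (holv_Dm kk_holv ord0 j) => s; rewrite [RHS]mxE.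
have d1 := hasDD (near0_at0 (holv_hasD kk_holv))
  (hasD_scale (hasder_coord ord0 (0 : 'rV[C]_1)) (near0_at0 (holv_hasD dr))).
have d2 := near0_at0 (holv_hasD holv_bb).
rewrite -(mul0mx _ e0) in d2.
have := hasD_comp (hasD_lin e0 (0 : 'rV[C]_1)) d2.
have /hasD_uniq h : hasD (fun s : 'rV[C]_1 => bb (s *m e0)) 0
    (Dm kk 0 + (delta_mx ord0 ord0 *m row ord0 (Dm kk 0)
      + (0 : 'rV[C]_1) ord0 ord0 *: Dm (fun s : 'rV[C]_1 => row ord0 (Dm kk s)) 0)).
  by apply: hasD_ext d1; apply: near0S bb_line => v; rewrite !add0r => ->.
move=> /h; rewrite f0 mul0mx => <-.
rewrite (DmE dk) row_iz mxE eqxx scale1r; apply/rowP => j.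
rewrite !mxE big_ord1 !mxE !eqxx /=; ring.
Qed.

Let L (p : 'rV[R]_((1 + 2) + (1 + 2))) := push Psi Phi (fL Y) (rc p).

(** Near the origin [T10_fiber] applies and the components are analytic. *)
Lemma generator : M 0 -> exists W : set 'rV[R]_((1 + 2) + (1 + 2)), [/\ W 0, open W & T10_generator (realification M) W L].
Proof.
move=> M0.
have hL := holv_push hPsi hPhi Phi0 (holv_fL hY).
pose part (b : bool) j := fun P => (if b then 1 else - i) * push Psi Phi (fL Y) P ord0 j.
have hp b j : hol (part b j) by apply: holM; [exact: hol_const|exact: hL].
have near_an b j : \forall p \near (0 : 'rV[R]_((1 + 2) + (1 + 2))),
    analytic_at (fun x => complex.Re (part b j (rc x))) p.
  have [r r0 h] := hol_analytic (hp b j).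
  apply/nbhs_ballP; exists r => // p; rewrite -ball_normE /= sub0r normrN => pr.
  exact: h (ltW pr).
have an b : \forall p \near (0 : 'rV[R]_((1 + 2) + (1 + 2))),
    forall j, analytic_at (fun x => complex.Re (part b j (rc x))) p.
  exact: filter_forall (near_an b).
have fib := T10_fiber hPsi hPhi Phi0 PsiK hG symG hM hY Y0 segE.
have W0 := filterI (an true) (filterI (an false) fib).
exists (interior (fun p => (forall j, analytic_at (fun x => complex.Re (part true j (rc x))) p) /\
  (forall j, analytic_at (fun x => complex.Re (part false j (rc x))) p) /\
  (realification M p -> T10 (realification M) p (L p) /\
   forall X, T10 (realification M) p X -> exists c : C, X = c *: L p))).
split; [exact: W0|exact: open_interior|split; first exact: open_interior].
- move=> p /interior_subset[h _] j.
  suff -> : (fun x => field_re L x ord0 j) = (fun x => complex.Re (part true j (rc x))) by exact: h.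
  by apply/funext => x; rewrite /field_re mxE /part mul1r.
- move=> p /interior_subset[_ [h _]] j.
  suff -> : (fun x => field_im L x ord0 j) = (fun x => complex.Re (part false j (rc x))) by exact: h.
  apply/funext => x; rewrite /field_im mxE /part /L.
  by case: (push _ _ _ _ _ _) => u v /=; ring.
- by move=> p [Mp /interior_subset[_ [_ h]]]; exact: h.
Qed.

(** A relation between [G 0] and [dG / dz 0] gives a combination of the two brackets whose
    component along the conjugate variables vanishes. This combination is tangent, and a
    tangent vector at the origin has equal components along [w] and along its conjugate:
    it is zero, whereas the four fields are independent. *)
Lemma class_II_independent : M 0 -> general_class_II (realification M) ->
  forall al be : C, al *: G 0 + be *: row iz (Dm G 0) = 0 -> al = 0 /\ be = 0.
Proof.
move=> M0 cls al be dep.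
have [W [W0 oW gen]] := generator M0.
have Mr0 : realification M 0.
  by rewrite /realification /= to_complexE rc0 lsub0 rsub0 scaler0 addr0.
have [free span] := cls W L gen 0 (conj Mr0 W0).
set F := \matrix_(_ < 4) _ in free span.
pose X := push Psi Phi (fL Y); pose X' := push Psi Phi (fL' Y).
have hx := holv_fL hY; have hx' := holv_fL' hY.
have hX : holv X := holv_push hPsi hPhi Phi0 hx.
have hX' : holv X' := holv_push hPsi hPhi Phi0 hx'.
have hTh := holv_Th hPsi; have T0 := Th0 Psi0.
(* the conjugate field *)
have LX : \forall p \near (0 : 'rV[R]_((1 + 2) + (1 + 2))), field_conj L p = X' (rc p).
  have cT : to0 (fun P : 'rV[C]_((1 + 2) + (1 + 2)) => Phi (lsubmx P + i *: rsubmx P)).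
    apply: holv_to0; last by rewrite lsub0 rsub0 scaler0 addr0.
    by holt; rewrite lsub0 rsub0 scaler0 addr0.
  apply: filterS (near0_real (near0_comp cT (holv_hasD hPsi))) => p.
  rewrite -to_complexE => dq.
  by have [_ e] := @push_real R Psi Phi Y p _ _ dq (Ti_rc Phi p) erefl; rewrite /X' e.
have dX := near0_real (holv_hasD hX); have dX' := near0_real (holv_hasD hX').
have brL : \forall p \near (0 : 'rV[R]_((1 + 2) + (1 + 2))),
    clie L (field_conj L) p = br X X' (rc p).
  have LX2 := near_join LX.
  apply: filterS3 LX2 dX dX' => p e d d'.
  by apply: clie_br d d' => //; by apply: filterE => x.
have brr : clie L (clie L (field_conj L)) 0 = br X (br X X') 0.
  rewrite -[X in br _ _ X](rc0 R 1); apply: clie_br => //.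
  - by apply: filterE => x.
  - exact: nbhs_singleton dX.
  - rewrite rc0; exact: near0_at0 (holv_hasD (holv_br hX hX')).
(* the four fields at the origin, pulled back *)
have p1 := push_Th PhiK (fL Y).
have p2 := push_Th PhiK (fL' Y).
have p3 := br_push hTh T0 hX hX' hx hx' p1 p2.
have p4 := br_push hTh T0 hX (holv_br hX hX') hx (holv_br hx hx') p1 p3.
have p30 := near0_at0 p3; have p40 := near0_at0 p4; rewrite T0 in p30 p40.
pose aa t := fL Y t *m Dm (fun=> 0 : 'rV[C]_2) t - fL' Y t *m Dm ff t.
have haa : holv aa.
  apply: holvB; apply: holv_mulmx => // a b; first exact: (holv_Dm (holv_const _ _)).
  exact: holv_Dm holv_ff _ _.
have n3E : near0 (fun t => br (fL Y) (fL' Y) t = row_mx (row_mx 0 (aa t)) (row_mx 0 (bb t))).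
  have := @br_shape R 1 2 ff (fun=> 0) gg 1%:M 0 1%:M holv_ff (holv_const _ _) holv_gg.
  have -> : (fun t => row_mx (row_mx (0 : 'rV[C]_1) 0) (row_mx 1%:M (gg t))) = fL' Y.
    by apply/funext => t; rewrite fL'E row_mx0.
  by apply: near0S => t ->; rewrite /aa /bb.
have n40 : exists w, br (fL Y) (br (fL Y) (fL' Y)) 0
    = row_mx (row_mx 0 w) (row_mx 0 (fL Y 0 *m Dm bb 0)).
  have h3 := holv_br hx hx'.
  have e1 := near0_at0 (holv_br_near (fL Y) h3 n3E).
  have e2 := near0_at0 (@br_shape R 1 2 ff aa bb 1%:M 0 0 holv_ff haa holv_bb).
  by eexists; rewrite -e1; exact: e2.
have n30 := near0_at0 n3E; case: n40 => w n40.
set N3 := br (fL Y) (fL' Y) 0 in n30 p30; set N4 := br (fL Y) (br (fL Y) (fL' Y)) 0 in n40 p40.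
pose Nv := (2 * al) *: N3 + be *: N4.
have lN : lsubmx (lsubmx Nv) = 0.
  by rewrite /Nv n30 n40 !scale_row_mx !add_row_mx !row_mxKl !scaler0 addr0.
have rN : rsubmx Nv = 0.
  rewrite /Nv n30 n40 bb0 Dm_bb0 !scale_row_mx !add_row_mx !row_mxKr !scaler0 addr0.
  have -> : (2 * al) *: (- (2 * i) *: G 0) + be *: (- (4 * i) *: row iz (Dm G 0))
    = - (4 * i) *: (al *: G 0 + be *: row iz (Dm G 0)).
    by rewrite scalerDr !scalerA; congr (_ *: _ + _ *: _); ring.
  by rewrite dep scaler0 row_mx0.
pose u := \row_(k < 4) [:: 0; 0; 2 * al; be]`_k.
have uF : u *m F = Nv *m Dm (Th Psi) 0.
  have -> : Nv *m Dm (Th Psi) 0 = (2 * al) *: br X X' 0 + be *: br X (br X X') 0.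
    by rewrite p30 p40 2!scalemxAl -mulmxDl.
  have -> : br X X' 0 = clie L (field_conj L) 0.
    by have := nbhs_singleton brL; rewrite rc0.
  by rewrite -brr; exact: row4_mul.
(* tangency forces the first components to agree with the last ones *)
have N0 : Nv = 0.
  have [tr ti] : ctangent (realification M) 0 (u *m F) by apply/span/submxMl.
  have aff := nbhs_singleton (tangent_annihilated hPhi Phi0 PsiK hM hY segE) Mr0.
  have ar := aff _ tr; have ai := aff _ ti.
  rewrite rc0 Ti0// in ar ai.
  have XE (x : 'rV[C]_((1 + 2) + (1 + 2))) : x = rc (ReM x) + i *: rc (ImM x).
    by apply/rowP => j; rewrite !mxE -complexE.
  have := XE (u *m F); set D := _ *m Dm (seg_def Y) 0 in ar ai.
  move/(congr1 (fun x => x *m D)); rewrite mulmxDl -scalemxAl ar ai scaler0 addr0 uF /D.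
  have dTh := near0_at0 (holv_hasD hTh); have dTi := near0_at0 (holv_hasD (holv_Ti hPhi)).
  rewrite -{1}T0 in dTi.
  have /hasD_uniq h := hasD_comp dTh dTi.
  have {}h : Dm (Th Psi) 0 *m Dm (Ti Phi) 0 = 1%:M.
    apply: h; apply: hasD_ext (hasD_id 0); apply: near0S (ThK PhiK) => v.
    by rewrite add0r.
  rewrite mulmxA -(mulmxA Nv) h mulmx1.
  have dY := near0_at0 (holv_hasD hY); rewrite -seg0 in dY.
  have [_ ->] := Dm_seg_def dY.
  have -> : seg Nv = 0 by rewrite /seg lN rN lsub0 rsub0 !row_mx0.
  rewrite mul0mx subr0 rN rsub0 subr0 => wN.
  by rewrite -[LHS]hsubmxK rN -[lsubmx Nv]hsubmxK lN wN !row_mx0.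
have u0 : u = 0.
  by apply/eqP; rewrite -(mulmx_free_eq0 _ free) uF N0 mul0mx.
have /rowP/(_ (lift ord0 (lift ord0 ord0))) := u0; rewrite !mxE /= => /eqP.
rewrite mulf_eq0 pnatr_eq0 /= => /eqP a0.
by have /rowP/(_ ord_max) := u0; rewrite !mxE /= => ->.
Qed.
End Independence.

(** * Division by z zb *)

Section Division.
Variable R : realType.
Local Notation C := R[i].
Local Notation i := ('i%C : C).
Implicit Types m : 'rV[C]_(1 + 1 + 2).

Lemma to0_zero_on n (s : seq 'I_n) : to0 (zero_on s : 'rV[C]_n -> 'rV[C]_n).
Proof.
move=> e e0; exists e; split=> // x xe j; rewrite mxE; case: ifP => _; last exact: xe.
by apply: le_trans (xe j); rewrite nrm0 nrm_ge0.
Qed.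

(** If [f = x_k h] vanishes for [x_j = 0], then [h] may be replaced by its difference with its
    value for [x_j = 0], and this difference is divisible by [x_j]. *)
Lemma hol_divide n (f : 'rV[C]_n -> C) j k : j != k -> hol f ->
  near0 (fun x => f (zero_on [:: j] x) = 0) -> near0 (fun x => f (zero_on [:: k] x) = 0) ->
  exists2 g, hol g & near0 (fun x => f x = x ord0 j * x ord0 k * g x).
Proof.
move=> jk [r [B [r0 fr]]] fj fk.
have [h [hr hE]] := rep_had_seq r0 fr (isT : uniq [:: k]).
have [g [gr gE]] := rep_had_seq r0 (hr k) (isT : uniq [:: j]).
exists (g j); first by exists r, (B / r / r).
have hk : near0 (fun x => f x = x ord0 k * h k x).
  apply: near0S2 fk (near0_inD n r0) => x f0 /hE ->.
  by rewrite f0 add0r big_seq1.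
apply: near0S (filterI hk (filterI fj (filterI (near0_comp (to0_zero_on [:: j]) hk) (near0_inD n r0)))).
move=> x [e1 [e2 [e3 /gE e4]]].
rewrite e1 e4 big_seq1 mulrDr.
have -> : x ord0 k * h k (zero_on [:: j] x) = 0.
  rewrite -e2 e3; congr (_ * _); rewrite mxE mem_seq1; case: eqP => // kj.
  by rewrite kj eqxx in jk.
by rewrite add0r; ring.
Qed.

Let kz : 'I_(1 + 1 + 2) := lshift 2 (lshift 1 ord0).
Let kc : 'I_(1 + 1 + 2) := lshift 2 (rshift 1 ord0).

Lemma swap4K m : swap4 (swap4 m) = m.
Proof. by rewrite /swap4 !(row_mxKl, row_mxKr) !cjK !hsubmxK. Qed.

(** The quotient is averaged with its conjugate to make the reality condition hold
    everywhere and not only near the origin. *)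
Lemma divide_graph (F : 'rV[C]_(1 + 1 + 2) -> 'rV[C]_2) : holv F ->
  near0 (fun x : 'rV[C]_(1 + 2) => F (row_mx (row_mx (lsubmx x) 0) (rsubmx x)) = 0) ->
  near0 (fun m => F (swap4 m) = cj (F m)) ->
  exists G, [/\ holv G, near0 (fun m => F m = graphF G m) & forall m, G (swap4 m) = cj (G m)].
Proof.
move=> hF F0 Fs.
have zE m : zz m = m ord0 kz * m ord0 kc by rewrite /zz !mxE.
have zc m : zero_on [:: kc] m = row_mx (row_mx (lsubmx (lsubmx m)) 0) (rsubmx m).
  apply/rowP => j; rewrite mxE mem_seq1 /kc.
  case: (split_ordP j) => a ->.
    rewrite (inj_eq (@lshift_inj _ _)) row_mxEl; case: (split_ordP a) => b ->.
      by rewrite eq_lrshift row_mxEl !mxE.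
    by rewrite !ord1 eqxx row_mxEr mxE.
  by rewrite eq_rlshift row_mxEr mxE.
have zk m : zero_on [:: kz] m = row_mx (row_mx 0 (rsubmx (lsubmx m))) (rsubmx m).
  apply/rowP => j; rewrite mxE mem_seq1 /kz.
  case: (split_ordP j) => a ->.
    rewrite (inj_eq (@lshift_inj _ _)) row_mxEl; case: (split_ordP a) => b ->.
      by rewrite !ord1 eqxx row_mxEl mxE.
    by rewrite eq_rlshift row_mxEr !mxE.
  by rewrite eq_rlshift row_mxEr mxE.
have t1 : to0 (fun m => row_mx (lsubmx (lsubmx m)) (rsubmx m) : 'rV[C]_(1 + 2)).
  by apply: holv_to0; [holt|rewrite !(lsub0, rsub0, row_mx0)].
have Fc : near0 (fun m => F (zero_on [:: kc] m) = 0).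
  apply: near0S (near0_comp t1 F0) => m; rewrite zc !(row_mxKl, row_mxKr).
  by [].
have t2 : to0 (fun m => row_mx (rsubmx (lsubmx m)) (rsubmx m) : 'rV[C]_(1 + 2)).
  by apply: holv_to0; [holt|rewrite !(lsub0, rsub0, row_mx0)].
have Fk : near0 (fun m => F (zero_on [:: kz] m) = 0).
  apply: near0S2 (near0_cj (near0_comp t2 F0)) (near0_comp (to0_zero_on [:: kz]) Fs) => m e1 e2.
  apply: (can_inj (@cjK R _ _)); rewrite -e2 cj0 -e1 zk.
  by rewrite /swap4 !(row_mxKl, row_mxKr) cj0 !cj_rsub !cj_lsub.
have /fin_all_exists2[g gh gE] : forall a : 'I_2, exists2 g, hol g &
    near0 (fun m => F m ord0 a = m ord0 kz * m ord0 kc * g m).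
  by move=> a; apply: hol_divide (hF a) _ _ => //; [apply: near0S Fk => m ->|apply: near0S Fc => m ->];
    rewrite mxE.
pose G m : 'rV[C]_2 := \row_a g a m.
have hG : holv G by move=> a; apply: eq_hol (gh a) => m; rewrite /G mxE.
have FG : near0 (fun m => F m = zz m *: G m).
  apply: near0S (@filter_forall _ 'I_2 _ (@near0 R _) _ gE) => m e.
  by apply/rowP => a; rewrite e !mxE -zE.
pose G' m := 2^-1 *: (G m + starv G (row_mx (row_mx (rsubmx (lsubmx m)) (lsubmx (lsubmx m))) (rsubmx m))).
have G'E m : G' m = 2^-1 *: (G m + cj (G (swap4 m))).
  by rewrite /G' /starv /swap4 !cj_row.
have ts : to0 (@swap4 R).
  move=> e e0; exists e; split=> // m me; rewrite /swap4.
  by apply: inD_row; [apply: inD_row|]; apply: inD_cj; do ?apply: inD_lsub; do ?apply: inD_rsub;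
    do ?apply: inD_lsub.
exists G'; split.
- have h := holv_star hG; rewrite /G'; holt.
  by rewrite !(lsub0, rsub0, row_mx0).
- apply: near0S3 FG (near0_comp ts FG) Fs => m e1 e2 e3.
  have e4 : F m = zz m *: cj (G (swap4 m)).
    rewrite -[F m]cjK -e3 e2 cjZ; congr (_ *: _).
    by rewrite /zz /swap4 !(row_mxKl, row_mxKr) !cjE conjM !conjcK mulrC.
  rewrite /graphF G'E scalerA mulrC -scalerA scalerDr -e1 -e4.
  by rewrite scalerDr addhalf.
- move=> m; rewrite !G'E swap4K cjZ cjD cjK conjc_inv conjc_nat.
  by rewrite addrC.
Qed.
End Division.

(** * Linear normalization at a CR-generic point *)

Section LinearNormalization.
Variable R : realType.
Local Notation C := R[i].
Local Notation i := ('i%C : C).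

Lemma near0_of_real n m (P : 'rV[R]_n -> Prop) (F : 'rV[C]_m -> 'rV[C]_n) :
  (\forall x \near (0 : 'rV[R]_n), P x) -> to0 F ->
  near0 (fun q => forall p, F q = rc p -> P p).
Proof.
move=> /nbhs_ballP[r /= r0 h] F0.
have r20 : 0 < r / 2 by rewrite divr_gt0.
apply: near0S (F0 _ r20) => q hq p e; apply: h.
rewrite -ball_normE /= sub0r normrN.
apply: (@le_lt_trans _ _ (r / 2)); last by rewrite ltr_pdivrMr// mulr_natr mulr2n ltrDl.
apply: mx_norm_le => [|a b]; first exact: ltW.
by have := hq b; rewrite e rcE nrm_real (ord1 a).
Qed.

Lemma near0_of_real1 n (P : 'rV[R]_n -> Prop) (g : R -> 'rV[R]_n) v :
  (\forall x \near (0 : 'rV[R]_n), P x) -> g 0 = 0 -> is_derive (0 : R) (1 : R) g v ->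
  \forall t \near (0 : R), P (g t).
Proof.
move=> hP g0 dg.
have gd : differentiable g 0 by apply/derivable1_diffP; case: dg.
have cg : {for 0, continuous g} by exact: differentiable_continuous.
by apply: cg; rewrite g0.
Qed.

(** The rows of [N] are a vector of the kernel of [mu] and a multiple of a left inverse of [mu]. *)
Lemma complete_coordinates (mu : 'M[C]_(1 + 2, 2)) c : c != 0 -> row_full mu ->
  exists2 N : 'M[C]_(1 + 2), N \in unitmx & N *m mu = c *: col_mx 0 1%:M.
Proof.
move=> c0 /row_fullP[B Bmu].
have k0 : kermx mu != 0.
  rewrite kermx_eq0 /row_free; apply/eqP => e.
  by have := rank_leq_col mu; rewrite e.
pose a := nz_row (kermx mu).
have a0 : a != 0 by rewrite nz_row_eq0.
have am : a *m mu = 0 by apply/sub_kermxP/nz_row_sub.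
have Nm : col_mx a (c *: B) *m mu = c *: col_mx 0 1%:M.
  by rewrite mul_col_mx am -scalemxAl Bmu scale_col_mx scaler0.
exists (col_mx a (c *: B)) => //.
rewrite -row_free_unit -kermx_eq0; apply/rowV0P => x /sub_kermxP.
rewrite -[x]hsubmxK; move: (lsubmx x) (rsubmx x) => {x} l r xN.
have := congr1 (fun y => y *m mu) xN; rewrite -mulmxA Nm -scalemxAr mul_row_col.
rewrite mulmx0 mulmx1 add0r mul0mx => /eqP; rewrite scaler_eq0 (negPf c0) /= => /eqP r0.
move: xN; rewrite r0 mul_row_col mul0mx addr0 [l]mx11_scalar mul_scalar_mx.
move/eqP; rewrite scaler_eq0 (negPf a0) orbF => /eqP ->.
by rewrite raddf0 row_mx0.
Qed.

Lemma complexify (rho : 'rV[R]_((1 + 2) + (1 + 2)) -> 'rV[R]_2) :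
  (forall j, analytic_at (fun x => rho x ord0 j) 0) ->
  exists Rh : 'rV[C]_((1 + 2) + (1 + 2)) -> 'rV[C]_2, [/\ holv Rh,
    near0 (fun x => starv Rh x = Rh x) &
    \forall x \near (0 : 'rV[R]_((1 + 2) + (1 + 2))), Rh (rc x) = rc (rho x)].
Proof.
move=> an.
have /fin_all_exists[g gP] := fun j => analytic_complexify (an j).
exists (fun x => \row_j g j x); split.
- by move=> j; have [h _ _] := gP j; apply: eq_hol h => x; rewrite mxE.
- have gs j : near0 (fun x => star (g j) x = g j x) by have [] := gP j.
  apply: near0S (@filter_forall _ 'I_2 _ (@near0 R _) _ gs) => x e; apply/rowP => j.
  by rewrite !mxE -e.
- have gr (j : 'I_2) : \forall x \near (0 : 'rV[R]_((1 + 2) + (1 + 2))), g j (rc x) = (rho x ord0 j)%:C.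
    have [_ _ [r r0 h]] := gP j; apply/nbhs_ballP; exists r => // x.
    by rewrite -ball_normE /= sub0r normrN; exact: h.
  have gr' : \forall x \near (0 : 'rV[R]_((1 + 2) + (1 + 2))),
      forall j : 'I_2, g j (rc x) = (rho x ord0 j)%:C by exact: filter_forall gr.
  apply: filterS gr' => x e; apply/rowP => j.
  by rewrite !mxE e.
Qed.

Lemma cj_usub m1 m2 n (A : 'M[C]_(m1 + m2, n)) : cj (usubmx A) = usubmx (cj A).
Proof. by apply/matrixP => a b; rewrite !mxE. Qed.

Lemma cj_dsub m1 m2 n (A : 'M[C]_(m1 + m2, n)) : cj (dsubmx A) = dsubmx (cj A).
Proof. by apply/matrixP => a b; rewrite !mxE. Qed.

Lemma cjB m n (A B : 'M[C]_(m, n)) : cj (A - B) = cj A - cj B.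
Proof. by rewrite cjD cjN. Qed.

(** On the left is the C-linear part of the R-linear map [v |-> rc v *m col_mx U D], and [Jst]
    is the multiplication by [i]. *)
Lemma real_part_mul n m (v : 'rV[R]_(n + n)) (U D : 'M[C]_(n, m)) :
  to_complex v *m (2^-1 *: U + c2 R *: D)
  = 2^-1 *: (rc v *m col_mx U D) + c2 R *: (rc (Jst v) *m col_mx U D).
Proof.
rewrite to_complexE /Jst rc_row -[rc v in RHS]hsubmxK !mul_row_col.
have -> : rc (- rsubmx v) = - rsubmx (rc v) by apply/rowP => j; rewrite !mxE rmorphN.
have -> : rc (lsubmx v) = lsubmx (rc v) by apply/rowP => j; rewrite !mxE.
rewrite mulmxDl !mulmxDr -!scalemxAr -!scalemxAl !scalerA mulNmx.
rewrite [_ * i]mulrC [_ * i]mulrC ic2.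
move: (lsubmx _ *m U) (lsubmx _ *m D) (rsubmx _ *m U) (rsubmx _ *m D) => a b c d.
by apply/rowP => j; rewrite !mxE c2E; ring.
Qed.

(** Let [mu] be the C-linear part of the differential at the origin of a defining map. For a
    tangent vector [b], [b mu] is a multiple of the differential of [Jst b]; since every
    vector is the sum of a tangent vector and of the image by [Jst] of a tangent vector, [mu]
    has rank two. The components of [c mu], up to a factor, are the new coordinates [w]: the
    linear part of the equation becomes [v]. *)
Lemma linear_normalization (M : set 'rV[C]_(1 + 2)) :
  @analytic_submanifold R ((1 + 2) + (1 + 2)) 4 (realification M) -> M 0 ->
  CR_generic (realification M) ->
  exists (N : 'M[C]_(1 + 2)) (T : 'rV[C]_((1 + 2) + (1 + 2)) -> 'rV[C]_2),
  [/\ N \in unitmx, holv T, bigOv 2 T,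
    near0 (fun x => T (row_mx (cj (rsubmx x)) (cj (lsubmx x))) = cj (T x)) &
    near0 (fun q => M (q *m N) <-> defS T q (cj q) = 0)].
Proof.
move=> [_ sub] M0 gen.
have M0' : realification M 0.
  by rewrite /realification /= to_complexE rc0 lsub0 rsub0 scaler0 addr0.
have [W [rho [oW W0 an Mrho rk]]] := sub 0 M0'.
have [Rh [hR sR RE]] := complexify (an 0 W0).
have rho0 : rho 0 = 0.
  have : (realification M `&` W) 0 by [].
  by rewrite Mrho => -[].
have R0 : Rh 0 = 0 by have := nbhs_singleton RE; rewrite rho0 !rc0.
have dR := near0_at0 (holv_hasD hR); set A := Dm Rh 0 in dR.
set J := 'J rho 0 in rk.
have AJ : A = rc J.
  have cA : cj A = A.
    have := hasD_star dR; rewrite cj0 => d1.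
    by apply: hasD_uniq dR; apply: hasD_ext d1; apply: near0S sR => v; rewrite add0r.
  have JE : J = ReM A.
    rewrite /J; have := @diff_Re R _ _ Rh rho 0 A; rewrite rc0 => /(_ dR)[//|_ ->//].
    by apply: filterS RE => x ->; rewrite ReM_rc.
  rewrite JE; clearbody A; apply/matrixP => a b; rewrite !mxE.
  move/matrixP/(_ a b): cA; rewrite mxE; case: (A a b) => u v [/= e].
  have -> : v = 0 by lra.
  by [].
have cA : cj A = A by rewrite AJ cj_rc.
clearbody A.
have Mr : \forall x \near (0 : 'rV[R]_((1 + 2) + (1 + 2))),
    realification M x <-> Rh (rc x) = 0.
  apply: filterS2 (open_nbhs_nbhs (conj oW W0)) RE => x Wx ->; split=> [Mx|e].
    have : (realification M `&` W) x by [].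
    by rewrite Mrho => -[_ ->]; rewrite rc0.
  have : [set x | W x /\ rho x = 0] x.
    split=> //; apply/matrixP => a b; move/matrixP/(_ a b): e.
    by rewrite rcE !mxE => -[].
  by rewrite -Mrho => -[].
have tanJ v : tangent (realification M) 0 v -> v *m J = 0.
  move=> [g [g0 gM dg]].
  have near_g := near0_of_real1 Mr g0 dg.
  have : rc v *m A = 0.
    apply: (@tangent_kernel R _ _ Rh A g) => //; first by rewrite g0 rc0.
    by apply: filterS2 gM near_g => t Mt [h _]; exact: h.
  rewrite AJ -rcM => /matrixP e; apply/matrixP => a b.
  by have := e a b; rewrite rcE !mxE => -[].
pose mu : 'M[C]_(1 + 2, 2) := 2^-1 *: usubmx A + c2 R *: dsubmx A.
have muE v : to_complex v *m mu = 2^-1 *: (rc v *m A) + c2 R *: (rc (Jst v) *m A).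
  by rewrite /mu real_part_mul vsubmxK.
have full : row_full mu.
  rewrite -sub1mx; apply/row_subP => k.
  have /row_fullP[B BJ] : row_full J by rewrite /row_full rk.
  have [a [b [ta tb e]]] := gen 0 M0' (row k B).
  have := muE b; rewrite AJ -!rcM (tanJ b tb) rc0 scaler0 add0r.
  have -> : Jst b *m J = row k 1%:M.
    by rewrite -BJ row_mul e mulmxDl (tanJ a ta) add0r.
  move=> h; have -> : row k (1%:M : 'M[C]_2) = (2 * i) *: to_complex b *m mu.
    rewrite -scalemxAl h scalerA mulrC c2K scale1r.
    by apply/rowP => j; rewrite !mxE rmorph_nat.
  exact: submxMl.
have c20 : c2 R != 0 by rewrite /c2 invr_eq0 mulf_neq0 ?pnatr_eq0 ?i_neq0.
have [N uN Nmu] := complete_coordinates c20 full.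
pose Lx (x : 'rV[C]_((1 + 2) + (1 + 2))) : 'rV[C]_((1 + 2) + (1 + 2)) :=
  row_mx (2^-1 *: (lsubmx x *m N + rsubmx x *m cj N)) (c2 R *: (lsubmx x *m N - rsubmx x *m cj N)).
have hL : holv Lx by rewrite /Lx; holt; exact: hol_const.
have L0 : Lx 0 = 0 by rewrite /Lx lsub0 rsub0 !mul0mx subrr addr0 !scaler0 row_mx0.
have LA x : Lx x *m A = c2 R *: (rsubmx (lsubmx x) - rsubmx (rsubmx x)).
  have cmu : cj mu = 2^-1 *: usubmx A - c2 R *: dsubmx A.
    rewrite /mu cjD !cjZ conj_c2 conjc_inv conjc_nat scaleNr.
    by rewrite cj_usub cj_dsub cA.
  have e1 (y : 'rV[C]_(1 + 2)) : y *m N *m mu = c2 R *: rsubmx y.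
    by rewrite -mulmxA Nmu -scalemxAr -[y in LHS]hsubmxK mul_row_col mulmx0 mulmx1 add0r.
  have e2 (y : 'rV[C]_(1 + 2)) : y *m cj N *m cj mu = - c2 R *: rsubmx y.
    rewrite -mulmxA -cjM Nmu cjZ conj_c2 -scalemxAr -[y in LHS]hsubmxK.
    have -> : cj (col_mx 0 1%:M : 'M[C]_(1 + 2, 2)) = col_mx 0 1%:M.
      by rewrite /cj map_col_mx map_mx0 map_mx1.
    by rewrite mul_row_col mulmx0 add0r mulmx1.
  rewrite scalerBr -[_ *: rsubmx (lsubmx x)]e1 -[- (_ *: _)]scaleNr -e2 cmu /mu /Lx.
  move: (lsubmx x *m N) (rsubmx x *m cj N) => a b; rewrite -{1}[A]vsubmxK.
  rewrite mul_row_col !mulmxDr mulmxN -!scalemxAl !mulmxBl !mulmxDl -!scalemxAr.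
  move: (a *m _) (a *m _) (b *m _) (b *m _) => p1 p2 p3 p4.
  by apply/rowP => j; rewrite !mxE; ring.
exists N, (fun x => Rh (Lx x) - c2 R *: (rsubmx (lsubmx x) - rsubmx (rsubmx x))).
split=> //.
- have h := holv_comp hR hL L0; by holt.
- have O2 : bigOv 2 (fun v => Rh v - v *m A).
    move=> j; apply: bigO_ext (dR j); apply: near0W => v.
    by rewrite add0r R0 mulmx_colE !mxE subr0.
  apply: bigOv_ext (bigOv_comp O2 hL L0); apply: near0W => x.
  by rewrite LA.
- apply: near0S (near0_comp (holv_to0 hL L0) sR) => x e.
  rewrite cjB; congr (_ - _); last first.
    by rewrite cjZ cjB conj_c2 !(row_mxKl, row_mxKr) !cj_rsub !cj_lsub scaleNr -scalerN opprB.
  rewrite -[in RHS]e /starv cjK; congr Rh.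
  rewrite /Lx !(row_mxKl, row_mxKr) cj_row !cjZ cjD cjB !cjM cjK conj_c2 conjc_inv conjc_nat.
  by rewrite [X in _ *: X]addrC scaleNr -scalerN opprB.
- have pt : to0 (fun q : 'rV[C]_(1 + 2) => Lx (row_mx q (cj q))).
    move=> e e0; have [r [r0 h]] := holv_to0 hL L0 e0; exists r; split=> // q qr.
    by apply/h/inD_row => //; exact: inD_cj.
  apply: near0S (near0_of_real Mr pt) => q h.
  have e : Lx (row_mx q (cj q)) = rc (row_mx (ReM (q *m N)) (ImM (q *m N))).
    by rewrite rc_row rc_ReM rc_ImM /Lx row_mxKl row_mxKr cjM.
  have := h _ e; rewrite -e /realification /= to_complex_row => ->.
  by rewrite /defS row_mxKl row_mxKr addrC subrK.
Qed.
End LinearNormalization.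

(** * Graphs in normal coordinates *)

Section PreNormalForm.
Variable R : realType.
Local Notation C := R[i].
Local Notation i := ('i%C : C).

(** The coordinates are the composite of [chart X], which is tangent to the identity, and of a
    linear map, hence they are invertible. *)
Lemma pre_normal_form (M : set 'rV[C]_(1 + 2)) :
  @analytic_submanifold R ((1 + 2) + (1 + 2)) 4 (realification M) -> M 0 ->
  CR_generic (realification M) -> general_class_II (realification M) ->
  exists (Psi Phi : 'rV[C]_(1 + 2) -> 'rV[C]_(1 + 2)) (G : 'rV[C]_(1 + 1 + 2) -> 'rV[C]_2),
  [/\ [/\ holv Psi, holv Phi, Psi 0 = 0 & Phi 0 = 0],
    near0 (fun q => Phi (Psi q) = q) /\ near0 (fun c => Psi (Phi c) = c),
    holv G /\ (forall m, G (swap4 m) = cj (G m)),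
    near0 (fun q => M (Psi q) <-> graph_def G (row_mx q (cj q)) = 0) &
    forall al be : C, al *: G 0 + be *: row (iz : 'I_(1 + 1 + 2)) (Dm G 0) = 0 -> al = 0 /\ be = 0].
Proof.
move=> sub M0 gen cls.
have [N [T [uN hT T2 Ts MT]]] := linear_normalization sub M0 gen.
have [X [F [[hX X2] hF XF F0 Fs]]] := normal_coordinates hT T2 Ts.
have [G [hG FG Gs]] := divide_graph hF F0 Fs.
pose Psi q := chart X q *m N.
have X0 : X 0 = 0 := bigOv_at0 X2.
have hc : holv (chart X) by rewrite /chart; holt.
have c0 : chart X 0 = 0 by rewrite /chart X0 lsub0 rsub0 addr0 row_mx0.
have hPsi : holv Psi by rewrite /Psi; holt; exact: hol_const.
have Psi0 : Psi 0 = 0 by rewrite /Psi c0 mul0mx.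
have dPsi : hasD Psi 0 N.
  have d1 : hasD (chart X) 0 1%:M.
    have h1 := hasD_lsub (hasD_id (0 : 'rV[C]_(1 + 2))); have h2 := hasD_rsub (hasD_id (0 : 'rV[C]_(1 + 2))).
    have := hasD_row h1 (hasDD h2 (hasD_bigO2 X2)).
    by rewrite addr0 hsubmxK.
  by have := hasD_comp d1 (hasD_lin N _); rewrite mul1mx.
have [Phi [hPhi Phi0 PhiK PsiK]] := inverse_function hPsi Psi0 dPsi uN.
have hM : near0 (fun q => M (Psi q) <-> graph_def G (row_mx q (cj q)) = 0).
  pose x (q : 'rV[C]_(1 + 2)) : 'rV[C]_(1 + 1 + 2 + 2) :=
    row_mx (mid (row_mx q (cj q))) (c2 R *: (rsubmx q - rsubmx (cj q))).
  have tx : to0 x.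
    pose y (t : 'rV[C]_((1 + 2) + (1 + 2))) : 'rV[C]_(1 + 1 + 2 + 2) :=
      row_mx (mid t) (c2 R *: (rsubmx (lsubmx t) - rsubmx (rsubmx t))).
    have hm := holv_mid R.
    have hy : holv y by rewrite /y; holt.
    have y0 : y 0 = 0 by rewrite /y mid0 !(lsub0, rsub0) subrr scaler0 row_mx0.
    move=> e e0; have [r [r0 h]] := holv_to0 hy y0 e0; exists r; split=> // q qr.
    have := h _ (inD_row qr (inD_cj qr)).
    by rewrite /y row_mxKl row_mxKr.
  have tm : to0 (fun q => lsubmx (x q)).
    by move=> e e0; apply: near0S (tx e e0) => q; exact: inD_lsub.
  apply: near0S3 (near0_comp (holv_to0 hc c0) MT) (near0_comp tx XF) (near0_comp tm FG) => q h1.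
  rewrite /= /x !row_mxKl row_mxKr => h2 h3; rewrite {}h3 in h2.
  rewrite /Psi h1 /graph_def row_mxKl row_mxKr.
  move: h2; rewrite {1 2 3 4}/mid !row_mxKl !row_mxKr.
  set u := 2^-1 *: _; set v := c2 R *: _.
  have iv : i *: v = 2^-1 *: (rsubmx q - rsubmx (cj q)) by rewrite /v scalerA ic2.
  have -> : u + i *: v = rsubmx q.
    by rewrite iv -scalerDr addrACA subrr addr0 scalerDr addhalf.
  have -> : u - i *: v = rsubmx (cj q).
    by rewrite iv -scalerBr opprB [rsubmx q + _]addrC addrACA subrr addr0 scalerDr addhalf.
  rewrite !hsubmxK /starv cjK => ->; split=> [->|/eqP]; first by rewrite subrr.
  by rewrite subr_eq0 => /eqP.
exists Psi, Phi, G; split=> //.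
have [Y [E [hY hE YE EG [Y0 segE]]]] := segre_form hG.
exact: (class_II_independent hPsi hPhi Psi0 Phi0 PhiK PsiK hG (near0W Gs) hM hY Y0 segE hE YE EG M0 cls).
Qed.
End PreNormalForm.

(** * Changes of coordinates of degree two *)

Section JetNormalization.
Variable R : realType.
Local Notation C := R[i].
Local Notation i := ('i%C : C).
Implicit Types m : 'rV[C]_(1 + 1 + 2).

Lemma ord2P (P : 'I_2 -> Prop) : P 0 -> P 1 -> forall j, P j.
Proof. by move=> h0 h1 [[|[|//]] h]; [move: h0|move: h1]; congr P; apply/val_inj. Qed.

Lemma real_sum_sqr (x y : C) : x^*%C = x -> y^*%C = y -> x ^+ 2 + y ^+ 2 = 0 -> x = 0 /\ y = 0.
Proof.
have re (z : C) : z^*%C = z -> z = (complex.Re z)%:C.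
  case: z => u v [/= e]; have -> : v = 0 by lra.
  by [].
move=> /re -> /re ->; rewrite -!rmorphXn -rmorphD => /eqP.
rewrite fmorph_eq0 paddr_eq0 ?sqr_ge0// !sqrf_eq0 => /andP[/eqP -> /eqP ->].
by [].
Qed.

(** With [D] the determinant of [a] and [c], take [la = conj D] and [be] that cancels the
    component of [c] along [a]; the columns of [A] are multiples of [a] and of its image by
    a quarter turn, hence [A] is real. *)
Lemma normalizing_data (a c : 'rV[C]_2) : cj a = a ->
  (forall al be : C, al *: a + be *: c = 0 -> al = 0 /\ be = 0) ->
  exists (la be : C) (A : 'M[C]_2), [/\ la != 0, A \in unitmx, cj A = A,
    (la * la^*%C) *: (a *m A) = delta_mx 0 0 &
    la^*%C *: ((be *: a + la ^+ 2 *: c) *m A) = delta_mx 0 1].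
Proof.
move=> ra ind.
pose a1 := a 0 0; pose a2 := a 0 1; pose c1 := c 0 0; pose c2 := c 0 1.
have r1 : a1^*%C = a1 by rewrite /a1 -[in RHS]ra cjE.
have r2 : a2^*%C = a2 by rewrite /a2 -[in RHS]ra cjE.
pose D := a1 * c2 - a2 * c1; pose D' := D^*%C.
pose n2 := a1 ^+ 2 + a2 ^+ 2.
have row2 (x y : 'rV[C]_2) : x 0 0 = y 0 0 -> x 0 1 = y 0 1 -> x = y.
  by move=> h0 h1; apply/rowP; exact: ord2P.
have an0 : ~ (a1 = 0 /\ a2 = 0).
  move=> [e1 e2]; have [] := ind 1 0; last by move=> /eqP; rewrite oner_eq0.
  by rewrite scale1r scale0r addr0; apply: row2; rewrite mxE.
have D0 : D != 0.
  apply/eqP => D0; apply: an0; split.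
    have [|_ /eqP] := ind c1 (- a1); last by rewrite oppr_eq0 => /eqP.
    apply: row2; rewrite !mxE -?/a1 -?/a2 -?/c1 -?/c2; first by ring.
    by rewrite -[RHS]oppr0 -[in RHS]D0 /D; ring.
  have [|_ /eqP] := ind c2 (- a2); last by rewrite oppr_eq0 => /eqP.
  apply: row2; rewrite !mxE -?/a1 -?/a2 -?/c1 -?/c2; last by ring.
  by rewrite -[in RHS]D0 /D; ring.
have n0 : n2 != 0 by apply/eqP => /(real_sum_sqr r1 r2).
have D'0 : D' != 0 by rewrite conjc_eq0.
pose p := (n2 * (D * D'))^-1; pose q := ((D * D') ^+ 2)^-1.
have rD : (D * D')^*%C = D * D' by rewrite conjM conjcK mulrC.
have rp : p^*%C = p by rewrite /p conjc_inv conjM rD /n2 conjD !expr2 !conjM r1 r2.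
have rq : q^*%C = q by rewrite /q conjc_inv expr2 conjM rD.
pose A : 'M[C]_2 := \matrix_(j, k) if k == 0 then a 0 j * p else (if j == 0 then - a2 else a1) * q.
pose e := (a1 * c1 + a2 * c2) / n2.
have q0 : q != 0 by rewrite invr_eq0 expf_neq0// mulf_neq0.
have p0 : p != 0 by rewrite invr_eq0 !mulf_neq0.
pose B : 'M[C]_2 := \matrix_(j, k) if j == 0 then a 0 k / (n2 * p)
  else (if k == 0 then - a2 else a1) / (n2 * q).
have sum2 (f : 'I_2 -> C) : \sum_j f j = f 0 + f 1.
  by rewrite !big_ord_recl big_ord0 addr0; congr (_ + f _); apply/val_inj.
have o10 : (1 == 0 :> 'I_2) = false by [].
exists D', (- e * D' ^+ 2), A; split=> //.
- suff /mulmx1_unit[] : A *m B = 1%:M by [].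
  apply/matrixP; apply: ord2P; apply: ord2P; rewrite !mxE sum2 !mxE ?eqxx ?o10 -?/a1 -?/a2.
  + by rewrite -[RHS]/(1 : C) /n2; field; rewrite -/n2 ?n0 ?p0 ?q0 ?D0 ?D'0.
  + by rewrite -[RHS]/(0 : C) /n2; field; rewrite -/n2 ?n0 ?p0 ?q0 ?D0 ?D'0.
  + by rewrite -[RHS]/(0 : C) /n2; field; rewrite -/n2 ?n0 ?p0 ?q0 ?D0 ?D'0.
  + by rewrite -[RHS]/(1 : C) /n2; field; rewrite -/n2 ?n0 ?p0 ?q0 ?D0 ?D'0.
- apply/matrixP; apply: ord2P; apply: ord2P; rewrite !mxE ?eqxx ?o10 -?/a1 -?/a2 conjM ?conjN.
  + by rewrite r1 rp.
  + by rewrite r2 rq.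
  + by rewrite r2 rp.
  + by rewrite r1 rq.
- rewrite conjcK; apply: row2; rewrite !mxE sum2 !mxE ?eqxx ?o10 -?/a1 -?/a2 /p /q.
  + by rewrite -[RHS]/(1 : C) /n2; field; rewrite -/n2 ?n0 ?p0 ?q0 ?D0 ?D'0.
  + by rewrite -[RHS]/(0 : C) /n2; field; rewrite -/n2 ?n0 ?p0 ?q0 ?D0 ?D'0.
- rewrite conjcK; apply: row2; rewrite !mxE sum2 !mxE ?eqxx ?o10 -?/a1 -?/a2 -?/c1 -?/c2 /p /q /e.
  + by rewrite -[RHS]/(0 : C) /n2; field; rewrite -/n2 ?n0 ?p0 ?q0 ?D0 ?D'0.
  + rewrite -[RHS]/(1 : C); transitivity (D * (a1 * c2 - a2 * c1) * D' ^+ 2 / (D * D') ^+ 2); first by ring.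
    by rewrite -/D; field; rewrite D0 D'0.
Qed.
End JetNormalization.

(** * Normalization of the first jet *)

Section NormalForm.
Variable R : realType.
Local Notation C := R[i].
Local Notation i := ('i%C : C).
Implicit Types m : 'rV[C]_(1 + 1 + 2).

Lemma unit_of_left_inverse n (Psi Phi : 'rV[C]_n -> 'rV[C]_n) : holv Psi -> holv Phi -> Psi 0 = 0 ->
  near0 (fun q => Phi (Psi q) = q) -> Dm Psi 0 \in unitmx.
Proof.
move=> hPsi hPhi Psi0 K.
have d1 := near0_at0 (holv_hasD hPsi); have d2 := near0_at0 (holv_hasD hPhi).
rewrite -{1}Psi0 in d2; have /hasD_uniq h := hasD_comp d1 d2.
have /h/mulmx1_unit[]// : hasD (fun x => Phi (Psi x)) 0 1%:M.
by apply: hasD_ext (hasD_id 0); apply: near0S K => v; rewrite add0r.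
Qed.

(** In the coordinates [z = la z' + be z' ^ 2] and [w = w' A^-1], [G] is replaced by its
    product by [|la + be z'| ^ 2] and by [A]; the constants are those of [normalizing_data]. *)
Lemma normal_form_germ (M : set 'rV[C]_(1 + 2)) :
  @analytic_submanifold R ((1 + 2) + (1 + 2)) 4 (realification M) -> M 0 ->
  CR_generic (realification M) -> general_class_II (realification M) ->
  exists (Psi Phi : 'rV[C]_(1 + 2) -> 'rV[C]_(1 + 2)) (G : 'rV[C]_(1 + 1 + 2) -> 'rV[C]_2),
  [/\ [/\ holv Psi, holv Phi, Psi 0 = 0 & Phi 0 = 0],
    near0 (fun q => Phi (Psi q) = q) /\ near0 (fun c => Psi (Phi c) = c),
    holv G /\ (forall m, G (swap4 m) = cj (G m)),
    near0 (fun q => M (Psi q) <-> graph_def G (row_mx q (cj q)) = 0) &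
    G 0 = delta_mx 0 0 /\ row (iz : 'I_(1 + 1 + 2)) (Dm G 0) = delta_mx 0 1].
Proof.
move=> sub M0 gen cls.
have [Psi0 [Phi0 [G0 [[hPsi hPhi Psi00 Phi00] [K1 K2] [hG Gs] hM ind]]]] :=
  pre_normal_form sub M0 gen cls.
have rG : cj (G0 0) = G0 0.
  by rewrite -Gs; congr G0; rewrite /swap4 !(lsub0, rsub0) !cj0 !row_mx0.
have [la [be [A [la0 uA rA A1 A2]]]] := normalizing_data rG ind.
pose B := invmx A.
have rB : cj B = B by rewrite /B /cj map_invmx -/(cj A) rA.
pose kz (z : 'rV[C]_1) := la + be * z ord0 ord0.
pose kc (z : 'rV[C]_1) := la^*%C + be^*%C * z ord0 ord0.
pose P (q : 'rV[C]_(1 + 2)) : 'rV[C]_(1 + 2) := row_mx (kz (lsubmx q) *: lsubmx q) (rsubmx q *m B).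
pose Pm m : 'rV[C]_(1 + 1 + 2) :=
  row_mx (row_mx (kz (lsubmx (lsubmx m)) *: lsubmx (lsubmx m))
                 (kc (rsubmx (lsubmx m)) *: rsubmx (lsubmx m))) (rsubmx m *m B).
pose G m := (kz (lsubmx (lsubmx m)) * kc (rsubmx (lsubmx m))) *: (G0 (Pm m) *m A).
have h0 : holv (fun q : 'rV[C]_(1 + 2) => lsubmx q) by holt.
have h1 : holv (fun m => lsubmx (lsubmx m)) by holt.
have h2 : holv (fun m => rsubmx (lsubmx m)) by holt.
have hkz : hol (fun q : 'rV[C]_(1 + 2) => kz (lsubmx q)).
  by apply: holD (hol_const _ _) (holM (hol_const _ _) (h0 ord0)).
have hk1 : hol (fun m => kz (lsubmx (lsubmx m))).
  by apply: holD (hol_const _ _) (holM (hol_const _ _) (h1 ord0)).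
have hk2 : hol (fun m => kc (rsubmx (lsubmx m))).
  by apply: holD (hol_const _ _) (holM (hol_const _ _) (h2 ord0)).
have hP : holv P.
  by apply: holv_row; [exact: holvZ|apply: holv_mulmx; [holt|move=> *; exact: hol_const]].
have P0 : P 0 = 0 by rewrite /P lsub0 rsub0 scaler0 mul0mx row_mx0.
have hPm : holv Pm.
  apply: holv_row; first by apply: holv_row; exact: holvZ.
  by apply: holv_mulmx; [holt|move=> *; exact: hol_const].
have Pm0 : Pm 0 = 0 by rewrite /Pm !(lsub0, rsub0) !scaler0 mul0mx !row_mx0.
have hGP := holv_comp hG hPm Pm0.
have hG' : holv G.
  by apply: holvZ; [exact: holM|apply: holv_mulmx => // *; exact: hol_const].
pose Psi q := Psi0 (P q).
have hPsi' : holv Psi := holv_comp hPsi hP P0.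
have Psi'0 : Psi 0 = 0 by rewrite /Psi P0.
have kz0 : kz 0 = la by rewrite /kz mxE mulr0 addr0.
have kc0 : kc 0 = la^*%C by rewrite /kc mxE mulr0 addr0.
have uPsi := unit_of_left_inverse hPsi hPhi Psi00 K1.
pose dia (l : C) (D : 'M[C]_2) : 'M[C]_(1 + 2) := row_mx (l *: lsubmx 1%:M) (rsubmx 1%:M *m D).
have diaE l D k (x : 'M[C]_(k, 1 + 2)) : x *m dia l D = row_mx (l *: lsubmx x) (rsubmx x *m D).
  by rewrite /dia mul_mx_row -scalemxAr mulmxA !(mulmx_lsub, mulmx_rsub) mulmx1.
have uDP : dia la B \in unitmx.
  have /mulmx1_unit[]// : dia la B *m dia la^-1 A = 1%:M.
  rewrite diaE /dia row_mxKl row_mxKr scalerA mulVf// scale1r -mulmxA mulVmx// mulmx1.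
  exact: hsubmxK.
have dkz n (F : 'rV[C]_n -> 'rV[C]_1) D p (a b : C) : hasD F p D ->
  hasder (fun x => a + b * F x ord0 ord0) p (b *: D).
  move=> dF; have := hasderD (hasder_const a p) (hasderZ b (dF ord0)); rewrite add0r.
  by have -> : col ord0 D = D by apply/colP => k; rewrite mxE.
have dP : hasD P 0 (dia la B).
  have d1 := hasD_lsub (hasD_id (0 : 'rV[C]_(1 + 2))).
  have d2 := hasD_comp (hasD_rsub (hasD_id (0 : 'rV[C]_(1 + 2)))) (hasD_lin B _).
  have := hasD_row (hasD_scale (dkz _ _ _ _ la be d1) d1) d2.
  by rewrite lsub0 mulmx0 add0r -/(kz _) kz0.
have dPsi : hasD Psi 0 (dia la B *m Dm Psi0 0).
  apply: hasD_comp dP _; rewrite P0; exact: near0_at0 (holv_hasD hPsi).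
have [|Phi [hPhi' Phi'0 K1' K2']] := inverse_function hPsi' Psi'0 dPsi.
  by rewrite unitmx_mul uDP.
exists Psi, Phi, G; split=> //.
- split=> // m; rewrite /G.
  have ek : Pm (swap4 m) = swap4 (Pm m).
    rewrite /Pm /swap4 !(row_mxKl, row_mxKr) /kz /kc !cjZ !cjM rB !cjE.
    by rewrite !conjD !conjM !conjcK.
  rewrite ek Gs cjZ cjM rA; congr (_ *: _).
  rewrite /swap4 !(row_mxKl, row_mxKr) /kz /kc !conjM !conjD !conjM !conjcK !cjE.
  by rewrite mulrC.
- have t1 := holv_to0 hP P0.
  apply: near0S (near0_comp t1 hM) => q; rewrite /Psi => ->.
  suff -> : graph_def G0 (row_mx (P q) (cj (P q))) = graph_def G (row_mx q (cj q)) *m B.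
    split=> [/(congr1 (fun x => x *m A))|->]; last by rewrite mul0mx.
    by rewrite mul0mx mulmxKV.
  have em : mid (row_mx (P q) (cj (P q))) = Pm (mid (row_mx q (cj q))).
    rewrite /Pm /mid !(row_mxKl, row_mxKr) /P cj_row !(row_mxKl, row_mxKr).
    rewrite cjM rB -mulmxDl -scalemxAl cj_rsub cjZ cj_lsub; congr (row_mx (row_mx _ (_ *: _)) _).
    by rewrite /kz /kc conjD conjM -cj_lsub cjE.
  rewrite /graph_def em mulmxBl -scalemxAl mulmxBl; congr (_ *: (_ - _) - _).
  + by rewrite /P !(row_mxKl, row_mxKr).
  + by rewrite /P cj_row !(row_mxKl, row_mxKr) cjM rB cj_rsub.
  move: (mid _) => m; rewrite /graphF /G -!scalemxAl mulmxK// scalerA; congr (_ *: _).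
  by rewrite /zz /Pm !(row_mxKl, row_mxKr) !mxE; ring.
- split; first by rewrite /G Pm0 !(lsub0, rsub0) kz0 kc0.
  pose x0 : 'rV[C]_(1 + 1 + 2) := row_mx (row_mx 1%:M 0) 0.
  have rx n (D : 'M[C]_(1 + 1 + 2, n)) : row (iz : 'I_(1 + 1 + 2)) D = x0 *m D.
    by rewrite /x0 row_iz mxE eqxx scale1r.
  have k1 := hasD_lsub (hasD_lsub (hasD_id (0 : 'rV[C]_(1 + 1 + 2)))).
  have k2 := hasD_rsub (hasD_lsub (hasD_id (0 : 'rV[C]_(1 + 1 + 2)))).
  have k3 := hasD_comp (hasD_rsub (hasD_id (0 : 'rV[C]_(1 + 1 + 2)))) (hasD_lin B _).
  have e1 := dkz _ _ _ _ la be k1; have e2 := dkz _ _ _ _ la^*%C be^*%C k2.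
  have dPm : hasD Pm 0 _ := hasD_row (hasD_row (hasD_scale e1 k1) (hasD_scale e2 k2)) k3.
  have dG0 : hasD G0 (Pm 0) (Dm G0 0) by rewrite Pm0; exact: near0_at0 (holv_hasD hG).
  have dG : hasD G 0 _ := hasD_scale (hasderM e1 e2) (hasD_comp (hasD_comp dPm dG0) (hasD_lin A _)).
  have x1 : x0 *m lsubmx (lsubmx 1%:M) = 1%:M.
    by rewrite !mulmx_lsub mulmx1 /x0 !row_mxKl.
  have x2 : x0 *m rsubmx (lsubmx 1%:M) = 0.
    by rewrite mulmx_rsub mulmx_lsub mulmx1 /x0 row_mxKl row_mxKr.
  have x3 : x0 *m rsubmx 1%:M = 0 by rewrite mulmx_rsub mulmx1 /x0 row_mxKr.
  rewrite (DmE dG) rx mulmxDr mulmxA [x0 *m (_ + _)]mulmxDr -!scalemxAr x1 x2 !scaler0 addr0.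
  rewrite !mulmxA !mul_mx_row [x0 *m (_ + _)]mulmxDr [x0 *m (_ + _)]mulmxDr !mulmxA -!scalemxAr x1 x2 x3.
  rewrite !(lsub0, rsub0) !mulmx0 !scaler0 mul0mx !addr0 !add0r.
  rewrite -/(kz _) -/(kc _) kz0 kc0 Pm0.
  rewrite row_iz 2![in X in X *: row _ _]mxE eqxx mulr1 -!scalemxAl mul1mx -A2 mulmxDl -!scalemxAl.
  by rewrite scalerDr !scalerA; congr (_ + _ *: _); ring.
Qed.
End NormalForm.

(** * Power series of given order *)

Section OrderedSeries.
Variable R : realType.
Local Notation C := R[i].

(** Like [rep], with control of the order of the series. *)
Definition ser n (k : nat) (f : 'rV[C]_n -> C) (r : R) : Prop :=
  exists a : mpseries n C, [/\ mporder_ge k a, (exists B, bnd (fun al => nrm (a al) * wt r al) B) &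
    forall x, inD r x -> hsum (fun al => a al * mon x al) (f x)].

Lemma near0_right n (P : 'rV[C]_n -> Prop) : near0 P -> \forall r \near 0^'+, forall x, inD r x -> P x.
Proof.
move=> [r0 [r00 h]]; near=> r => x xr; apply: h; apply: inD_le xr.
by near: r; exact: nbhs_right_le.
Unshelve. all: by end_near.
Qed.

Definition hol_ge n k (f : 'rV[C]_n -> C) := \forall r \near 0^'+, ser k f r.

Lemma hol_ge0 n (f : 'rV[C]_n -> C) : hol f -> hol_ge 0 f.
Proof.
move=> [r0 [B [r00 fr]]]; rewrite /hol_ge; near=> r.
have [a [ha hf]] : rep r f B.
  by apply: rep_ler fr; near: r; [exact: nbhs_right_ge|exact: nbhs_right_le].
by exists a; split=> //; exists B.
Unshelve. all: by end_near.
Qed.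

Lemma hol_ge_ext n k (f g : 'rV[C]_n -> C) :
  near0 (fun x => f x = g x) -> hol_ge k f -> hol_ge k g.
Proof.
move=> /near0_right fg; apply: filterS2 fg => r fg [a [ak ab af]].
by exists a; split=> // x xr; rewrite -fg//; exact: af.
Qed.

Lemma hol_ge_zero n k : hol_ge k (fun _ : 'rV[C]_n => 0).
Proof.
apply: filterE => r; exists (fun=> 0); split=> //.
  by exists 0 => J; rewrite big1_fset// => al _ _; rewrite nrm0 mul0r.
move=> x _; apply: (@eq_hsum _ _ (fun=> 0)); last exact: hsum0.
by move=> al; rewrite mul0r.
Qed.

Lemma hol_geD n k (f g : 'rV[C]_n -> C) :
  hol_ge k f -> hol_ge k g -> hol_ge k (fun x => f x + g x).
Proof.
move=> hf hg; rewrite /hol_ge; near=> r.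
have r0 : 0 <= r by near: r; exact: nbhs_right_ge.
have [a [ak [A ha] af]] : ser k f r by near: r.
have [b [bk [B hb] bg]] : ser k g r by near: r.
exists (fun al => a al + b al); split.
- by move=> al h; rewrite ak// bk// addr0.
- exists (A + B) => J; apply: le_trans (lerD (ha J) (hb J)); rewrite -big_split /=.
  by apply: ler_sum => al _; rewrite -mulrDl ler_wpM2r ?wt_ge0// ler_nrmD.
- by move=> x xr; apply: eq_hsum (hsumD (af _ xr) (bg _ xr)) => al; rewrite mulrDl.
Unshelve. all: by end_near.
Qed.

Lemma hol_ge_sum n k (I : Type) (s : seq I) (f : I -> 'rV[C]_n -> C) :
  (forall j, hol_ge k (f j)) -> hol_ge k (fun x => \sum_(j <- s) f j x).
Proof.
move=> hf; elim: s => [|j s IH].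
  by apply: hol_ge_ext (@hol_ge_zero n k); apply: near0W => x; rewrite big_nil.
by apply: hol_ge_ext (hol_geD (hf j) IH); apply: near0W => x; rewrite big_cons.
Qed.

Lemma hol_ge_shift n k (f : 'rV[C]_n -> C) j : hol_ge k f -> hol_ge k.+1 (fun x => x ord0 j * f x).
Proof.
move=> hf; rewrite /hol_ge; near=> r.
have r0 : 0 <= r by near: r; exact: nbhs_right_ge.
have [a [ak [B ha] af]] : ser k f r by near: r.
pose b (al : {ffun 'I_n -> nat}) := if al j == 0%N then 0 else a (decf j al).
have bE al : b (incf j al) = a al by rewrite /b (negbTE (incf_neq0 _ _)) incfK.
exists b; split.
- move=> al; rewrite /b; case: eqP => // /eqP aj; rewrite -{1}(decfK aj) => lt.
  apply: ak; move: lt.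
  have -> : (\sum_i incf j (decf j al) i = (\sum_i decf j al i).+1)%N; last by [].
  rewrite (eq_bigr (fun i => decf j al i + (i == j))%N); last by move=> i _; rewrite ffunE.
  have e : (\sum_(i < n) (i == j) = 1)%N.
    by rewrite (bigD1 j)//= eqxx big1// => i /negPf ->.
  by rewrite big_split /= e addn1.
- exists (r * B); apply: (bnd_reindex (incfK j)) => [al /decfN h|]; first by rewrite /b h nrm0 mul0r.
  by apply: bnd_le (bndZ r0 ha) => al; rewrite bE wt_inc mulrCA.
move=> x xr; apply: (hsum_reindex (incfK j)) => [al /decfN h|]; first by rewrite /b h mul0r.
by apply: eq_hsum (hsumZ (x ord0 j) (af _ xr)) => al; rewrite bE mon_inc mulrCA.
Unshelve. all: by end_near.
Qed.

(** Hadamard, twice: [f] is a combination of the products of two coordinates. *)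
Lemma hol_ge2 n (f : 'rV[C]_n -> C) : hol f -> bigO 2 f -> hol_ge 2 f.
Proof.
move=> hf f2; have f0 := bigO_at0 f2.
have [h [hh hE]] := hol_hadamard hf.
have h0 j : h j 0 = 0.
  have d1 : hasder f 0 0.
    apply: bigO_ext f2; apply: near0W => v.
    by rewrite add0r f0 subr0 mulmx0 mxE subr0.
  have d2 := hasder_sum (index_enum 'I_n)
    (fun j => hasderM (hasder_coord j 0) (near0_at0 (hol_der (hh j)))).
  have /hasder_uniq/(_ d2) : hasder (fun x => \sum_j x ord0 j * h j x) 0 0.
    by apply: hasder_ext d1; apply: near0S hE => v e; rewrite add0r e f0 add0r.
  move/colP/(_ j); rewrite mxE summxE => e.
  rewrite [RHS]e (bigD1 j)//= big1 ?addr0 => [|k kj]; rewrite !mxE ?mul0r ?addr0 ?eqxx ?mulr1//.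
  by rewrite eq_sym (negPf kj) mulr0.
apply: (@hol_ge_ext _ _ (fun x => \sum_j x ord0 j * h j x)).
  by apply: near0S hE => x ->; rewrite f0 add0r.
apply: hol_ge_sum => j; apply: hol_ge_shift.
have [g [hg gE]] := hol_hadamard (hh j).
apply: (@hol_ge_ext _ _ (fun x => \sum_k x ord0 k * g k x)).
  by apply: near0S gE => x ->; rewrite h0 add0r.
by apply: hol_ge_sum => k; apply: hol_ge_shift; exact: hol_ge0.
Qed.
End OrderedSeries.

(** * Domains, and expansion of the graph *)

Section Domains.
Variables (K : numFieldType) (n : nat) (Psi Phi : 'rV[K]_n -> 'rV[K]_n) (rho sigma : K).
Hypotheses (rho0 : 0 < rho) (sigma0 : 0 < sigma) (Phi0 : Phi 0 = 0).
Hypothesis HPsi : forall q, `|q| < rho -> Phi (Psi q) = q /\ differentiable_rV Psi q.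
Hypothesis HPhi : forall p, `|p| < sigma -> Psi (Phi p) = p /\ differentiable_rV Phi p.

Lemma open_preimage (F : 'rV[K]_n -> 'rV[K]_n) a b :
  (forall q, `|q| < a -> differentiable_rV F q) -> open [set q | `|q| < a /\ `|F q| < b].
Proof.
have ballE c : ball (0 : 'rV[K]_n) c = [set y | `|y| < c].
  by rewrite -ball_normE; apply/funext => y; rewrite /= sub0r normrN.
have nbh c (x : 'rV[K]_n) : `|x| < c -> nbhs x [set y : 'rV[K]_n | `|y| < c].
  move=> xc; rewrite -ballE; apply: open_nbhs_nbhs; split; first exact: ball_open.
  by rewrite ballE.
move=> dF; rewrite openE => q /= [qa Fb].
have cF : {for q, continuous F} := differentiable_continuous (dF q qa).
exact: filterI (nbh _ _ qa) (cF _ (nbh _ _ Fb)).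
Qed.

(** The domains are polydiscs intersected with the preimages of each other. *)
Lemma inverse_domains : exists U V : set 'rV[K]_n,
  centered_holomorphic_coordinates U V Phi Psi /\ forall q, V q -> `|q| < rho.
Proof.
exists [set p | `|p| < sigma /\ `|Phi p| < rho], [set q | `|q| < rho /\ `|Psi q| < sigma].
split; last by move=> q [].
split.
- split=> //; last by rewrite /= Phi0 normr0.
    by apply: open_preimage => p /HPhi[].
  by apply: open_preimage => q /HPsi[].
- by move=> p [/= ps pr]; have [e _] := HPhi ps; rewrite /= e.
- by move=> q [/= qr qs]; have [e _] := HPsi qr; rewrite /= e.
- by move=> p [/= /HPhi[]].
- by move=> q [/= /HPsi[]].
Qed.
End Domains.

Section Assembly.
Variable R : realType.
Local Notation C := R[i].
Local Notation i := ('i%C : C).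
Implicit Types m : 'rV[C]_(1 + 1 + 2).

Lemma norm_inD n r (q : 'rV[C]_n) : @Num.norm C 'rV[C]_n q < r%:C -> inD r q.
Proof.
have [rho rho0 [-> h]] := norm_real_of q; rewrite ltcR => rr.
exact: inD_le (ltW rr) h.
Qed.

Variable G : 'rV[C]_(1 + 1 + 2) -> 'rV[C]_2.
Hypotheses (hG : holv G) (Gs : forall m, G (swap4 m) = cj (G m)).
Hypotheses (G0 : G 0 = delta_mx 0 0) (dG0 : row (iz : 'I_(1 + 1 + 2)) (Dm G 0) = delta_mx 0 1).

(** The leading terms of the two equations, divided by [z zb]. *)
Definition model (x : 'rV[C]_2) (k : 'I_2) : C :=
  if k == 0 then 1 else x ord0 0 + x ord0 1.

(** The derivative of [G] in [ze] at the origin is the conjugate of the derivative in [z]. *)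
Lemma G_restrict k : hol_ge 2 (fun x : 'rV[C]_(1 + 1) => G (row_mx x 0) ord0 k - model x k).
Proof.
have hr : holv (fun x : 'rV[C]_(1 + 1) => row_mx x 0 : 'rV[C]_(1 + 1 + 2)) by holt.
have hGr : holv (fun x : 'rV[C]_(1 + 1) => G (row_mx x 0)).
  by apply: holv_comp hG hr _; rewrite row_mx0.
have hm : hol (fun x : 'rV[C]_(1 + 1) => model x k).
  rewrite /model; case: eqP => _; first exact: hol_const.
  exact: holD (hol_coord _ _) (hol_coord _ _).
apply: hol_ge2; first exact: holB (hGr k) hm.
have d0 := near0_at0 (holv_hasD hG).
have d1 : hasD (fun x : 'rV[C]_(1 + 1) => G (row_mx x 0)) 0 (row_mx 1%:M 0 *m Dm G 0).
  by apply: hasD_comp (hasD_row (hasD_id _) (hasD_const _ _)) _; rewrite row_mx0.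
apply: bigO_ext (d1 k); apply: near0W => v.
rewrite add0r row_mx0 -addrA -opprD mulmx_colE; congr (_ - _).
rewrite mulmxA mul_mx_row mulmx1 mulmx0.
pose x0 : 'rV[C]_(1 + 1 + 2) := row_mx (row_mx 1%:M 0) 0.
have e1 : x0 *m Dm G 0 = delta_mx 0 1 by rewrite /x0 row_iz mxE eqxx scale1r.
have e2 : row_mx (row_mx 0 1%:M) 0 *m Dm G 0 = delta_mx 0 1.
  have s0 : swap4 0 = 0 :> 'rV[C]_(1 + 1 + 2) by rewrite /swap4 !(lsub0, rsub0) !cj0 !row_mx0.
  have := swap_der d0 s0 (near0W (fun v => _)) x0.
  move=> /(_ (fun v => Gs (0 + v))); rewrite e1.
  have -> : swap4 x0 = row_mx (row_mx 0 1%:M) 0.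
    rewrite /swap4 /x0 !(row_mxKl, row_mxKr) !cj0; congr (row_mx (row_mx _ _) _).
    by apply/matrixP => a b; rewrite !mxE !ord1 eqxx rmorph1.
  by move=> ->; apply/matrixP => a b; rewrite !mxE rmorph_nat.
have -> : row_mx v 0 = v ord0 0 *: x0 + v ord0 1 *: row_mx (row_mx 0 1%:M) 0 :> 'rV[C]_(1 + 1 + 2).
  rewrite !scale_row_mx !add_row_mx !scaler0 !addr0 add0r; congr row_mx.
  apply/rowP => j; case: (split_ordP j) => a ->; rewrite !ord1 ?row_mxEl ?row_mxEr !mxE eqxx mulr1;
  by congr (v _ _); apply/val_inj.
rewrite mulmxDl -!scalemxAl e1 e2 G0 -scalerDl; clear hm d1; move: k; apply: ord2P; rewrite !mxE /model /=.
  by rewrite mulr0 addr0.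
by rewrite add0r mulr1.
Qed.

Lemma G_split k : exists B D : 'rV[C]_(1 + 1 + 2) -> C, [/\ hol_ge 0 B, hol_ge 0 D &
  near0 (fun m => G m ord0 k = G (row_mx (lsubmx m) 0) ord0 k
    + rsubmx m ord0 0 * B m + rsubmx m ord0 1 * D m)].
Proof.
have [r [B [r0 Gr]]] := hG k.
have [h [hr hE]] := rep_had r0 Gr.
exists (h 0), (h 1); split; [apply: hol_ge0; by exists r, (B / r)|apply: hol_ge0; by exists r, (B / r)|].
exists r; split=> // m /hE ->; rewrite !big_ord_recl big_ord0 addr0 addrA.
by congr (_ + _ + _ _ _ * h _ _); apply/val_inj.
Qed.

(** Hadamard in the variables [u] splits off the terms divisible by [u_1] and [u_2]. *)
Lemma expansion k : \forall r \near 0^'+, exists (A : mpseries 2 C) (B D : mpseries 4 C),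
  [/\ mporder_ge 2 A, mpconverges r%:C A, mpconverges r%:C B, mpconverges r%:C D &
   forall z (u : 'rV[R]_2), nrm z <= r -> inD r (rc u) ->
   let m : 'rV[C]_(1 + 1 + 2) := row_mx (row_mx z%:M (z^*%C)%:M) (rc u) in
   z * z^*%C * model (row_mx z%:M (z^*%C)%:M : 'rV[C]_(1 + 1)) k
   + graph_remainder A B D z (u 0 0) (u 0 1) = graphF G m ord0 k].
Proof.
have [b [d [hb hd GE]]] := G_split k.
have hA := G_restrict k.
near=> r.
have [A [Ak [A0 cA] sA]] : ser 2 (fun x : 'rV[C]_(1 + 1) => G (row_mx x 0) ord0 k - model x k) r.
  by near: r.
have [B [_ [B0 cB] sB]] : ser 0 b r by near: r.
have [D [_ [D0 cD] sD]] : ser 0 d r by near: r.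
have GE' : forall m, inD r m -> G m ord0 k = G (row_mx (lsubmx m) 0) ord0 k
    + rsubmx m ord0 0 * b m + rsubmx m ord0 1 * d m by near: r; exact: near0_right.
exists A, B, D; split=> //.
- exact: mpconverges_C cA.
- exact: mpconverges_C cB.
- exact: mpconverges_C cD.
move=> z u zr ur; set m : 'rV[C]_(1 + 1 + 2) := row_mx _ (rc u).
have zzr : inD r (row_mx z%:M (z^*%C)%:M : 'rV[C]_(1 + 1)).
  by apply: inD_row => j; rewrite (ord1 j) mxE eqxx mulr1n ?nrm_conj.
have mr : inD r m by exact: inD_row.
rewrite /graph_remainder.
have -> : row_of_seq 2 [:: z; z^*%C] = row_mx z%:M (z^*%C)%:M :> 'rV[C]_(1 + 1).
  apply/rowP => j; rewrite mxE; case: (split_ordP j) => a ->; rewrite !ord1 ?row_mxEl ?row_mxEr !mxE eqxx;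
  by rewrite mulr1n.
have hm : forall j : 'I_(1 + 1 + 2), [:: z; z^*%C; (u 0 0)%:C; (u 0 1)%:C]`_j = m ord0 j.
  move=> j; rewrite /m; case: (split_ordP j) => a ->; rewrite ?row_mxEl ?row_mxEr.
    by case: (split_ordP a) => c ->; rewrite !ord1 ?row_mxEl ?row_mxEr !mxE eqxx mulr1n.
  by rewrite rcE; move: a; apply: ord2P.
have -> : row_of_seq 4 [:: z; z^*%C; (u 0 0)%:C; (u 0 1)%:C] = m.
  by apply/rowP => j; rewrite mxE hm.
rewrite (mpeval_hsum (sA _ zzr)) (mpeval_hsum (sB _ mr)) (mpeval_hsum (sD _ mr)).
rewrite /graphF [RHS]mxE (GE' _ mr) /zz {2 4 6 8}/m !row_mxKl !row_mxKr !rcE !mxE eqxx !mulr1n.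
by ring.
Unshelve. all: by end_near.
Qed.
End Assembly.

(** * The normal form *)

Section RealGraph.
Variable R : realType.
Local Notation C := R[i].
Variable G : 'rV[C]_(1 + 1 + 2) -> 'rV[C]_2.
Hypothesis Gs : forall m, G (swap4 m) = cj (G m).

Definition real_mid (z : C) (u : 'rV[R]_2) : 'rV[C]_(1 + 1 + 2) :=
  row_mx (row_mx z%:M (z^*%C)%:M) (rc u).

(** The conjugation of [(z, ze, u)] fixes the real points. *)
Lemma Im_graphF z u k : complex.Im (graphF G (real_mid z u) ord0 k) = 0.
Proof.
have cs (x : C) : cj (x%:M : 'M[C]_1) = (x^*%C)%:M.
  by apply/matrixP => a b; rewrite !mxE !ord1 eqxx !mulr1n.
have sw : swap4 (real_mid z u) = real_mid z u.
  by rewrite /swap4 /real_mid !(row_mxKl, row_mxKr) !cs conjcK cj_rc.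
have : cj (graphF G (real_mid z u)) = graphF G (real_mid z u).
  rewrite /graphF cjZ -Gs sw; congr (_ *: _).
  by rewrite /zz /real_mid !(row_mxKl, row_mxKr) !mxE !eqxx !mulr1n conjM conjcK mulrC.
move=> /rowP/(_ k); rewrite cjE; case: (graphF _ _ _ _) => x y [/= e].
lra.
Qed.

Lemma graph_def_real (q : 'rV[C]_(1 + 2)) k :
  graph_def G (row_mx q (cj q)) ord0 k = (complex.Im (rsubmx q ord0 k))%:C
   - graphF G (real_mid (lsubmx q ord0 ord0) (\row_j complex.Re (rsubmx q ord0 j))) ord0 k.
Proof.
have -> : real_mid (lsubmx q ord0 ord0) (\row_j complex.Re (rsubmx q ord0 j))
    = mid (row_mx q (cj q)).
  rewrite /real_mid /mid row_mxKl row_mxKr -mx11_scalar; congr (row_mx (row_mx _ _) _).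
    by apply/matrixP => a b; rewrite !mxE !ord1 eqxx mulr1n.
  rewrite -cj_rsub -rc_ReM; congr (rc _); apply/rowP => j.
  by rewrite [LHS]mxE [RHS]mxE.
have e (a b : 'rV[C]_2) : (a - b) ord0 k = a ord0 k - b ord0 k by rewrite !mxE.
by rewrite /graph_def row_mxKl row_mxKr -cj_rsub -rc_ImM e rcE; congr (_%:C - _); rewrite mxE.
Qed.
End RealGraph.
Theorem mainTheorem2 (R : realType) (M : set 'rV[R[i]]_3)
    (M_submanifold : analytic_submanifold 4 (realification M))
    (M_origin : M 0)
    (M_generic : CR_generic (realification M))
    (M_class : general_class_II (realification M)) :
  exists (U V : set 'rV[R[i]]_3) (Phi Psi : 'rV[R[i]]_3 -> 'rV[R[i]]_3)
         (r : R) (A1 A2 : mpseries 2 R[i]) (B1 C1 B2 C2 : mpseries 4 R[i]),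
    let F1 (z : R[i]) (u1 u2 : R) : R[i] :=
      z * z^* + graph_remainder A1 B1 C1 z u1 u2 in
    let F2 (z : R[i]) (u1 u2 : R) : R[i] :=
      z ^+ 2 * z^* + z * z^* ^+ 2 + graph_remainder A2 B2 C2 z u1 u2 in
    [/\ centered_holomorphic_coordinates U V Phi Psi,
        [/\ 0 < r,
            mpconverges r%:C A1 /\ mpconverges r%:C A2,
            mpconverges r%:C B1 /\ mpconverges r%:C B2,
            mpconverges r%:C C1 /\ mpconverges r%:C C2 &
            mporder_ge 2 A1 /\ mporder_ge 2 A2],
        forall (z : R[i]) (u1 u2 : R), `|z| < r%:C -> `|u1| < r -> `|u2| < r ->
          complex.Im (F1 z u1 u2) = 0 /\ complex.Im (F2 z u1 u2) = 0,
        forall q, V q -> forall j, `|q ord0 j| < r%:C &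
        forall q, V q ->
          let z := q ord0 0 in
          let w1 := q ord0 1 in
          let w2 := q ord0 2%:R in
          M (Psi q) <->
          (complex.Im w1)%:C = F1 z (complex.Re w1) (complex.Re w2) /\
          (complex.Im w2)%:C = F2 z (complex.Re w1) (complex.Re w2)].

Proof.
have [Psi [Phi [G [[hPsi hPhi Psi0 Phi0] [K1 K2] [hG Gs] hM [G0 dG0]]]]] :=
  @normal_form_germ R M M_submanifold M_origin M_generic M_class.
have hE k := expansion hG Gs G0 dG0 k.
have [r [r0 [hq [hp hF]]]] : exists r : R, 0 < r /\ (forall q : 'rV[R[i]]_(1 + 2), inD r q ->
    [/\ Phi (Psi q) = q, hasD Psi q (Dm Psi q) & (M (Psi q) <-> graph_def G (row_mx q (cj q)) = 0)])
    /\ (forall p : 'rV[R[i]]_(1 + 2), inD r p -> Psi (Phi p) = p /\ hasD Phi p (Dm Phi p))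
    /\ forall k, exists (A : mpseries 2 R[i]) (B D : mpseries 4 R[i]),
    [/\ mporder_ge 2 A, mpconverges r%:C A, mpconverges r%:C B, mpconverges r%:C D &
     forall z (u : 'rV[R]_2), nrm z <= r -> inD r (rc u) ->
     z * z^*%C * model (row_mx z%:M (z^*%C)%:M : 'rV[R[i]]_(1 + 1)) k
     + graph_remainder A B D z (u 0 0) (u 0 1) = graphF G (real_mid z u) ord0 k].
  have f1 := near0_right (filterI K1 (filterI (holv_hasD hPsi) hM)).
  have f2 := near0_right (filterI K2 (holv_hasD hPhi)).
  near (0 : R)^'+ => r; exists r; split; first by near: r; exact: nbhs_right_gt.
  have h : forall q, inD r q -> Phi (Psi q) = q /\ (hasD Psi q (Dm Psi q) /\
      (M (Psi q) <-> graph_def G (row_mx q (cj q)) = 0)) by near: r; exact: f1.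
  split; first by move=> q /h[h1 [h2 h3]]; split.
  split; first by near: r; exact: f2.
  by apply: ord2P; [near: r; exact: hE|near: r; exact: hE].
have r0C : (0 : R[i]) < r%:C by rewrite ltcR.
have [||U [V [UV Vr]]] := @inverse_domains R[i] 3 Psi Phi r%:C r%:C r0C r0C Phi0.
- by move=> q /norm_inD/hq[? /hasD_differentiable].
- by move=> p /norm_inD/hp[? /hasD_differentiable].
have [A1 [B1 [D1 [A1o A1c B1c D1c E1]]]] := hF 0.
have [A2 [B2 [D2 [A2o A2c B2c D2c E2]]]] := hF 1.
exists U, V, Phi, Psi, r, A1, A2, B1, D1, B2, D2; move=> F1 F2.
have FE z u1 u2 : `|z| < r%:C -> `|u1| < r -> `|u2| < r ->
    let m := real_mid z (\row_j [:: u1; u2]`_j) in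
    F1 z u1 u2 = graphF G m ord0 0 /\ F2 z u1 u2 = graphF G m ord0 1.
  move=> zr u1r u2r m; rewrite nrmE ltcR in zr.
  have ur : inD r (rc (\row_(j < 2) [:: u1; u2]`_j)).
    by apply: ord2P; rewrite rcE nrm_real mxE; exact: ltW.
  rewrite -(E1 _ _ (ltW zr) ur) -(E2 _ _ (ltW zr) ur) ![(\row__ _) _ _]mxE.
  split; rewrite /model /=; first by rewrite mulr1.
  congr (_ + _).
  have -> : (row_mx z%:M (z^*%C)%:M : 'rV[R[i]]_(1 + 1)) 0 1 = z^*%C.
    transitivity ((row_mx z%:M (z^*%C)%:M : 'rV[R[i]]_(1 + 1)) ord0 (rshift 1 ord0)).
      by congr (row_mx _ _ _ _); apply/val_inj.
    by rewrite row_mxEr mxE eqxx mulr1n.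
  have -> : (row_mx z%:M (z^*%C)%:M : 'rV[R[i]]_(1 + 1)) 0 0 = z.
    transitivity ((row_mx z%:M (z^*%C)%:M : 'rV[R[i]]_(1 + 1)) ord0 (lshift 1 ord0)).
      by congr (row_mx _ _ _ _); apply/val_inj.
    by rewrite row_mxEl mxE eqxx mulr1n.
  ring.
split; first exact: UV.
- by split; first exact: r0; split.
- by move=> z u1 u2 zr u1r u2r; have [-> ->] := FE z u1 u2 zr u1r u2r; rewrite !Im_graphF.
- move=> q /Vr qr j; apply: le_lt_trans qr; exact: ler_mx_coord.
move=> q Vq z w1 w2.
have qr := norm_inD (Vr q Vq); have [_ _ ->] := hq q qr.
have qj (j : 'I_3) : nrm (q ord0 j) < r.
  by rewrite -ltcR -nrmE; apply: le_lt_trans (Vr q Vq); exact: ler_mx_coord.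
have zr : `|z| < r%:C by rewrite nrmE ltcR; exact: qj.
have u1r : `|complex.Re w1| < r by apply: le_lt_trans (nrm_Re _) (qj _).
have u2r : `|complex.Re w2| < r by apply: le_lt_trans (nrm_Re _) (qj _).
have [-> ->] := FE z _ _ zr u1r u2r.
have wE (k : 'I_2) : rsubmx (q : 'rV[R[i]]_(1 + 2)) ord0 k = [:: w1; w2]`_k.
  by move: k; apply: ord2P; rewrite mxE /=; congr (q _ _); apply/val_inj.
have zE : lsubmx (q : 'rV[R[i]]_(1 + 2)) ord0 ord0 = z.
  by rewrite mxE; congr (q _ _); apply/val_inj.
set m := real_mid z _.
have gE k : graph_def G (row_mx q (cj q)) ord0 k
    = (complex.Im [:: w1; w2]`_k)%:C - graphF G m ord0 k.
  suff uE : \row_j complex.Re (rsubmx (q : 'rV[R[i]]_(1 + 2)) ord0 j)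
      = \row_j [:: complex.Re w1; complex.Re w2]`_j by rewrite graph_def_real zE wE uE.
  by apply/rowP => j; rewrite [LHS]mxE [RHS]mxE wE; move: j; apply: ord2P.
split=> [g0|[w1E w2E]].
  by have [g1 g2] := (gE 0, gE 1); split; apply/eqP; rewrite -subr_eq0;
    [rewrite -[_ - _]g1|rewrite -[_ - _]g2]; rewrite g0 mxE.
apply/rowP; apply: ord2P; rewrite gE [RHS]mxE; apply/eqP; rewrite subr_eq0; apply/eqP;
  [exact: w1E|exact: w2E].
Unshelve. all: end_near.
Qed.
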